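(* Let $S^1=\mathcal{N}(\sigma_0^1,\ldots,\sigma_{m_1}^1)$ and $S^2=\mathcal{N}(\sigma_0^2,\ldots,\sigma_{m_2}^2)$ be two compatible Nikishin systems such that the first $2^k+1$ moments of $\sigma_k^i$, $k=1,\ldots,m_i$, $i=1,2$, are finite, and all the moments of $\sigma_0^2\,(=\sigma_0^1)$ are finite. Then the matrix $\widehat{\mathbb{S}}$ is mixed type perfect. For each $\mathbf{n}=(\mathbf{n}_1;\mathbf{n}_2)\in\mathbb{Z}_+^{m_1+1}\times\mathbb{Z}_+^{m_2+1}$ with $|\mathbf{n}_1|=|\mathbf{n}_2|+1$, the mixed type vector polynomial $\mathbb{A}_{\mathbf n}$ relative to $\widehat{\mathbb{S}}$ and $\mathbf{n}$ is uniquely determined up to a constant factor.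
   Context: Measures. For an interval $\Delta\subset\mathbb{R}$ (closed, bounded or unbounded), $\mathcal{M}(\Delta)$ is the class of finite Borel measures $s$ on $\mathbb{R}$ of constant sign whose support contains infinitely many points and such that $\mathrm{Co}(\operatorname{supp}s)=\Delta$, where $\mathrm{Co}(E)$ is the smallest interval containing $E$. Cauchy transform: $\widehat{s}(z)=\int\frac{ds(x)}{z-x}$. ''The first $N$ moments of $s$ are finite'' means $\int x^\nu ds(x)$, $\nu=0,\ldots,N-1$, are finite. Products. If $\Delta_\alpha,\Delta_\beta$ do not intersect or have at most a common end point, $\sigma_\alpha\in\mathcal{M}(\Delta_\alpha)$, $\sigma_\beta\in\mathcal{M}(\Delta_\beta)$ and $\widehat{\sigma}_\beta\in L_1(\sigma_\alpha)$, then $d\langle\sigma_\alpha,\sigma_\beta\rangle(x)=\widehat{\sigma}_\beta(x)d\sigma_\alpha(x)$. Inductively, $\langle\sigma_j,\ldots,\sigma_k\rangle=\langle\sigma_j,\langle\sigma_{j+1},\ldots,\sigma_k\rangle\rangle$. Nikishin system. Let $\Delta_j$, $j=0,\ldots,m$, be intervals such that for each $j\le m-1$ either $\Delta_j\cap\Delta_{j+1}=\emptyset$ or $\Delta_j\cap\Delta_{j+1}=\{x_{j,j+1}\}$ is a single point. Let $\sigma_j\in\mathcal{M}(\Delta_j)$ be such that $\langle\sigma_j,\ldots,\sigma_k\rangle$ is well defined and belongs to $\mathcal{M}(\Delta_j)$ for all $0\le j<k\le m$; when $\Delta_j\cap\Delta_{j+1}=\{x_{j,j+1}\}$, $x_{j,j+1}$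 is not a mass point of $\sigma_j$ nor of $\sigma_{j+1}$. With $s_{j,k}=\langle\sigma_j,\ldots,\sigma_k\rangle$ ($j<k$), $s_{j,j}=\sigma_j$, the system $(s_{0,0},\ldots,s_{0,m})=\mathcal{N}(\sigma_0,\ldots,\sigma_m)$ is the Nikishin system generated by $(\sigma_0,\ldots,\sigma_m)$. For the systems $S^i$, $i=1,2$, the corresponding measures are $s^i_{j,k}=\langle\sigma^i_j,\ldots,\sigma^i_k\rangle$. Compatibility and the matrix $\widehat{\mathbb{S}}$. Put $\mathbb{U}=(1,\widehat{s}^2_{1,1},\ldots,\widehat{s}^2_{1,m_2})$, $\mathbb{V}=(1,\widehat{s}^1_{1,1},\ldots,\widehat{s}^1_{1,m_1})$, $\mathbb{W}=\mathbb{U}^t\mathbb{V}$ (an $(m_2+1)\times(m_1+1)$ matrix). $S^1,S^2$ are compatible if $\sigma_0^1=\sigma_0^2$ and every entry of $\mathbb{W}$ is in $L_1(\sigma_0^2)$. Then $\widehat{\mathbb{S}}(z)=\int\frac{\mathbb{W}(x)d\sigma_0^2(x)}{z-x}$ (entrywise). Each entry is identified with its formal (asymptotic) expansion $\sum_{n\ge0}c_n z^{-n-1}$ at $\infty$, $c_n$ being the $n$-th moment of the corresponding measure. Mixed type vector polynomial, normality, perfectness. Let $\mathbf{n}_i=(n_{i,0},\ldots,n_{i,m_i})$, $|\mathbf{n}_1|=|\mathbf{n}_2|+1$, where $|\cdot|$ is the sum of the components. $\mathbb{A}_{\mathbf n}=(a_{\mathbf{n},0},\ldots,a_{\mathbf{n},m_1})$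 is a mixed type vector polynomial relative to an $(m_2+1)\times(m_1+1)$ matrix $\mathbb{F}$ of formal expansions at $\infty$ and $\mathbf{n}$ if: a) $\mathbb{A}_{\mathbf n}\not\equiv\mathbf{0}$ and $\deg a_{\mathbf{n},k}\le n_{1,k}-1$, $k=0,\ldots,m_1$ ($\deg\le-1$ means identically zero); b) for some vector polynomial $\mathbb{B}_{\mathbf n}$ with $m_2+1$ components, $(\mathbb{F}\mathbb{A}_{\mathbf n}^t-\mathbb{B}_{\mathbf n}^t)(z)=\left(\frac{A_{\mathbf{n},0}}{z^{n_{2,0}+1}}+\cdots,\ldots,\frac{A_{\mathbf{n},m_2}}{z^{n_{2,m_2}+1}}+\cdots\right)^t$ as formal expansions in decreasing powers of $z$. The multi-index $\mathbf{n}$ is mixed type normal if every such $\mathbb{A}_{\mathbf n}$ satisfies $\deg a_{\mathbf{n},k}=n_{1,k}-1$, $k=0,\ldots,m_1$ (with $\deg=-1$ meaning identically zero). $\mathbb{F}$ is mixed type perfect if all multi-indices in $\mathbb{Z}_+^{m_1+1}\times\mathbb{Z}_+^{m_2+1}$ with $|\mathbf{n}_1|=|\mathbf{n}_2|+1$ are mixed type normal. *)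

(* Defs.v *)
From HB Require Import structures.
From mathcomp Require Import all_boot all_order all_algebra.
From mathcomp Require Import all_classical all_reals all_analysis.
From mathcomp Require Import complex.

Set Implicit Arguments.
Unset Strict Implicit.
Unset Printing Implicit Defensive.

Import Order.TTheory GRing.Theory Num.Theory.
Import numFieldNormedType.Exports.

Local Open Scope classical_set_scope.
Local Open Scope charge_scope.
Local Open Scope ring_scope.
Local Open Scope complex_scope.

Notation bcharge R := (charge (measurableTypeR R) R).

(* A Hahn decomposition is unique up to null sets, so nothing below depends
   on which one is chosen. *)
Definition hahn_p (R : realType) (s : bcharge R) : set (measurableTypeR R) :=
  sval (cid (Hahn_decomposition s)).

Definition hahn_n (R : realType) (s : bcharge R) : set (measurableTypeR R) :=
  sval (cid (svalP (cid (Hahn_decomposition s)))).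

Lemma hahn_pn (R : realType) (s : bcharge R) :
  hahn_decomposition s (hahn_p s) (hahn_n s).
Proof. exact: svalP (cid (svalP (cid (Hahn_decomposition s)))). Qed.

Definition posp (R : realType) (s : bcharge R) := jordan_pos (hahn_pn s).
Definition negp (R : realType) (s : bcharge R) := jordan_neg (hahn_pn s).
Definition variation (R : realType) (s : bcharge R) :=
  charge_variation (hahn_pn s).

Definition L1 (R : realType) (s : bcharge R) (f : R -> R) : Prop :=
  (posp s).-integrable setT (EFin \o f) /\
  (negp s).-integrable setT (EFin \o f).

Definition cint (R : realType) (s : bcharge R) (f : R -> R) : R :=
  Rintegral (posp s) setT f - Rintegral (negp s) setT f.

Definition finite_moments (R : realType) (N : nat) (s : bcharge R) : Prop :=
  forall nu, (nu < N)%N -> L1 s (fun x => x ^+ nu).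

Definition supp (R : realType) (s : bcharge R) : set R :=
  [set x | forall U : set R, open_nbhs x U -> (0 < variation s U)%E].

Definition Co (R : realType) (E : set R) : set R := smallest (@is_interval R) E.

Definition classM (R : realType) (Delta : set R) (s : bcharge R) : Prop :=
  [/\ s.-positive_set setT \/ s.-negative_set setT,
      infinite_set (supp s) &
      Co (supp s) = Delta].

(* Cauchy transform at a real point.  The conventions [0^-1 = 0] and
   [integral = 0 on divergence] matter only on [Delta] itself; when [x] ranges
   over an adjacent interval this is at most the common end point, which is a
   null set by definition of a Nikishin system. *)
Definition cauchy (R : realType) (s : bcharge R) (x : R) : R :=
  cint s (fun t => (x - t)^-1).

(* The signed measure [f ds]; the null measure if [f] is not integrable. *)
Definition density (R : realType) (s : bcharge R) (f : R -> R) : bcharge R :=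
  match pselect (L1 s f) with
  | left h => cadd (induced_charge h.1) (cscale (-1) (induced_charge h.2))
  | right _ => czero
  end.

Definition cprod (R : realType) (s t : bcharge R) : bcharge R :=
  density s (cauchy t).

(* Generators are families indexed by [nat], of which a system of length
   [m.+1] only involves the members [0, ..., m]. *)
Fixpoint iter_cprod (R : realType) (sigma : nat -> bcharge R) (j d : nat) :
    bcharge R :=
  if d is d'.+1 then cprod (sigma j) (iter_cprod sigma j.+1 d') else sigma j.

(* s_{j,k}, for j <= k *)
Definition nik (R : realType) (sigma : nat -> bcharge R) (j k : nat) :
    bcharge R :=
  iter_cprod sigma j (k - j).

Definition nikishin (R : realType) (m : nat) (sigma : nat -> bcharge R) :
    Prop :=
  exists Delta : nat -> set R,
    [/\ forall j, (j <= m)%N ->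
          [/\ is_interval (Delta j), closed (Delta j) &
              classM (Delta j) (sigma j)],
        forall j, (j < m)%N ->
          Delta j `&` Delta j.+1 = set0 \/
          exists x : R, [/\ Delta j `&` Delta j.+1 = [set x],
                            sigma j [set x] = 0%E & sigma j.+1 [set x] = 0%E] &
        forall j k, (j < k <= m)%N ->
          L1 (sigma j) (cauchy (nik sigma j.+1 k)) /\
          classM (Delta j) (nik sigma j k)].

Definition hatrow (R : realType) (m : nat) (sigma : nat -> bcharge R) (x : R) :
    'rV[R]_m.+1 :=
  \row_(k < m.+1) if k == 0%N :> nat then 1 else cauchy (nik sigma 1 k) x.

Definition Wmx (R : realType) (m1 m2 : nat) (sigma1 sigma2 : nat -> bcharge R)
    (x : R) : 'M[R]_(m2.+1, m1.+1) :=
  (hatrow m2 sigma2 x)^T *m hatrow m1 sigma1 x.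

(* A charge is a function on all subsets, hence the restriction to measurable
   ones. *)
Definition compatible (R : realType) (m1 m2 : nat)
    (sigma1 sigma2 : nat -> bcharge R) : Prop :=
  (forall A : set (measurableTypeR R), measurable A ->
     sigma1 0%N A = sigma2 0%N A) /\
  (forall j k, L1 (sigma2 0%N) (fun x => Wmx m1 m2 sigma1 sigma2 x j k)).

(* [f p] is the coefficient of [z^p] *)
Definition fseries (K : fieldType) := int -> K.

(* \sum_(n >= 0) c_n z^(-n-1); recall that [Negz n] is [- n.+1] *)
Definition expansion (K : fieldType) (c : nat -> K) : fseries K :=
  fun p => if p is Negz n then c n else 0.

Definition fpoly (K : fieldType) (a : {poly K}) : fseries K :=
  fun p => if p is Posz n then a`_n else 0.

Definition fmul (K : fieldType) (f : fseries K) (a : {poly K}) : fseries K :=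
  fun p => \sum_(i < size a) f (p - i%:Z) * a`_i.

Definition Shat (R : realType) (m1 m2 : nat) (sigma1 sigma2 : nat -> bcharge R) :
    'M[fseries R[i]]_(m2.+1, m1.+1) :=
  \matrix_(j, k) expansion (fun n =>
    (cint (sigma2 0%N) (fun x => x ^+ n * Wmx m1 m2 sigma1 sigma2 x j k))%:C).

(* [deg a <= n - 1] is [size a <= n].  The last clause says that, in row [j],
   F A^t - B^t has no term [z^p] with [p > - (n2 j + 1)]. *)
Definition mixed_vector (K : fieldType) (p q : nat) (F : 'M[fseries K]_(q, p))
    (n1 : 'I_p -> nat) (n2 : 'I_q -> nat) (A : 'rV[{poly K}]_p) : Prop :=
  [/\ A != 0,
      forall k, (size (A ord0 k) <= n1 k)%N &
      exists B : 'rV[{poly K}]_q, forall (j : 'I_q) (e : int),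
        - (n2 j).+1%:Z < e ->
        \sum_(k < p) fmul (F j k) (A ord0 k) e - fpoly (B ord0 j) e = 0].

Definition mixed_normal (K : fieldType) (p q : nat) (F : 'M[fseries K]_(q, p))
    (n1 : 'I_p -> nat) (n2 : 'I_q -> nat) : Prop :=
  forall A, mixed_vector F n1 n2 A -> forall k, size (A ord0 k) = n1 k.

Definition mixed_perfect (K : fieldType) (p q : nat)
    (F : 'M[fseries K]_(q, p)) : Prop :=
  forall (n1 : 'I_p -> nat) (n2 : 'I_q -> nat),
    (\sum_k n1 k = (\sum_j n2 j).+1)%N -> mixed_normal F n1 n2.

(* Main.v *)
(** At finitely many points of [Delta_0], the functions of a Nikishin system
    depend on each generator only through finitely many integrals.  For these
    integrals a generator may be replaced by finitely many point masses of the
    same sign, located in any prescribed set of full measure: otherwise a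
    separating hyperplane would produce a non-negative function of zero mean.
    With atomic generators the functions become polynomials over a common
    denominator, and eliminating them one at a time, by Lagrange interpolation
    at the zeros of the eliminated one, shows that [\sum_k p_k w_k] with
    [size p_k <= n_k] cannot weakly alternate at more than [\sum_k n_k] points.

    In the mixed problem the common generator is made atomic as well.  If some
    [size a_k < n1 k], then [F = \sum_k a_k w1_k] has fewer than [\sum_j n2 j]
    sign changes on the atoms, so some combination [B = \sum_j b_j w2_j] with
    [size b_j <= n2 j] changes sign exactly there.  Orthogonality makes the
    integral of [B * F] vanish, so [F] vanishes at all the atoms: too many. *)

Require Import Defs.
From mathcomp Require Import all_boot all_order all_algebra.
From mathcomp Require Import all_classical all_reals all_analysis.
From mathcomp Require Import complex.
From mathcomp Require Import measurable_realfun.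
From mathcomp Require Import ring lra zify.

Import Order.TTheory GRing.Theory Num.Theory.
Local Open Scope ring_scope.

Set Implicit Arguments.
Unset Strict Implicit.
Unset Printing Implicit Defensive.

(** * Polynomials with prescribed zeros *)

Section PolyRoots.
Context {F : fieldType}.
Implicit Types (Y : seq F) (p : {poly F}).

(** After an elimination the functions need no longer be iterated Cauchy transforms of the atoms, so
    the induction runs over a larger class, the polynomials [npoly o J k]. They imitate minors:
    [npoly o J k] changes sign when [k] is exchanged with the head of [J], it satisfies the
    three-term relation [plucker], and its recursion is that relation solved for one term. The
    recursion divides, so exactness, degrees and position of the zeros have to be proved together
    ([good]): the zeros of each member are real, simple and in one interval, and at them the other
    members form the next system up to weights of one sign.

    Alternation is weak throughout, so that one bound controls sign changes and common zeros alike.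

    Adjacent intervals may touch and may be unbounded. The common end point is not charged, so it is
    removed from the sets of full measure in which atoms are chosen; the finitely many atoms of
    adjacent levels are then strictly separated. Their number can be prescribed from below, and it
    is taken so large that after all eliminations each member still has more zeros than the
    remaining form can alternate at. *)

Definition rootp Y : {poly F} := \prod_(y <- Y) ('X - y%:P).
Definition rootp' Y (y : F) : {poly F} := \prod_(z <- Y | z != y) ('X - z%:P).

Lemma size_rootp Y : size (rootp Y) = (size Y).+1.
Proof. exact: size_prod_XsubC. Qed.

Lemma rootp_neq0 Y : rootp Y != 0.
Proof. by rewrite -size_poly_eq0 size_rootp. Qed.

Lemma monic_rootp Y : rootp Y \is monic.
Proof. exact: monic_prod_XsubC. Qed.

Lemma rootpD1 Y y : uniq Y -> y \in Y -> rootp Y = ('X - y%:P) * rootp' Y y.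
Proof. by move=> uY yY; rewrite /rootp (bigD1_seq y). Qed.

Lemma rootp_root Y y : (rootp Y).[y] == 0 = (y \in Y).
Proof. by have := root_prod_XsubC Y y; rewrite /root. Qed.

Lemma rootp'_neq0 Y y : (rootp' Y y).[y] != 0.
Proof.
rewrite /rootp' horner_prod prodf_seq_neq0; apply/allP => z _.
by apply/implyP => zy; rewrite !hornerE subr_eq0 eq_sym.
Qed.

Lemma deriv_rootp Y y : uniq Y -> y \in Y ->
  (rootp Y)^`().[y] = (rootp' Y y).[y].
Proof.
move=> uY yY; rewrite (rootpD1 uY yY) derivM derivB derivX derivC !hornerE /=.
by rewrite subrr; ring.
Qed.

Lemma deriv_rootp_neq0 Y y : uniq Y -> y \in Y -> (rootp Y)^`().[y] != 0.
Proof. by move=> uY yY; rewrite deriv_rootp// rootp'_neq0. Qed.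

Lemma rootp'_root Y y z : z \in Y -> z != y -> (rootp' Y y).[z] = 0.
Proof.
move=> zY zy; rewrite /rootp' horner_prod -big_filter.
by apply/eqP; rewrite prodf_seq_eq0; apply/hasP; exists z;
  rewrite ?mem_filter ?zy ?zY//= !hornerE subrr.
Qed.

Lemma monic_rootp' Y y : rootp' Y y \is monic.
Proof. by rewrite /rootp' -big_filter monic_prod_XsubC. Qed.

Lemma size_rootp' Y y : uniq Y -> y \in Y -> size (rootp' Y y) = size Y.
Proof.
move=> uY yY; have := size_rootp Y.
rewrite (rootpD1 uY yY) size_monicM ?monicXsubC ?monic_neq0 ?monic_rootp' //.
by rewrite size_XsubC /= => -[].
Qed.

Lemma lagrange Y p : uniq Y -> (size p <= size Y)%N ->
  p = \sum_(y <- Y) (p.[y] / (rootp Y)^`().[y]) *: rootp' Y y.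
Proof.
move=> uY sp; apply/eqP; rewrite -subr_eq0; apply/eqP.
set q := (X in p - X); apply: (@roots_geq_poly_eq0 _ _ Y) => //.
  apply/allP => z zY; rewrite /root !hornerE /q horner_sum.
  rewrite (bigD1_seq z)//= big_seq_cond big1 => [|y /andP[yY yz]].
    rewrite addr0 !hornerE deriv_rootp// mulfVK ?rootp'_neq0 //.
    by rewrite subrr.
  by rewrite !hornerE rootp'_root ?mulr0 // eq_sym.
rewrite (leq_trans (size_polyD _ _))// geq_max sp size_polyN /q big_seq.
apply: (leq_trans (size_sum _ _ _)); apply/bigmax_leqP_seq => y yY _.
by rewrite (leq_trans (size_scale_leq _ _))// size_rootp'.
Qed.

(** Leading coefficients in Lagrange's formula, each [rootp' Y y] being monic. For [p] of smaller
    degree the sum is zero: the residues of [p / rootp Y] cancel. This is how orthogonality enters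
    the counting argument. *)
Lemma lagrange_coef Y p : uniq Y -> (size p <= size Y)%N ->
  \sum_(y <- Y) p.[y] / (rootp Y)^`().[y] = p`_(size Y).-1.
Proof.
move=> uY sp; rewrite [in RHS](lagrange uY sp) coef_sum.
rewrite !big_seq; apply: eq_bigr => y yY; rewrite coefZ.
have /monicP := monic_rootp' Y y; rewrite lead_coefE size_rootp'// => ->.
by rewrite mulr1.
Qed.

(** Partial fractions: [p / rootp Y] is the Cauchy transform of the discrete measure whose masses
    are its residues. *)
Lemma lagrange_horner Y p x : uniq Y -> (size p <= size Y)%N -> x \notin Y ->
  p.[x] = (rootp Y).[x] *
    \sum_(y <- Y) (p.[y] / (rootp Y)^`().[y]) / (x - y).
Proof.
move=> uY sp xY; rewrite {1}(lagrange uY sp) horner_sum mulr_sumr.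
rewrite !big_seq; apply: eq_bigr => y yY; rewrite (rootpD1 uY yY).
have : x - y != 0 by rewrite subr_eq0; apply: contraNneq xY => ->.
rewrite hornerM hornerZ hornerXsubC => h.
by rewrite [RHS]mulrC -!mulrA; congr (_ * (_ * _)); rewrite mulKf.
Qed.

End PolyRoots.

(** * Polynomials of constant sign on each side of an interval *)

Section Sides.
Context {R : rcfType}.
Implicit Types (lo hi x y z : R) (p q : {poly R}) (Y B : seq R).

Definition inside lo hi x := (lo <= x) && (x <= hi).

Definition side lo hi x y :=
  ((x < lo) && (y < lo)) || ((hi < x) && (hi < y)).

Lemma side_subr_gt0 lo hi x y b : lo <= hi -> inside lo hi b ->
  side lo hi x y -> 0 < (x - b) * (y - b).
Proof. by move=> ? /andP[? ?] /orP[/andP[? ?]|/andP[? ?]]; nra. Qed.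

Lemma side_sym lo hi x y : side lo hi x y = side lo hi y x.
Proof. by rewrite /side andbC [(hi < x) && _]andbC. Qed.

(** Products of two values avoid naming the sign, which may differ on the two half-lines; [csign] is
    encoded in the same way. *)
Definition offsign lo hi p := forall x y, side lo hi x y -> 0 < p.[x] * p.[y].

Definition csign (w : R -> R) Y := forall y z, y \in Y -> z \in Y -> 0 < w y * w z.

Lemma csign_neq0 w Y y : csign w Y -> y \in Y -> w y != 0.
Proof.
by move=> h yY; apply: contraTneq (h _ _ yY yY) => ->; rewrite mul0r ltxx.
Qed.

Lemma csignM w v Y : csign w Y -> csign v Y -> csign (fun y => w y * v y) Y.
Proof. by move=> hw hv y z yY zY; rewrite mulrACA mulr_gt0 ?hw ?hv. Qed.

Lemma csignV w Y : csign w Y -> csign (fun y => (w y)^-1) Y.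
Proof. by move=> hw y z yY zY; rewrite -invfM invr_gt0 hw. Qed.

Lemma csignN w Y : csign w Y -> csign (fun y => - w y) Y.
Proof. by move=> hw y z yY zY; rewrite mulrNN hw. Qed.

Lemma eq_csign w v Y : {in Y, w =1 v} -> csign w Y -> csign v Y.
Proof. by move=> e hw y z yY zY; rewrite -!e ?hw. Qed.

Lemma csignZ c w Y : c != 0 -> csign w Y -> csign (fun y => c * w y) Y.
Proof.
move=> c0 hw y z yY zY; rewrite mulrACA mulr_gt0 ?hw // -expr2.
by rewrite exprn_even_gt0.
Qed.

Lemma csign_sum (w v v' : R -> R) Y : Y != [::] -> csign w Y ->
  (forall y, y \in Y -> 0 < v y) -> (forall y, y \in Y -> 0 < v' y) ->
  0 < (\sum_(y <- Y) w y * v y) * (\sum_(y <- Y) w y * v' y).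
Proof.
case: Y => // y0 Y _ hw.
have pos u : (forall y, y \in y0 :: Y -> 0 < u y) ->
    0 < w y0 * \sum_(y <- y0 :: Y) w y * u y.
  move=> hu; rewrite mulr_sumr big_cons ltr_pwDl //.
    by rewrite mulrA mulr_gt0 ?hu ?hw ?mem_head.
  rewrite big_seq sumr_ge0 // => y yY.
  by rewrite mulrA ltW // mulr_gt0 ?hu ?hw ?mem_head // inE yY orbT.
move=> /pos h1 /pos h2; have := mulr_gt0 h1 h2; rewrite mulrACA pmulr_rgt0 //.
by rewrite hw ?mem_head.
Qed.

Lemma offsign_rootp lo hi Y : lo <= hi -> all (inside lo hi) Y ->
  offsign lo hi (rootp Y).
Proof.
move=> h /allP hY x y sxy; rewrite /rootp !horner_prod -big_split /=.
rewrite big_seq prodr_gt0 // => z /hY zin; rewrite !hornerE.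
exact: side_subr_gt0 sxy.
Qed.

Lemma offsignZ lo hi c p : c != 0 -> offsign lo hi p -> offsign lo hi (c *: p).
Proof.
move=> c0 hp x y s; rewrite !hornerZ mulrACA mulr_gt0 ?hp // -expr2.
by rewrite exprn_even_gt0.
Qed.

Lemma offsign_neq0 lo hi p : offsign lo hi p -> p != 0.
Proof.
move=> hp; have : 0 < p.[lo - 1] * p.[lo - 1].
  by apply: hp; apply/orP; left; rewrite ltrBlDr ltrDl ltr01.
by apply: contraTneq => ->; rewrite horner0 mul0r ltxx.
Qed.

Lemma offsign_root lo hi p y : lo <= hi -> offsign lo hi p -> root p y ->
  inside lo hi y.
Proof.
move=> h hp /rootP py; apply/negPn/negP; rewrite negb_and -!ltNge => s.
have : 0 < p.[y] * p.[y] by apply: hp; rewrite /side !andbb.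
by rewrite py mul0r ltxx.
Qed.

(** The sign condition says that [p / rootp Y] is the Cauchy transform of masses of one sign in
    [lo, hi]. Such a transform has no zero off the interval, and its total mass, which is the top
    coefficient of [p], does not vanish. *)
Lemma pure_offsign lo hi Y p : lo <= hi -> all (inside lo hi) Y -> uniq Y ->
  Y != [::] -> (size p <= size Y)%N ->
  csign (fun y => p.[y] * (rootp Y)^`().[y]) Y ->
  size p = size Y /\ offsign lo hi p.
Proof.
move=> h hY uY Y0 sp hs.
set w := fun y => p.[y] / (rootp Y)^`().[y].
have hw : csign w Y.
  apply: (@eq_csign (fun y => (p.[y] * (rootp Y)^`().[y]) *
            ((rootp Y)^`().[y] * (rootp Y)^`().[y])^-1)).
    by move=> y yY; rewrite /w; field; exact: deriv_rootp_neq0.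
  apply: csignM => //; apply: csignV => y z yY zY.
  rewrite -!expr2 mulr_gt0 // exprn_even_gt0 //= ?deriv_rootp_neq0 //.
split.
  apply/eqP; rewrite eqn_leq sp /= leqNgt; apply/negP => lt.
  have := lagrange_coef uY sp; rewrite nth_default; last first.
    by case: (size Y) lt.
  have := csign_sum Y0 hw (fun _ _ => ltr01) (fun _ _ => ltr01).
  under eq_bigr do rewrite mulr1.
  by move=> he h0; move: he; rewrite /w h0 mulr0 ltxx.
have notin x y : side lo hi x y -> x \notin Y.
  move=> s; apply/negP => /(allP hY) /andP[h1 h2].
  by case/orP: s => /andP[? _]; lra.
move=> x y s; rewrite (lagrange_horner uY sp (notin _ _ s)).
rewrite [p.[y]](lagrange_horner uY sp (notin y x _)); last by rewrite side_sym.
rewrite mulrACA mulr_gt0 //; first exact: (offsign_rootp h hY s).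
case/orP: s => /andP[hx hy].
  have pos u : u < lo -> forall y, y \in Y -> 0 < (y - u)^-1.
    by move=> ux z /(allP hY)/andP[? ?]; rewrite invr_gt0; lra.
  have fl u : \sum_(z <- Y) p.[z] / (rootp Y)^`().[z] / (u - z) =
     - \sum_(z <- Y) w z * (z - u)^-1.
    by rewrite -sumrN; apply: eq_bigr => z _; rewrite /w -mulrN -invrN opprB.
  by rewrite !fl mulrNN; apply: csign_sum; rewrite // => z; exact: pos.
have pos u : hi < u -> forall y, y \in Y -> 0 < (u - y)^-1.
  by move=> ux z /(allP hY)/andP[? ?]; rewrite invr_gt0; lra.
by apply: (@csign_sum w) => // z; exact: pos.
Qed.

End Sides.

(** * Interlacing of zeros *)

Section Interlacing.
Context {R : rcfType}.
Implicit Types (lo hi x y z : R) (p q : {poly R}) (Y B : seq R).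

Lemma deriv_rootp_lt0 B x y : uniq B -> x \in B -> y \in B -> x < y ->
  (forall z, z \in B -> (z <= x) || (y <= z)) ->
  (rootp B)^`().[x] * (rootp B)^`().[y] < 0.
Proof.
move=> uB xB yB xy gap; rewrite !deriv_rootp // /rootp' !horner_prod.
rewrite -big_filter (bigD1_seq y) ?filter_uniq ?mem_filter//=; last first.
  by rewrite yB gt_eqF.
rewrite -[X in _ * X]big_filter.
rewrite [X in _ * X](bigD1_seq x) ?filter_uniq ?mem_filter//=; last first.
  by rewrite xB lt_eqF.
rewrite !big_filter_cond; under [X in _ * (_ * X)]eq_bigl do rewrite andbC.
rewrite mulrACA -big_split /= pmulr_llt0; last first.
  rewrite big_seq_cond prodr_gt0 // => z /andP[zB /andP[zx zy]].
  rewrite !hornerXsubC.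
  have [z1|z1] := orP (gap z zB).
    have : z < x by rewrite lt_neqAle zx.
    by nra.
  have : y < z by rewrite lt_neqAle eq_sym zy.
  by nra.
by rewrite !hornerXsubC; nra.
Qed.

Lemma gap_roots p B : sorted <%R B ->
  (forall i, (i.+1 < size B)%N -> p.[B`_i] * p.[B`_i.+1] < 0) ->
  exists Y, [/\ uniq Y, size Y = (size B).-1, all (root p) Y &
    forall y, y \in Y -> B`_0 <= y <= B`_(size B).-1].
Proof.
move=> sB hB.
have mono i j : (i < size B)%N -> (j < size B)%N -> (i <= j)%N -> B`_i <= B`_j.
  move=> iB jB ij; have /andP[_ sB'] := lt_sorted_is_uniq_le sB.
  exact: (le_sorted_leq_nth 0 sB').
have /choice[f fP] i : exists x, (i.+1 < size B)%N ->
    [/\ B`_i < x, x < B`_i.+1 & root p x].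
  case: (ltnP i.+1 (size B)) => iB; last by exists 0.
  have [||x xi rx] := @polyrcf.poly_ivtoo _ p B`_i B`_i.+1.
  - by apply: mono => //; exact: ltnW.
  - exact: hB.
  by exists x => _; move: xi; rewrite in_itv /= => /andP[].
have idx i : (i < (size B).-1)%N -> (i.+1 < size B)%N by lia.
exists (mkseq f (size B).-1); split.
- apply: (@sorted_uniq _ <%R); [exact: lt_trans | exact: ltxx|].
  apply/(sortedP 0) => i; rewrite size_mkseq => iB.
  rewrite !nth_mkseq //; last exact: ltnW.
  have [_ h1 _] := fP i (idx _ (ltnW iB)).
  have [h2 _ _] := fP i.+1 (idx _ iB).
  exact: lt_trans h1 h2.
- by rewrite size_mkseq.
- by apply/allP => _ /mapP[i + ->]; rewrite mem_iota => /idx /fP[].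
- move=> _ /mapP[i + ->]; rewrite mem_iota /= => iB.
  have [h1 h2 _] := fP i (idx _ iB).
  rewrite (le_trans (mono 0%N i _ _ _) (ltW h1)); [|lia..].
  by rewrite (le_trans (ltW h2)) // mono //; lia.
Qed.

(** Subtracting a multiple of [rootp B] leaves the Wronskian unchanged and lowers the degree so that
    [lagrange] applies; the Wronskian of a Lagrange basis polynomial with [rootp B] is minus a
    square. *)
Let wronskian_rootp B p x : uniq B -> (size p <= (size B).+1)%N ->
  p^`().[x] * (rootp B).[x] - p.[x] * (rootp B)^`().[x] =
  - \sum_(b <- B) (p.[b] / (rootp B)^`().[b]) * (rootp' B b).[x] ^+ 2.
Proof.
move=> uB sp; set D := rootp B; set C := p`_(size B).
pose r := p - C *: D.
have rp : p = C *: D + r by rewrite /r addrC subrK.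
have lD : D`_(size B) = 1.
  by have /monicP := monic_rootp B; rewrite lead_coefE size_rootp.
have sr : (size r <= size B)%N.
  apply/leq_sizeP => j; rewrite leq_eqVlt => /orP[/eqP<-|jB].
    by rewrite /r coefB coefZ lD mulr1 subrr.
  rewrite /r coefB coefZ !nth_default ?mulr0 ?subrr ?size_rootp //.
  exact: leq_trans sp jB.
have rb b : b \in B -> r.[b] = p.[b].
  by rewrite -rootp_root => /eqP h; rewrite /r !hornerE h mulr0 subr0.
have -> : p^`().[x] * D.[x] - p.[x] * D^`().[x] =
          r^`().[x] * D.[x] - r.[x] * D^`().[x].
  move: rp; clearbody r D C => ->.
  by rewrite derivD derivZ !hornerD !hornerZ; ring.
rewrite {1 2}(lagrange uB sr) raddf_sum /= !horner_sum !mulr_suml.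
rewrite -sumrB -sumrN !big_seq; apply: eq_bigr => b bB.
rewrite rb //; move: (p.[b] / _) => w.
rewrite derivZ !hornerZ /D (rootpD1 uB bB) derivM derivB derivX derivC.
by rewrite subr0 mul1r hornerD !hornerM hornerXsubC; ring.
Qed.

(** Since the derivative of [rootp B] alternates along [B], so does [p], which yields a zero in each
    gap. The degree leaves room for at most one more zero, which is therefore real. The Wronskian
    with [rootp B] keeps one strict sign at the zeros of [p]; this makes them simple and gives the
    last conclusion. They lie in [lo, hi] by [offsign]. *)
Let interlace_sorted lo hi B p : lo <= hi -> all (inside lo hi) B ->
  sorted <%R B -> B != [::] -> (size p <= (size B).+1)%N -> offsign lo hi p ->
  csign (fun b => p.[b] * (rootp B)^`().[b]) B ->
  exists Y c, [/\ uniq Y, all (inside lo hi) Y, c != 0, p = c *: rootp Y &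
    csign (fun y => p^`().[y] * (rootp B).[y]) Y].
Proof.
move=> h hB sB B0 sp op cs.
have uB : uniq B := lt_sorted_uniq sB.
have p0 := offsign_neq0 op.
have nB y : root p y -> y \notin B.
  move=> /rootP py; apply/negP => yB; have := csign_neq0 cs yB.
  by rewrite py mul0r eqxx.
have cs' : csign (fun b => p.[b] / (rootp B)^`().[b]) B.
  apply: (@eq_csign _ (fun y => (p.[y] * (rootp B)^`().[y]) *
            ((rootp B)^`().[y] * (rootp B)^`().[y])^-1)).
    by move=> y yY; field; exact: deriv_rootp_neq0.
  apply: csignM => //; apply: csignV => y z yY zY.
  rewrite -!expr2 mulr_gt0 // exprn_even_gt0 //= ?deriv_rootp_neq0 //.
have pD x y : root p x -> root p y ->
    0 < (p^`().[x] * (rootp B).[x]) * (p^`().[y] * (rootp B).[y]).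
  move=> rx ry.
  have pos u : u \notin B -> forall b, b \in B -> 0 < (rootp' B b).[u] ^+ 2.
    move=> uNB b bB; rewrite exprn_even_gt0 //=.
    apply: contra uNB => /eqP r0; rewrite -rootp_root (rootpD1 uB bB) hornerM.
    by rewrite r0 mulr0.
  have := wronskian_rootp x uB sp; have := wronskian_rootp y uB sp.
  rewrite (rootP rx) (rootP ry) !mul0r !subr0 => -> ->.
  rewrite mulrNN; apply: (csign_sum B0 cs'); exact: pos (nB _ _).
have [|Y0 [uY0 sY0 rY0 _]] := @gap_roots p B sB.
  move=> i iB; have iB' := ltnW iB.
  have m1 := mem_nth 0 iB'; have m2 := mem_nth 0 iB.
  have lt : B`_i < B`_i.+1 by apply: (sortedP 0 sB).
  have gap z : z \in B -> (z <= B`_i) || (B`_i.+1 <= z).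
    move=> /(nthP 0)[j jB <-].
    have /andP[_ sB'] := lt_sorted_is_uniq_le sB.
    have mono := le_sorted_leq_nth 0 sB'.
    case: (leqP j i) => ji; first by rewrite (mono j i).
    by rewrite (mono i.+1 j) ?orbT.
  by have := deriv_rootp_lt0 uB m1 m2 lt gap; have := cs _ _ m1 m2; nra.
have [||u pE] := @uniq_roots_prod_XsubC _ p Y0; rewrite ?uniq_rootsE //.
rewrite -/(rootp Y0) in pE.
have u0 : u != 0 by apply: contraNneq p0 => u0; rewrite pE u0 mul0r.
have su : (size u <= 2)%N.
  move: sp; rewrite pE size_Mmonic ?monic_rootp // size_rootp sY0.
  have : (0 < size B)%N by rewrite lt0n size_eq0.
  by move: (size B) (size u) => b n; lia.
have fin Y c : uniq Y -> c != 0 -> p = c *: rootp Y ->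
  exists Y c, [/\ uniq Y, all (inside lo hi) Y, c != 0, p = c *: rootp Y &
    csign (fun y => p^`().[y] * (rootp B).[y]) Y].
  move=> uY c0 pY; exists Y, c.
  have rY y : y \in Y -> root p y.
    by rewrite pY rootZ // /root rootp_root.
  split => //; first by apply/allP => y /rY; exact: offsign_root.
  by move=> y z /rY + /rY; exact: pD.
case: (leqP (size u) 1) => [/size1_polyC uC|u2].
  apply: (fin Y0 u`_0) => //; first by apply: contraNneq u0 => e; rewrite uC e.
  by rewrite {1}pE {1}uC mul_polyC.
have {su u2} su : size u = 2 by lia.
pose z := - u`_0 / u`_1.
have u1 : u`_1 != 0.
  by have := lead_coef_eq0 u; rewrite lead_coefE su /= => ->.
have uz : root u z.
  rewrite /root horner_coef su !big_ord_recl big_ord0 /= /bump /= /z.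
  by apply/eqP; field.
have pz : root p z by rewrite pE rootM uz.
(* A repeated zero would be a zero of the derivative of [p], against [pD]. *)
have zY0 : z \notin Y0.
  apply/negP => zY; have := pD z z pz pz; suff -> : p^`().[z] = 0.
    by rewrite !mul0r ltxx.
  have /eqP Y0z : (rootp Y0).[z] == 0 by rewrite rootp_root.
  by rewrite pE derivM hornerD !hornerM Y0z (rootP uz) mulr0 mul0r addr0.
apply: (fin (z :: Y0) (lead_coef p)); first by rewrite /= zY0.
  by rewrite lead_coef_eq0.
apply: all_roots_prod_XsubC; last by rewrite uniq_rootsE /= zY0.
  by rewrite pE size_Mmonic ?monic_rootp // size_rootp su addnS.
by rewrite /= pz.
Qed.

Lemma interlace lo hi B p : lo <= hi -> all (inside lo hi) B ->
  uniq B -> B != [::] -> (size p <= (size B).+1)%N -> offsign lo hi p ->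
  csign (fun b => p.[b] * (rootp B)^`().[b]) B ->
  exists Y c, [/\ uniq Y, all (inside lo hi) Y, c != 0, p = c *: rootp Y &
    csign (fun y => p^`().[y] * (rootp B).[y]) Y].
Proof.
move=> h hB uB B0 sp op cs.
have pB : perm_eq (sort <=%R B) B by rewrite perm_sort.
have eB : rootp (sort <=%R B) = rootp B by apply: perm_big.
have := @interlace_sorted lo hi (sort <=%R B) p h.
rewrite eB (perm_all _ pB) sort_lt_sorted size_sort -size_eq0 size_sort size_eq0.
by apply => // y z; rewrite !(perm_mem pB); exact: cs.
Qed.

End Interlacing.

(** * Weak alternation *)

Section SignChanges.
Context {R : rcfType}.
Implicit Types (e x y : R) (f G : R -> R) (xs Y s z : seq R).

(** [e] is the sign expected at the head. The inequality is weak, so a zero of [f] fits either sign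
    and any list of zeros alternates. *)
Fixpoint alternates e f xs :=
  if xs is x :: xs' then (0 <= e * f x) && alternates (- e) f xs' else true.

Lemma alternates_take e f xs n : alternates e f xs -> alternates e f (take n xs).
Proof.
by elim: xs e n => // x xs IH e [|n] //= /andP[-> /IH ->].
Qed.

Lemma eq_alternates e f g xs : {in xs, f =1 g} ->
  alternates e f xs = alternates e g xs.
Proof.
elim: xs e => //= x xs IH e fg; rewrite fg ?mem_head // IH // => y yxs.
by rewrite fg // inE yxs orbT.
Qed.

Lemma rootp_cons x s : rootp (x :: s) = ('X - x%:P) * rootp s.
Proof. by rewrite /rootp big_cons. Qed.

Lemma rootp_left x s : (forall r, r \in s -> x < r) ->
  0 < (-1) ^+ size s * (rootp s).[x].
Proof.
elim: s => [|r s IH] h; first by rewrite /rootp big_nil hornerC mul1r.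
rewrite rootp_cons hornerM hornerXsubC /= exprS.
have := IH (fun t ts => h t (mem_behead (s := r :: s) ts)).
by have := h r (mem_head r s); nra.
Qed.

(** Along an increasing list the derivative of [rootp] alternates strictly and is positive at the
    last point, so the two alternations compensate. *)
Lemma alternates_deriv e f xs : sorted <%R xs -> alternates e f xs ->
  forall x, x \in xs ->
    0 <= e * (-1) ^+ (size xs).-1 * (f x / (rootp xs)^`().[x]).
Proof.
elim: xs e => // x xs IH e sx /= /andP[ef al] z.
have lt : forall r, r \in xs -> x < r.
  by move=> r rx; have /allP := order_path_min lt_trans sx; apply.
have sxs := path_sorted sx.
rewrite rootp_cons derivM derivB derivX derivC subr0 mul1r.
rewrite hornerD hornerM hornerXsubC inE => /orP[/eqP ->|zx].
  rewrite subrr mul0r addr0; have := rootp_left lt.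
  set u := _ ^+ _; have uu : u * u = 1 by rewrite -expr2 sqrr_sign.
  set w := _.[x] => uw; have w0 : w != 0.
    by apply: contraTneq uw => ->; rewrite mulr0 ltxx.
  have -> : e * u * (f x / w) = (e * f x) / (u * w).
    have u0 : u != 0 by apply: contraTneq uw => ->; rewrite mul0r ltxx.
    by field: uu; rewrite w0 u0.
  by rewrite divr_ge0 // ltW.
have := IH (- e) sxs al z zx; have /eqP -> : (rootp xs).[z] == 0 by rewrite rootp_root.
rewrite add0r; have xz := lt z zx.
case: xs zx sxs {IH lt sx al} => // y xs zx sxs /=.
rewrite exprS mulN1r; set u := _ ^+ _; set w := _.[z] => h.
rewrite invfM.
have -> : e * - u * (f z * ((z - x)^-1 / w)) = (z - x)^-1 * (- e * u * (f z / w)).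
  by ring.
by rewrite mulr_ge0 // invr_ge0 subr_ge0 ltW.
Qed.

(** [Y] is scanned from its right end, [e] being the sign of [G] at the head of the witness [z].
    Each new change point in [s] comes with a new entry of [z], so a bound on alternations of [G]
    along [z] bounds the degree of [rootp s]. *)
Lemma sign_changes (Q : R -> Prop) G Y :
  (forall x y, x < y -> exists2 r, x < r < y & Q r) ->
  sorted <%R Y -> has (fun y => G y != 0) Y ->
  exists s z e, [/\ sorted <%R s,
    forall r, r \in s -> [/\ Q r, r \notin Y, exists2 y, y \in Y & y < r &
                          exists2 y, y \in Y & r < y],
    [/\ subseq z Y, size z = (size s).+1, e * e = 1 & alternates e G z] &
    forall y, y \in Y -> 0 <= e * (-1) ^+ size s * ((rootp s).[y] * G y)].
Proof.
move=> dense; elim: Y => // y Y IH sY hG.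
have lt : forall r, r \in Y -> y < r.
  by move=> r rx; have /allP := order_path_min lt_trans sY; apply.
have sY' := path_sorted sY.
have [hY|] := boolP (has (fun y => G y != 0) Y); last first.
  move=> /hasPn hY; have {hG} Gy : G y != 0.
    move: hG => /= /orP[//|/hasP[x xY]]; by move: (hY x xY) => /negPn/eqP ->; rewrite eqxx.
  exists [::], [:: y], (Num.sg (G y)); split => //.
    split => //; first by rewrite sub1seq mem_head.
      by rewrite -expr2 sqr_sg Gy.
    by rewrite /= andbT -normrEsg.
  move=> x; rewrite /rootp big_nil hornerC expr0 mulr1 mul1r inE => /orP[/eqP->|xY].
    by rewrite -normrEsg.
  by move: (hY x xY) => /negPn/eqP ->; rewrite mulr0.
have [s [z [e [ss hs [zY sz ee al] sgn]]]] := IH sY' hY.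
have lts r : r \in s -> y < r.
  by move=> /hs[_ _ [w wY wr] _]; exact: lt_trans (lt w wY) wr.
have pos := rootp_left lts.
(* A value of the expected weak sign changes nothing. Otherwise a change point [r] goes between [y]
   and the head of [Y], and [y] joins [z]. *)
have [ge|lt0] := leP 0 (e * G y).
  exists s, z, e; split => //.
  - move=> r rs; have [Qr rY [a aY ar] [b bY rb]] := hs r rs; split => //.
    + by rewrite inE negb_or rY andbT gt_eqF // lts.
    + by exists a => //; rewrite inE aY orbT.
    + by exists b => //; rewrite inE bY orbT.
  - by split => //; rewrite (subseq_trans zY) // subseq_cons.
  move=> x; rewrite inE => /orP[/eqP ->|/sgn//].
  by move: pos; set u := _ ^+ _; set w := _.[y]; nra.
have Y0 : head 0 Y \in Y by case: (Y) hY => //= a Y1 _; exact: mem_head.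
have [r /andP[yr rY] Qr] := dense _ _ (lt _ Y0).
have rlt x : x \in Y -> r < x.
  move=> xY; apply: lt_le_trans rY _.
  case: (Y) xY sY' => // a Y1; rewrite inE => /orP[/eqP->//|aY1] /= pa.
  by apply: ltW; have /allP := order_path_min lt_trans pa; apply.
exists (r :: s), (y :: z), (- e); split.
- rewrite /= path_min_sorted //; apply/allP => t ts.
  by have [_ _ [w wY wt] _] := hs t ts; exact: lt_trans (rlt w wY) wt.
- move=> t; rewrite inE => /orP[/eqP ->|ts].
    split => //.
    + rewrite inE negb_or gt_eqF //=; apply/negP => /rlt; by rewrite ltxx.
    + by exists y; rewrite ?mem_head.
    + by exists (head 0 Y); rewrite ?inE ?Y0 ?orbT.
  have [Qt tY [a aY at_] [b bY tb]] := hs t ts; split => //.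
  + by rewrite inE negb_or tY andbT gt_eqF // lts.
  + by exists a => //; rewrite inE aY orbT.
  + by exists b => //; rewrite inE bY orbT.
- split; rewrite /= ?eqxx ?sz ?mulrNN ?opprK ?al ?andbT //.
  by rewrite mulNr oppr_ge0 ltW.
move=> x; rewrite rootp_cons hornerM hornerXsubC /= exprS !mulN1r mulrNN.
rewrite inE => /orP[/eqP ->|xY].
  move: pos; set u := _ ^+ _; set w := _.[y] => uw.
  have -> : e * u * ((y - r) * w * G y) = (u * w) * ((r - y) * - (e * G y)) by ring.
  rewrite mulr_ge0 ?(ltW uw) // mulr_ge0 ?subr_ge0 ?(ltW yr) //.
  by rewrite oppr_ge0 ltW.
have -> : e * (-1) ^+ size s * ((x - r) * (rootp s).[x] * G x) =
   (x - r) * (e * (-1) ^+ size s * ((rootp s).[x] * G x)) by ring.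
by rewrite mulr_ge0 ?sgn // subr_ge0 ltW // rlt.
Qed.

Lemma alternates0 e f xs : {in xs, forall x, f x = 0} -> alternates e f xs.
Proof.
elim: xs e => //= x xs IH e h; rewrite h ?mem_head // mulr0 lexx IH // => y yxs.
by rewrite h // inE yxs orbT.
Qed.

Lemma seq_max xs : xs != [::] -> exists2 w, w \in xs & forall x, x \in xs -> x <= w.
Proof.
elim: xs => // x [|y xs] IH _; first by exists x; rewrite ?mem_head // => y /[!inE] /eqP ->.
have [//|w wxs hw] := IH; have [xw|wx] := leP x w.
  by exists w => [|z]; [exact: (@mem_behead _ (x :: _))|rewrite inE => /orP[/eqP->|/hw]].
exists x; rewrite ?mem_head // => z; rewrite inE => /orP[/eqP->//|/hw zw].
exact: le_trans zw (ltW wx).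
Qed.

Lemma seq_min xs : xs != [::] -> exists2 w, w \in xs & forall x, x \in xs -> w <= x.
Proof.
elim: xs => // x [|y xs] IH _; first by exists x; rewrite ?mem_head // => y /[!inE] /eqP ->.
have [//|w wxs hw] := IH; have [wx|xw] := leP w x.
  by exists w => [|z]; [exact: (@mem_behead _ (x :: _))|rewrite inE => /orP[/eqP->|/hw]].
exists x; rewrite ?mem_head // => z; rewrite inE => /orP[/eqP->//|/hw zw].
exact: le_trans (ltW xw) zw.
Qed.

Lemma rootp_cat xs Y : rootp (xs ++ Y) = rootp xs * rootp Y.
Proof. exact: big_cat. Qed.

Lemma ge0_sum_gt0 (g : R -> R) Y y0 : (forall y, y \in Y -> 0 <= g y) ->
  y0 \in Y -> g y0 != 0 -> 0 < \sum_(y <- Y) g y.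
Proof.
move=> g0 yY gy; rewrite lt0r big_seq sumr_ge0 // andbT psumr_eq0 //.
by apply/negP => /allP/(_ y0 yY); rewrite yY /= (negPf gy).
Qed.

End SignChanges.

(** * Elimination in atomic Nikishin systems *)

Lemma filter_predAC (T : Type) (a b : pred T) (s : seq T) :
  seq.filter a (seq.filter b s) = seq.filter b (seq.filter a s).
Proof. by rewrite -!filter_predI; apply: eq_filter => x /=; rewrite andbC. Qed.

Lemma deg_bound_cons b1 b2 l0 l1 s y : (b1 <= b2)%N -> (y.+1 = l1 + b2)%N ->
  ((s + l0 <= l0 + y) || (s + l0 <= (l0 + b1 + l1).-1))%N -> (s <= y)%N.
Proof. lia. Qed.

Lemma deg_bound_form m1 m2 m3 m4 m5 : (m1 <= m3)%N -> (m3 + m2 <= m4 + m5.+1)%N ->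
  ((m1 + m2).-1 <= m4 + m5)%N.
Proof. lia. Qed.

Lemma deg_bound_mul m1 m2 m3 m4 m5 : (m1 <= m3.+1)%N -> (m2 <= m4 + m5)%N ->
  ((m1 + m2).-1 <= m4 + m3 + m5)%N.
Proof. lia. Qed.

Lemma card_bound_zeros N' N T L M l j y : (N' <= N -> l <= y.+1 -> N <= T ->
  T + M.+3 < L -> L <= l + j -> j < M.+1 -> N' < y)%N.
Proof. lia. Qed.

Lemma card_bound_size L y l b j : (L <= l + j -> y.+1 = l + b -> b <= 1 -> L <= y + j.+1)%N.
Proof. lia. Qed.

Lemma sub_lt_step m j d : (m - j <= d -> j < m -> m - j.+1 < d)%N.
Proof. lia. Qed.

Section NikishinPolynomials.
Context {R : rcfType}.
Variables (A : nat -> seq R) (c : nat -> R -> R).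

Definition atomp o : {poly R} := rootp (A o).

(* [rootp (A o.+1)] times the iterated Cauchy transform of the levels
   [o.+1, ..., o + d]; see [basep_atomcauchy]. *)
Fixpoint basep d o : {poly R} :=
  if d is d'.+1 then
    \sum_(a <- A o.+1) (c o.+1 a * (basep d' o.+1).[a] / (atomp o.+2).[a])
      *: rootp' (A o.+1) a
  else atomp o.+1.

(* Member [k] of the system of level [o] after elimination of the members in [J].
   The division is exact, and the sign for [o \in J] makes the result alternating in [J]. *)
Fixpoint npoly_rec n o (J : seq nat) k : {poly R} :=
  match n, J with
  | n'.+1, i :: J' =>
    if o \in J then (-1) ^+ (index o J).+1 *: npoly_rec n' o.+1 (rem o J) k
    else if k == o then npoly_rec n' o.+1 J' i
    else (npoly_rec n' o J' k * npoly_rec n' o.+1 J' i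
          - npoly_rec n' o J' i * npoly_rec n' o.+1 J' k) %/ npoly_rec n' o J' o
  | _, _ => basep (k - o) o
  end.

Definition npoly o J k := npoly_rec (size J) o J k.

Lemma npoly_nil o k : npoly o [::] k = basep (k - o) o.
Proof. by []. Qed.

Lemma npoly_in o J k : o \in J ->
  npoly o J k = (-1) ^+ (index o J).+1 *: npoly o.+1 (rem o J) k.
Proof.
case: J => // i J oJ; rewrite /npoly [in LHS]/= oJ size_rem //.
Qed.

Lemma npoly_base o i J : o \notin i :: J -> npoly o (i :: J) o = npoly o.+1 J i.
Proof. by move=> oJ; rewrite /npoly /= (negPf oJ) eqxx. Qed.

Lemma npoly_cons o i J k : o \notin i :: J -> k != o ->
  npoly o (i :: J) k = (npoly o J k * npoly o.+1 J i
                        - npoly o J i * npoly o.+1 J k) %/ npoly o J o.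
Proof. by move=> oJ ko; rewrite /npoly /= (negPf oJ) (negPf ko). Qed.

Lemma npoly_head o J k : npoly o (o :: J) k = - npoly o.+1 J k.
Proof. by rewrite npoly_in ?mem_head //= eqxx expr1 scaleN1r. Qed.

Lemma npoly_in2 o i J k : o \in J -> i != o ->
  npoly o (i :: J) k = - ((-1) ^+ (index o J).+1 *: npoly o.+1 (i :: rem o J) k).
Proof.
move=> oJ io; rewrite npoly_in ?inE ?oJ ?orbT //= (negPf io).
by rewrite exprS mulN1r scaleNr.
Qed.

Lemma npoly_second o i J k : i != o -> npoly o [:: i, o & J] k = npoly o.+1 (i :: J) k.
Proof.
move=> io; rewrite npoly_in ?inE ?eqxx ?orbT //= (negPf io) eqxx.
by rewrite expr2 mulrNN mulr1 scale1r.
Qed.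

Lemma npolyC o J a b : a != b -> a \notin J -> b \notin J ->
  npoly o (a :: J) b = - npoly o (b :: J) a.
Proof.
have [n] := ubnP (size J); elim: n => // n IH in o J *.
rewrite ltnS => sJ ab aJ bJ.
have [oJ|oJ] := boolP (o \in J).
  have ao : a != o by apply: contraNneq aJ => ->.
  have bo : b != o by apply: contraNneq bJ => ->.
  rewrite (npoly_in2 _ oJ ao) (npoly_in2 _ oJ bo).
  rewrite IH //; first by rewrite scalerN.
  - by rewrite size_rem //; case: (J) oJ sJ => //=.
  - by apply: contra aJ; exact: mem_rem.
  - by apply: contra bJ; exact: mem_rem.
have [ao|ao] := eqVneq a o.
  by rewrite ao npoly_head npoly_base // inE negb_or oJ -ao ab.
have [bo|bo] := eqVneq b o.
  by rewrite bo npoly_head npoly_base ?opprK // inE negb_or oJ -bo eq_sym ab.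
have oaJ : o \notin a :: J by rewrite inE negb_or eq_sym ao.
have obJ : o \notin b :: J by rewrite inE negb_or eq_sym bo.
rewrite !npoly_cons //.
by rewrite -divpN opprB [npoly o J a * _]mulrC [npoly o J b * _]mulrC.
Qed.

Variables (lo hi : nat -> R) (M L : nat).
Hypothesis uA : forall i, uniq (A i).
Hypothesis inA : forall i, all (inside (lo i) (hi i)) (A i).
Hypothesis lohi : forall i, lo i <= hi i.
Hypothesis sep : forall i, (hi i < lo i.+1) || (hi i.+1 < lo i).
Hypothesis csA : forall i, csign (c i) (A i).
Hypothesis szA : forall i, (L <= size (A i))%N.
Hypothesis ML : (M.+1 < L)%N.

(** Index of the interval that carries the zeros of all [npoly o J k]: every elimination moves them
    one interval further. *)
Definition level o (J : seq nat) := (o + size J).+1.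

(* At the zeros of member [i] the other members reduce, up to weights of
   constant sign, to the system with [i] eliminated. *)
Definition chart o J i := exists (Y : seq R) (th : R -> R) (e : R),
  [/\ uniq Y, all (inside (lo (level o J)) (hi (level o J))) Y, e != 0,
      npoly o J i = e *: rootp Y & csign th Y /\
      forall k y, (o <= k <= M)%N -> k \notin i :: J -> y \in Y ->
        (npoly o J k).[y] =
        (npoly o J i)^`().[y] * th y * (npoly o (i :: J) k).[y]].

Definition offall o J := forall k, (o <= k <= M)%N -> k \notin J ->
  offsign (lo (level o J)) (hi (level o J)) (npoly o J k).

(** Only two sizes occur, as for [J = [::]], where the base member [rootp (A o.+1)] has one zero
    more than the numerators of the transforms. The bound on [l] records that an elimination costs
    at most one zero. *)
Definition sizeall o J := exists l, (L <= l + size J)%N /\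
  forall k, (o <= k <= M)%N -> k \notin J ->
    size (npoly o J k) = (l + (k <= o + size J))%N.

Definition good o J := [/\ offall o J, sizeall o J &
  forall i, (o <= i <= M)%N -> i \notin J -> chart o J i].

Definition valid o J := uniq J && all (fun j => (o <= j <= M)%N) J.

Lemma side_next i y z : inside (lo i.+1) (hi i.+1) y ->
  inside (lo i.+1) (hi i.+1) z -> side (lo i) (hi i) y z.
Proof.
move=> /andP[y1 y2] /andP[z1 z2]; apply/orP.
by case/orP: (sep i) => s; [right|left]; apply/andP; split; lra.
Qed.

Lemma side_prev i y z : inside (lo i) (hi i) y ->
  inside (lo i) (hi i) z -> side (lo i.+1) (hi i.+1) y z.
Proof.
move=> /andP[y1 y2] /andP[z1 z2]; apply/orP.
by case/orP: (sep i) => s; [left|right]; apply/andP; split; lra.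
Qed.

Lemma csign_next i p Y : offsign (lo i) (hi i) p ->
  all (inside (lo i.+1) (hi i.+1)) Y -> csign (horner p) Y.
Proof. by move=> op /allP hY y z /hY yi /hY zi; apply/op/side_next. Qed.

Lemma csign_prev i p Y : offsign (lo i.+1) (hi i.+1) p ->
  all (inside (lo i) (hi i)) Y -> csign (horner p) Y.
Proof. by move=> op /allP hY y z /hY yi /hY zi; apply/op/side_prev. Qed.

(** At a zero of member [o], members [k] and [i] are the same multiple of what remains after
    eliminating [o], which by [npoly_head] is the system of level [o.+1] up to sign. Hence the
    numerator vanishes there, and these zeros are simple. *)
Lemma chart_div o J i k : (o <= M)%N -> i \notin J -> o \notin i :: J -> k \notin o :: i :: J ->
  (o <= i <= M)%N -> (o <= k <= M)%N -> chart o J o ->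
  npoly o (i :: J) k * npoly o J o =
  npoly o J k * npoly o.+1 J i - npoly o J i * npoly o.+1 J k.
Proof.
move=> oM iJ oJ kJ iM kM [B [th [e [uB _ e0 NE [_ H]]]]].
move: oJ kJ; rewrite !inE !negb_or => /andP[oi oJ] /and3P[ko ki kJ].
rewrite npoly_cons ?inE ?negb_or ?oi //.
rewrite divpK // NE dvdpZl // /rootp; apply: uniq_roots_dvdp; last first.
  by rewrite uniq_rootsE.
apply/allP => b bB; rewrite /root hornerD hornerN !hornerM.
have kJ' : k \notin o :: J by rewrite inE negb_or ko.
have iJ' : i \notin o :: J by rewrite inE negb_or eq_sym oi iJ.
rewrite (H k b) // (H i b) //.
by rewrite !npoly_head !hornerN; apply/eqP; ring.
Qed.

Definition goodle r := forall o J,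
  (o <= M.+1)%N -> valid o J -> (size J <= r)%N -> good o J.

Lemma in_next o i : o != i -> (o <= i <= M)%N -> (o < i <= M)%N.
Proof. by move=> oi /andP[h ->]; rewrite ltn_neqAle oi h. Qed.

Lemma validS o i J : valid o (i :: J) -> valid o J.
Proof. by rewrite /valid /= => /andP[/andP[_ ->] /andP[_ ->]]. Qed.

Lemma valid_next o J : valid o J -> o \notin J -> valid o.+1 J.
Proof.
move=> /andP[uJ /allP hJ] oJ; rewrite /valid uJ; apply/allP => j jJ.
have /andP[oj ->] := hJ j jJ; rewrite andbT ltn_neqAle oj andbT.
by apply: contraNneq oJ => ->.
Qed.

Lemma valid_le o j J : valid o J -> j \in J -> (o <= j <= M)%N.
Proof. by move=> /andP[_ /allP]; apply. Qed.

Lemma good_neq0 o J k : good o J -> (o <= k <= M)%N -> k \notin J ->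
  npoly o J k != 0.
Proof. by move=> [H _ _] kM kJ; apply: offsign_neq0 (H k kM kJ). Qed.

Lemma valid_rem o j J : valid o J -> valid o (rem j J).
Proof.
move=> /andP[uJ /allP hJ]; rewrite /valid rem_uniq //=.
by apply/allP => i /mem_rem; exact: hJ.
Qed.

Lemma good_div r o J i k : goodle r -> (size J <= r)%N -> (o <= M)%N ->
  valid o (i :: J) -> o \notin i :: J -> k \notin o :: i :: J ->
  (o <= k <= M)%N ->
  npoly o (i :: J) k * npoly o J o =
  npoly o J k * npoly o.+1 J i - npoly o J i * npoly o.+1 J k.
Proof.
move=> G sJ oM vJ oJ kJ kM; apply: chart_div => //.
- by case/andP: vJ => /= /andP[].
- by apply: valid_le vJ _; rewrite mem_head.
have [_ _] := G o J (leqW oM) (validS vJ) sJ; apply; first by rewrite leqnn.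
by move: oJ; rewrite inE negb_or => /andP[].
Qed.

(** The three-term relation between minors. If [o] is [a], [b] or [k], it is the recursion itself;
    if [o \in J], it comes from level [o.+1]. Otherwise, multiplied by [npoly o J o], each
    eliminated member is replaced through [good_div], and everything cancels. *)
Lemma plucker r o J a b k : goodle r -> (size J <= r)%N -> (o <= M)%N ->
  valid o [:: a, b, k & J] ->
  npoly o J a * npoly o (b :: J) k - npoly o J b * npoly o (a :: J) k
  - npoly o (b :: J) a * npoly o J k = 0.
Proof.
move=> G; have [n] := ubnP (size J); elim: n => // n IH in o J *.
rewrite ltnS => sn sJ oM v.
have := v; rewrite /valid /= !inE !negb_or.
case/andP=> /and4P[/and3P[ab ak aJ] /andP[bk bJ] kJ uJ].
case/and4P=> aM bM kM JM.
have ba : b != a by rewrite eq_sym.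
have ka : k != a by rewrite eq_sym.
have kb : k != b by rewrite eq_sym.
have [oJ|oJ] := boolP (o \in J).
  have [ao bo ko] : [/\ a != o, b != o & k != o].
    by split; [move: aJ | move: bJ | move: kJ]; apply: contraNneq => ->.
  have lto i : (o <= i <= M)%N -> i != o -> (o < i <= M)%N.
    by move=> iM io; apply: in_next iM; rewrite eq_sym.
  have e : npoly o.+1 (rem o J) a * npoly o.+1 (b :: rem o J) k -
      npoly o.+1 (rem o J) b * npoly o.+1 (a :: rem o J) k -
      npoly o.+1 (b :: rem o J) a * npoly o.+1 (rem o J) k = 0.
    have sr : ((size (rem o J)).+1 = size J)%N.
      by rewrite size_rem // prednK //; case: (J) oJ.
    apply: IH; [lia|lia| |].
      by have /andP[] := lto a aM ao; exact: leq_trans.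
    rewrite /valid /= !inE !negb_or ab ak bk rem_uniq // !lto //=.
    rewrite !(contra (@mem_rem _ _ _ _)) //=.
    apply/allP => j; rewrite mem_rem_uniq // inE => /andP[jo jJ].
    by apply: lto => //; exact: (allP JM).
  rewrite (npoly_in2 _ oJ ao) !(npoly_in2 _ oJ bo) !(npoly_in _ oJ) -!mul_polyC.
  set u := (_ ^+ _)%:P.
  by rewrite -[RHS](mulr0 (- u ^+ 2)) -e; ring.
have gJ : good o J.
  by apply: G => //; [exact: leqW|do 3 apply: validS; exact: v].
have dv i j : [&& o != i, i \notin J, o != j, i != j & j \notin J] ->
    (o <= i <= M)%N -> (o <= j <= M)%N ->
    npoly o (i :: J) j * npoly o J o =
    npoly o J j * npoly o.+1 J i - npoly o J i * npoly o.+1 J j.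
  case/and5P=> oi iJ oj ij jJ iM jM; apply: (good_div G) => //.
  - by rewrite /valid /= iJ uJ iM JM.
  - by rewrite inE negb_or oi.
  - by rewrite !inE !negb_or [j == o]eq_sym oj [j == i]eq_sym ij.
have [ao|ao] := eqVneq o a.
  have := dv b k; rewrite ao ab ak bJ bk kJ => /(_ isT).
  rewrite -ao bM kM => /(_ isT isT) e.
  rewrite npoly_head npoly_base ?inE ?negb_or ?oJ ?ao ?ab //.
  rewrite -ao mulrC e; ring.
have [bo|bo] := eqVneq o b.
  have := dv a k; rewrite bo ba ak aJ bk kJ => /(_ isT).
  rewrite -bo aM kM => /(_ isT isT) e.
  rewrite !npoly_head [npoly o J o * _]mulrC e; ring.
have [ko|ko] := eqVneq o k.
  have := dv b a; rewrite bo bJ ao ba aJ aM bM => /(_ isT isT isT).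
  rewrite -ko => e.
  by rewrite !npoly_base ?inE ?negb_or ?oJ ?ao ?bo // e; ring.
have N0 : npoly o J o != 0 by apply: good_neq0 => //; rewrite leqnn.
apply: (mulIf N0); rewrite mul0r.
have := dv b k; rewrite bo bJ ko bk kJ bM kM => /(_ isT isT isT) e1.
have := dv a k; rewrite ao aJ ko ak kJ aM kM => /(_ isT isT isT) e2.
have := dv b a; rewrite bo bJ ao ba aJ aM bM => /(_ isT isT isT) e3.
rewrite !mulrBl -!mulrA [npoly o J k * npoly o J o]mulrC.
rewrite [npoly o (b :: J) a * _]mulrA e1 e2 e3; ring.
Qed.

(** In the generic case, multiplication by [npoly o J o] leads to an expression with one elimination
    at level [o.+1] only ([key]). By [npolyC] that expression changes sign when its two indices are
    exchanged. *)
Lemma npoly_swap r o J a b k : goodle r -> (size J < r)%N -> (o <= M)%N ->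
  valid o [:: a, b, k & J] ->
  npoly o [:: a, b & J] k = - npoly o [:: b, a & J] k.
Proof.
move=> G; have [n] := ubnP (size J); elim: n => // n IH in o J *.
rewrite ltnS => sn sJ oM v.
have := v; rewrite /valid /= !inE !negb_or.
case/andP=> /and4P[/and3P[ab ak aJ] /andP[bk bJ] kJ uJ].
case/and4P=> aM bM kM JM.
have ba : b != a by rewrite eq_sym.
have ka : k != a by rewrite eq_sym.
have kb : k != b by rewrite eq_sym.
have [oJ|oJ] := boolP (o \in J).
  have [ao bo ko] : [/\ a != o, b != o & k != o].
    by split; [move: aJ | move: bJ | move: kJ]; apply: contraNneq => ->.
  have lto i : (o <= i <= M)%N -> i != o -> (o < i <= M)%N.
    by move=> iM io; apply: in_next iM; rewrite eq_sym.
  have e : npoly o.+1 [:: a, b & rem o J] k = - npoly o.+1 [:: b, a & rem o J] k.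
    have sr : ((size (rem o J)).+1 = size J)%N.
      by rewrite size_rem // prednK //; case: (J) oJ.
    apply: IH; [lia|lia| |].
      by have /andP[] := lto a aM ao; exact: leq_trans.
    rewrite /valid /= !inE !negb_or ab ak bk rem_uniq // !lto //=.
    rewrite !(contra (@mem_rem _ _ _ _)) //=.
    apply/allP => j; rewrite mem_rem_uniq // inE => /andP[jo jJ].
    by apply: lto => //; exact: (allP JM).
  have oabJ : o \in [:: a, b & J] by rewrite !inE oJ !orbT.
  have obaJ : o \in [:: b, a & J] by rewrite !inE oJ !orbT.
  rewrite (npoly_in _ oabJ) (npoly_in _ obaJ) /= (negPf ao) (negPf bo) /=.
  by rewrite e scalerN.
have [ao|ao] := eqVneq o a.
  by rewrite ao npoly_head npoly_second.
have [bo|bo] := eqVneq o b.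
  by rewrite bo npoly_head npoly_second // opprK.
have oab : o \notin [:: a, b & J] by rewrite !inE !negb_or ao bo.
have oba : o \notin [:: b, a & J] by rewrite !inE !negb_or ao bo.
have [ko|ko] := eqVneq o k.
  by rewrite -ko !npoly_base // npolyC.
have vb : valid o (b :: J) by rewrite /valid /= bJ uJ bM JM.
have va : valid o (a :: J) by rewrite /valid /= aJ uJ aM JM.
have ob : o \notin b :: J by rewrite inE negb_or bo.
have oa : o \notin a :: J by rewrite inE negb_or ao.
have oM1 : (o < M.+1)%N by [].
have gt : good o.+1 J.
  by apply: G => //; [apply: (valid_next _ oJ); exact: validS vb|exact: ltnW].
have lto i : o != i -> (o <= i <= M)%N -> (o < i <= M)%N := @in_next o i.
have gJ : good o J by apply: G; [exact: leqW | exact: validS vb | exact: ltnW].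
have N0 : npoly o J o != 0 by apply: good_neq0 => //; rewrite leqnn.
have ta0 : npoly o.+1 J a != 0 by apply: good_neq0 => //; exact: lto.
have tb0 : npoly o.+1 J b != 0 by apply: good_neq0 => //; exact: lto.
have oM2 : (o.+1 <= M)%N.
  by have /andP[] := lto a ao aM; exact: leq_trans.
have key x y : o != x -> o != y -> x != y -> x != k -> y != k ->
    x \notin J -> y \notin J -> (o <= x <= M)%N -> (o <= y <= M)%N ->
    npoly o [:: x, y & J] k * npoly o J o =
    npoly o J k * npoly o.+1 (y :: J) x - npoly o J x * npoly o.+1 (y :: J) k
    + npoly o J y * npoly o.+1 (x :: J) k.
  move=> xo yo xy xk yk xJ yJ xM yM.
  have vxy : valid o [:: x, y & J].
    by rewrite /valid /= inE negb_or xy xJ yJ uJ xM yM.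
  have oxy : o \notin [:: x, y & J] by rewrite !inE !negb_or xo yo.
  have oy : o \notin y :: J by rewrite inE negb_or yo.
  have koxy : k \notin [:: o, x, y & J].
    by rewrite !inE !negb_or kJ eq_sym ko eq_sym xk eq_sym yk.
  have koy : k \notin [:: o, y & J].
    by rewrite !inE !negb_or kJ eq_sym ko eq_sym yk.
  have xoy : x \notin [:: o, y & J].
    by rewrite !inE !negb_or xJ eq_sym xo xy.
  have d1 := good_div G (sJ : (size (y :: J) <= r)%N) oM vxy oxy koxy kM.
  have d2 := good_div G (ltnW sJ) oM (validS vxy) oy koy kM.
  have d3 := good_div G (ltnW sJ) oM (validS vxy) oy xoy xM.
  rewrite npoly_base // in d1.
  have tx0 : npoly o.+1 J x != 0 by apply: good_neq0 => //; exact: lto.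
  have ty0 : npoly o.+1 J y != 0 by apply: good_neq0 => //; exact: lto.
  (* Expanding the double elimination leaves a denominator [npoly o.+1 J y]; the relation at level
     [o.+1] makes it cancel. *)
  have pl := @plucker r o.+1 J x y k G (ltnW sJ) oM2.
  have {}pl := pl _; move: pl.
  rewrite {1}/valid /= !inE !negb_or xy xk xJ yk yJ kJ uJ /=.
  rewrite (in_next xo xM) (in_next yo yM) (in_next ko kM) /=.
  have -> : all (fun j => (o < j <= M)%N) J.
    apply/allP => j jJ; apply: lto; last exact: (allP JM).
    by apply: contraNneq oJ => ->.
  move=> /(_ isT) pl; apply: (mulIf ty0).
  rewrite mulrAC d1 mulrBl.
  have -> : npoly o (y :: J) k * npoly o.+1 (y :: J) x * npoly o J o =
    (npoly o (y :: J) k * npoly o J o) * npoly o.+1 (y :: J) x by ring.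
  have -> : npoly o (y :: J) x * npoly o.+1 (y :: J) k * npoly o J o =
    (npoly o (y :: J) x * npoly o J o) * npoly o.+1 (y :: J) k by ring.
  rewrite d2 d3.
  by rewrite -[RHS]addr0 -[in RHS](mulr0 (npoly o J y)) -pl; ring.
apply: (mulIf N0); rewrite mulNr key // (key b a) //.
by rewrite (npolyC _ ab aJ bJ); ring.
Qed.

Lemma sign_neq0 n : (-1) ^+ n != 0 :> R.
Proof. by rewrite expf_neq0 // oppr_eq0 oner_neq0. Qed.

(** In the recursion the numerator acquires the factor [s * t] and the denominator [s], so only the
    factor of level [o.+1] survives. *)
Lemma npoly_scale r o J1 J2 i k s t : goodle r -> (size J1 <= r)%N ->
  (size J2 <= r)%N -> (o <= M)%N -> valid o (i :: J1) -> valid o (i :: J2) ->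
  J1 =i J2 -> o \notin i :: J1 -> k \notin i :: J1 -> (o <= k <= M)%N ->
  (forall k, (o <= k <= M)%N -> k \notin J1 -> npoly o J1 k = s *: npoly o J2 k) ->
  (forall k, (o < k <= M)%N -> k \notin J1 ->
     npoly o.+1 J1 k = t *: npoly o.+1 J2 k) ->
  npoly o (i :: J1) k = t *: npoly o (i :: J2) k.
Proof.
move=> G s1 s2 oM v1 v2 e12 oJ kJ kM hs ht.
have oJ2 : o \notin i :: J2 by move: oJ; rewrite !inE e12.
have := oJ; rewrite inE negb_or => /andP[oi oJ1].
have := kJ; rewrite inE negb_or => /andP[ki kJ1].
have iM : (o <= i <= M)%N by apply: (valid_le v1); rewrite mem_head.
have iM' : (o < i <= M)%N := in_next oi iM.
have iJ1 : i \notin J1 by case/andP: v1 => /= /andP[].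
have [ko|ko] := eqVneq k o; first by rewrite ko !npoly_base // ht.
have kM' : (o < k <= M)%N by apply: in_next kM; rewrite eq_sym.
have k1 : k \notin [:: o, i & J1] by rewrite inE negb_or ko.
have k2 : k \notin [:: o, i & J2] by move: k1; rewrite !inE e12.
have N0 : npoly o J1 o != 0.
  apply: good_neq0 => //; last by rewrite leqnn.
  by apply: G => //; [exact: leqW|exact: validS v1].
apply: (mulIf N0); rewrite (good_div G s1) //.
rewrite [in RHS]hs ?leqnn // -scalerAl -scalerAr scalerA.
rewrite (good_div G s2) // (hs k) // (hs i) // (ht k) // (ht i) //.
by rewrite -!mul_polyC rmorphM /=; ring.
Qed.

(** Up to a scalar common to all [k], any eliminated index can be treated as the last one
    eliminated. Inductively [j] is brought to the front of the tail, at levels [o] and [o.+1], and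
    then swapped with the head. *)
Lemma npoly_move r o J j : goodle r -> (size J <= r.+1)%N -> (o <= M.+1)%N ->
  valid o J -> j \in J -> exists2 s : R, s != 0 & forall k, (o <= k <= M)%N ->
    k \notin J -> npoly o J k = s *: npoly o (j :: rem j J) k.
Proof.
move=> G; have [n] := ubnP (size J); elim: n => // n IH in o J *.
rewrite ltnS => sn sJ oM v jJ.
have jM := valid_le v jJ; have {}oM : (o <= M)%N by lia.
have [uJ JM] := andP v.
have sr i : i \in J -> ((size (rem i J)).+1 = size J)%N.
  by move=> iJ; rewrite size_rem // prednK //; case: (J) iJ.
have [oJ|oJ] := boolP (o \in J).
  have vr : valid o.+1 (rem o J).
    by apply: valid_next (valid_rem _ v) _; rewrite mem_rem_uniqF.
  have [jo|jo] := eqVneq j o.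
    exists (- (-1) ^+ (index o J).+1); first by rewrite oppr_eq0 sign_neq0.
    by move=> k kM kJ; rewrite jo npoly_head npoly_in // scalerN scaleNr opprK.
  have jr : j \in rem o J by rewrite mem_rem_uniq // inE jo.
  have sro := sr _ oJ.
  have [|||s s0 hs] := IH o.+1 (rem o J) _ _ _ vr jr; [lia|lia|by []|].
  have orj : o \in rem j J by rewrite mem_rem_uniq // inE eq_sym jo.
  exists (- ((-1) ^+ (index o J).+1 * s / (-1) ^+ (index o (rem j J)).+1)).
    by rewrite oppr_eq0 !mulf_neq0 ?invr_neq0 ?sign_neq0.
  move=> k kM kJ; rewrite npoly_in // hs; last first.
  - by apply: contra kJ; exact: mem_rem.
  - by apply: in_next => //; apply: contraNneq kJ => <-.
  have -> : npoly o (j :: rem j J) k =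
      - ((-1) ^+ (index o (rem j J)).+1 *: npoly o.+1 (j :: rem j (rem o J)) k).
    by rewrite npoly_in2 // !rem_filter ?filter_uniq // filter_predAC.
  rewrite scalerN scaleNr opprK !scalerA; congr (_ *: _).
  by rewrite mulrVK // unitfE sign_neq0.
case: J => // i J in sn sJ v jJ jM uJ JM sr oJ *.
have [->|ij] := eqVneq i j.
  by exists 1; rewrite ?oner_neq0 //= eqxx => k _ _; rewrite scale1r.
have {}jJ : j \in J by move: jJ; rewrite inE eq_sym (negPf ij).
have vJ := validS v; rewrite /= (negPf ij).
have [oi oJ1] : o != i /\ o \notin J.
  by move: oJ; rewrite inE negb_or => /andP[].
have vJ1 := valid_next vJ oJ1.
have [|||s s0 hs] := IH o J _ _ _ vJ jJ; [by []|by apply: ltnW|by apply: leqW|].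
have [|||t t0 ht] := IH o.+1 J _ _ _ vJ1 jJ; [by []|by apply: ltnW|by []|].
exists (- t); first by rewrite oppr_eq0.
move=> k kM kJ.
have jin : j \in i :: J by rewrite inE jJ orbT.
have uJ' : uniq J by case/andP: vJ.
have sJ' : (size (j :: rem j J) <= r)%N.
  by move: sJ; rewrite /= ltnS size_rem // prednK //; case: (J) jJ.
have iJ : i \notin J by case/andP: uJ.
have [ki kJ1] : k != i /\ k \notin J.
  by move: kJ; rewrite inE negb_or => /andP[].
have krJ : k \notin rem j J by apply: contra kJ1; exact: mem_rem.
have iM : (o <= i <= M)%N by apply: (valid_le v); rewrite mem_head.
have irJ : i \notin rem j J by apply: contra iJ; exact: mem_rem.
have kj : k != j by apply: contraNneq kJ1 => ->.
have jrJ : j \notin rem j J by rewrite mem_rem_uniqF.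
have JMr : all (fun j => (o <= j <= M)%N) (rem j J).
  by apply/allP => l /mem_rem lJ; exact: (valid_le vJ).
have v2 : valid o [:: j, i, k & rem j J].
  rewrite /valid /= !inE !negb_or [j == i]eq_sym ij [j == k]eq_sym kj jrJ.
  by rewrite [i == k]eq_sym ki irJ krJ rem_uniq // jM iM kM JMr.
rewrite scaleNr -scalerN -(npoly_swap G (_ : size (rem j J) < r)%N oM); last 2 first.
- exact: sJ'.
- rewrite /valid /= !inE !negb_or ij irJ [i == k]eq_sym ki [j == k]eq_sym kj jrJ.
  by rewrite krJ rem_uniq // jM iM kM JMr.
apply: (npoly_scale (s := s) G) => //.
- rewrite /valid /= inE negb_or ij irJ jrJ rem_uniq //= iM jM JMr //.
- by move=> l; rewrite inE mem_rem_uniq // inE; case: eqVneq => // ->.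
Qed.
(** At the zeros of the base member, the values of member [i] are given by [npoly o.+1 J i], whose
    zeros lie in the next interval and whose sign is therefore constant there. So [interlace] gives
    the zeros of member [i] and the sign of its derivative against the base member. *)
Lemma charts_from_base o J : (o <= M)%N -> o \notin J -> valid o J ->
  offall o J -> offall o.+1 J -> (1 < size (npoly o J o))%N ->
  (forall k, (o <= k <= M)%N -> k \notin J ->
     (size (npoly o J k) <= size (npoly o J o))%N) ->
  chart o J o -> forall i, (o <= i <= M)%N -> i \notin J -> chart o J i.
Proof.
move=> oM oJ v off off1 s1 sk cho i iM iJ.
have [->//|io] := eqVneq i o.
have [B [th [e [uB inB e0 NE [cth H]]]]] := cho.
have sB : size (npoly o J o) = (size B).+1 by rewrite NE size_scale ?size_rootp.
have B0 : B != [::] by rewrite -size_eq0 -lt0n; move: s1; rewrite sB.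
have oi : o != i by rewrite eq_sym.
have iM1 := in_next oi iM.
have offt := off1 i iM1 iJ.
have lvl : level o.+1 J = (level o J).+1 by rewrite /level addSn.
rewrite lvl in offt.
have ioJ : i \notin o :: J by rewrite inE negb_or io.
have csB : csign (fun b => (npoly o J i).[b] * (rootp B)^`().[b]) B.
  apply: (@eq_csign _ (fun b => (- e * (th b * (npoly o.+1 J i).[b])) *
    ((rootp B)^`().[b] * (rootp B)^`().[b]))).
    move=> b bB; rewrite (H i b) // npoly_head NE derivZ hornerZ hornerN; ring.
  apply: csignM; last first.
    by move=> y z yB zB; rewrite mulr_gt0 // -expr2 exprn_even_gt0 //=
      deriv_rootp_neq0.
  apply: csignZ; first by rewrite oppr_eq0.
  by apply: csignM => //; exact: csign_prev offt inB.
have sNi : (size (npoly o J i) <= (size B).+1)%N by rewrite -sB sk.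
have [Y [e' [uY inY e'0 NiE csY]]] :=
  interlace (lohi _) inB uB B0 sNi (off i iM iJ) csB.
have cst : csign (horner (npoly o.+1 J i)) Y by exact: csign_prev offt inY.
have csd : csign (fun y => (npoly o J i)^`().[y] * (npoly o J i)^`().[y]) Y.
  move=> y z yY zY; rewrite mulr_gt0 // -expr2 exprn_even_gt0 //=.
    by apply: contraTneq (csign_neq0 csY yY) => ->; rewrite mul0r eqxx.
  by apply: contraTneq (csign_neq0 csY zY) => ->; rewrite mul0r eqxx.
(* By [chart_div], at a zero of member [i] the ratio of [npoly o J k] to [npoly o (i :: J) k] is
   [npoly o J o] over [npoly o.+1 J i]. The weight is this quotient divided by the derivative of
   member [i]; inserting the square of the derivative exhibits a product whose sign is known from
   [csY]. *)
exists Y, (fun y => e * ((npoly o J i)^`().[y] * (rootp B).[y]) *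
  ((npoly o.+1 J i).[y] * ((npoly o J i)^`().[y] * (npoly o J i)^`().[y]))^-1), e'.
split=> //; split.
  apply: csignM; first exact: csignZ.
  by apply: csignV; exact: csignM.
move=> k y kM kiJ yY.
have t0 := csign_neq0 cst yY.
have d0 : (npoly o J i)^`().[y] != 0.
  by apply: contraTneq (csign_neq0 csY yY) => ->; rewrite mul0r eqxx.
have D0 : (rootp B).[y] != 0.
  by apply: contraTneq (csign_neq0 csY yY) => ->; rewrite mulr0 eqxx.
have oiJ : o \notin i :: J by rewrite inE negb_or oi.
have [ko|ko] := eqVneq k o.
  by rewrite ko npoly_base // NE hornerZ; field; rewrite t0 d0.
have Niy : (npoly o J i).[y] = 0.
  by rewrite NiE hornerZ; have := rootp_root Y y; rewrite yY => /eqP ->; rewrite mulr0.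
have koiJ : k \notin [:: o, i & J] by rewrite inE negb_or ko kiJ.
have /(congr1 (fun p => p.[y])) := chart_div oM iJ oiJ koiJ iM kM cho.
rewrite NE !hornerM hornerD hornerN !hornerM hornerZ Niy mul0r subr0 => q.
apply: (mulIf t0); rewrite -q; field; by rewrite t0 d0.
Qed.

Lemma valid_size o J : valid o J -> (size J <= M.+1)%N.
Proof.
move=> /andP[uJ JM]; rewrite -[M.+1](size_iota 0); apply: uniq_leq_size => // j.
by move=> /(allP JM) /andP[_ jM]; rewrite mem_iota add0n ltnS.
Qed.

(** Downward induction on the level. For [k > o], dividing by [rootp (A o.+1)] gives the Cauchy
    transform of masses on [A o.+1] which have one sign, because the members of level [o.+1] have no
    zeros in the interval of these atoms; thus [pure_offsign] applies. *)
Lemma good_nil o : (o <= M.+1)%N -> good o [::].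
Proof.
move=> oM; have [n] := ubnP (M.+1 - o); elim: n => // n IH in o oM *.
rewrite ltnS => on.
have [oM1|oM1] := eqVneq o M.+1.
  have no k : ~ (o <= k <= M)%N by rewrite oM1 => /andP[/leq_trans h /h]; rewrite ltnn.
  split; [by move=> k /no|exists L|by move=> k /no].
  by rewrite addn0; split => // k /no.
have {}oM : (o <= M)%N by rewrite -ltnS ltn_neqAle oM1.
have [off1 _ _] : good o.+1 [::] by apply: IH => //; lia.
have lvl : level o [::] = o.+1 by rewrite /level addn0.
have lvl1 : level o.+1 [::] = o.+2 by rewrite /level addn0.
have No : npoly o [::] o = rootp (A o.+1) by rewrite npoly_nil subnn.
have An : A o.+1 != [::].
  by rewrite -size_eq0 -lt0n (leq_trans _ (szA _)) // (leq_trans _ ML).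
have cso k : (o < k <= M)%N -> csign (horner (npoly o.+1 [::] k)) (A o.+1).
  move=> kM; have := off1 k kM; rewrite lvl1 => /(_ isT) h.
  exact: csign_prev h (inA _).
have cso1 : csign (horner (npoly o.+1 [::] o.+1)) (A o.+1).
  rewrite npoly_nil subnn; apply: csign_prev (inA _).
  by apply: offsign_rootp.
have val k a : (o < k <= M)%N -> a \in A o.+1 -> (npoly o [::] k).[a] =
    (rootp (A o.+1))^`().[a] *
    (c o.+1 a * (npoly o.+1 [::] k).[a] / (npoly o.+1 [::] o.+1).[a]).
  move=> kM aA; rewrite npoly_nil; have -> : (k - o = (k - o.+1).+1)%N by lia.
  rewrite /= horner_sum (bigD1_seq a) //= big1 => [|b ba]; last first.
    by rewrite hornerZ rootp'_root ?mulr0 // eq_sym.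
  rewrite addr0 hornerZ deriv_rootp // !npoly_nil subnn /= mulrC.
  by congr (_ * _).
have sz k : (o < k <= M)%N -> (size (npoly o [::] k) <= size (A o.+1))%N.
  move=> kM; rewrite npoly_nil; have -> : (k - o = (k - o.+1).+1)%N by lia.
  rewrite /= big_seq; apply: (leq_trans (size_sum _ _ _)).
  apply/bigmax_leqP_seq => a aA _.
  by rewrite (leq_trans (size_scale_leq _ _)) // size_rootp'.
have pure k : (o < k <= M)%N -> size (npoly o [::] k) = size (A o.+1) /\
    offsign (lo o.+1) (hi o.+1) (npoly o [::] k).
  move=> kM; apply: pure_offsign => //; first exact: sz.
  apply: (@eq_csign _ (fun a => (c o.+1 a * (npoly o.+1 [::] k).[a] *
     ((npoly o.+1 [::] o.+1).[a])^-1) *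
      ((rootp (A o.+1))^`().[a] * (rootp (A o.+1))^`().[a]))).
    by move=> a aA; rewrite val //; ring.
  apply: csignM; last first.
    by move=> y z yB zB; rewrite mulr_gt0 // -expr2 exprn_even_gt0 //=
      deriv_rootp_neq0.
  apply: csignM; last exact: csignV.
  by apply: csignM => //; exact: cso.
have off : offall o [::].
  move=> k kM _; rewrite lvl; have [->|ko] := eqVneq k o.
    by rewrite No; apply: offsign_rootp.
  by apply: (pure k _).2; apply: in_next kM; rewrite eq_sym.
split=> //.
  exists (size (A o.+1)); rewrite /= !addn0; split => // k kM _.
  have [->|ko] := eqVneq k o; first by rewrite No size_rootp leqnn addn1.
  have /andP[h1 h2] : (o < k <= M)%N by apply: in_next kM; rewrite eq_sym.
  by rewrite (pure k _).1 ?h1 // leqNgt h1 addn0.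
apply: charts_from_base => //.
- by rewrite No size_rootp ltnS lt0n size_eq0.
- move=> k kM _; have [->//|ko] := eqVneq k o.
  by rewrite No size_rootp leqW // sz //; apply: in_next kM; rewrite eq_sym.
exists (A o.+1), (fun a => - (c o.+1 a / (npoly o.+1 [::] o.+1).[a])), 1.
rewrite lvl scale1r; split => //.
split; first by apply: csignN; apply: csignM => //; exact: csignV.
move=> k a kM ko aA; rewrite npoly_head hornerN val //; last first.
  by apply: in_next kM; move: ko; rewrite inE eq_sym.
by rewrite No; ring.
Qed.

Lemma good_in o J : (o <= M)%N -> valid o J -> o \in J ->
  good o.+1 (rem o J) -> good o J.
Proof.
move=> oM v oJ [off [l [Ll szl]] ch].
have sr : ((size (rem o J)).+1 = size J)%N.
  by rewrite size_rem // prednK //; case: (J) oJ.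
have lvl : level o.+1 (rem o J) = level o J by rewrite /level -sr addSnnS.
have kok k : (o <= k <= M)%N -> k \notin J -> (o < k <= M)%N /\ k \notin rem o J.
  move=> kM kJ; split; last by apply: contra kJ; exact: mem_rem.
  by apply: in_next kM; apply: contraNneq kJ => <-.
split.
- move=> k kM kJ; have [kM1 kJ1] := kok k kM kJ.
  rewrite npoly_in //; apply: offsignZ; first exact: sign_neq0.
  by rewrite -lvl; exact: off.
- exists l; split; first by rewrite -sr addnS leqW.
  move=> k kM kJ; have [kM1 kJ1] := kok k kM kJ.
  by rewrite npoly_in // size_scale ?sign_neq0 // szl // -sr addSnnS.
move=> i iM iJ; have [iM1 iJ1] := kok i iM iJ.
have io : i != o by apply: contraNneq iJ => ->.
have [Y [th [e [uY inY e0 NE [cth H]]]]] := ch i iM1 iJ1.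
set s := (-1) ^+ (index o J).+1 : R.
have s0 : s != 0 by exact: sign_neq0.
have ss : s * s = 1 by rewrite -expr2 sqrr_sign.
exists Y, (fun y => - s * th y), (s * e); rewrite -lvl; split => //.
- by rewrite mulf_neq0.
- by rewrite npoly_in // NE scalerA.
split; first by apply: csignZ; rewrite ?oppr_eq0.
move=> k y kM kiJ yY; have kJ : k \notin J.
  by move: kiJ; rewrite inE negb_or => /andP[].
have ki : k != i by move: kiJ; rewrite inE negb_or => /andP[].
have [kM1 kJ1] := kok k kM kJ.
rewrite npoly_in // (npoly_in i) // npoly_in2 // derivZ hornerN !hornerZ -/s.
rewrite (H k y) // ?inE ?negb_or ?ki //.
set d := _^`().[y]; set w := (npoly o.+1 (i :: _) k).[y].
by rewrite -[LHS]mul1r -ss; ring.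
Qed.

(** The new base member is [npoly o.+1 J i], with zeros [Y]. At [Y] one term of the recursion drops
    out, and the rest says that a new member divided by the base has residues of one sign. For [k]
    beyond [o + size (i :: J)] the degree is small enough for [pure_offsign]. *)
Lemma good_cons_high o i J : (o <= M)%N -> valid o (i :: J) -> o \notin i :: J ->
  good o J -> good o.+1 J -> offall o.+1 (i :: J) ->
  [/\ (L <= (size (npoly o.+1 J i)).-1 + (size J).+1)%N,
    (1 < size (npoly o.+1 J i))%N, chart o (i :: J) o &
    forall k, (o + size (i :: J) < k <= M)%N -> k \notin i :: J ->
      offsign (lo (level o (i :: J))) (hi (level o (i :: J)))
        (npoly o (i :: J) k) /\
      (size (npoly o (i :: J) k) = (size (npoly o.+1 J i)).-1)%N].
Proof.
move=> oM v oiJ [off [l0 [Ll0 sz0]] ch] [off1 [l1 [Ll1 sz1]] ch1] off2.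
have := oiJ; rewrite inE negb_or => /andP[oi oJ].
have iM : (o <= i <= M)%N by apply: (valid_le v); rewrite mem_head.
have iM1 := in_next oi iM.
have iJ : i \notin J by case/andP: v => /= /andP[].
have [Y [th [e [uY inY e0 NE [cth H]]]]] := ch1 i iM1 iJ.
have lvl : level o.+1 J = (level o J).+1 by rewrite /level addSn.
have lvl2 : level o (i :: J) = (level o J).+1 by rewrite /level /= addnS.
have lvl3 : level o.+1 (i :: J) = (level o J).+2 by rewrite /level /= addSn addnS.
have sY : size (npoly o.+1 J i) = (size Y).+1 by rewrite NE size_scale ?size_rootp.
have LY : (L <= size Y + (size J).+1)%N.
  by apply: card_bound_size Ll1 _ (leq_b1 (i <= o.+1 + size J)%N); rewrite -sY sz1.
have sJ := valid_size v; rewrite /= in sJ.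
have Y0 : Y != [::].
  rewrite -size_eq0 -lt0n -(ltn_add2r (size J).+1) add0n.
  by rewrite (leq_ltn_trans sJ) // (leq_trans ML).
have oY : npoly o (i :: J) o = e *: rootp Y by rewrite npoly_base.
rewrite lvl in inY.
have csi : csign (horner (npoly o J i)) Y.
  exact: csign_next (off i iM iJ) inY.
have oo : (o <= o <= M)%N by rewrite leqnn.
have cso : csign (horner (npoly o J o)) Y.
  exact: csign_next (off o oo oJ) inY.
pose om y := th y * ((npoly o J i).[y] / (npoly o J o).[y]).
have com : csign om Y by do 2 apply: csignM => //; exact: csignV.
have val k y : (o < k <= M)%N -> k \notin i :: J -> y \in Y ->
    (npoly o (i :: J) k).[y] =
    - ((npoly o (i :: J) o)^`().[y] * om y * (npoly o.+1 (i :: J) k).[y]).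
  move=> kM kiJ yY; have /andP[ok kM'] := kM.
  have kM2 : (o <= k <= M)%N by rewrite ltnW.
  have koiJ : k \notin [:: o, i & J] by rewrite inE negb_or kiJ gtn_eqF.
  have /(congr1 (fun p => p.[y])) := chart_div oM iJ oiJ koiJ iM kM2 (ch o oo oJ).
  rewrite !hornerM hornerD hornerN !hornerM (H k y) // NE hornerZ.
  have := rootp_root Y y; rewrite yY => /eqP ->; rewrite !mulr0 add0r => q.
  have N0 := csign_neq0 cso yY.
  apply: (mulIf N0); rewrite q oY /om; set d := _^`().[y].
  by field.
have cs2 k : (o < k <= M)%N -> k \notin i :: J ->
    csign (horner (npoly o.+1 (i :: J) k)) Y.
  by move=> kM kiJ; have := off2 k kM kiJ; rewrite lvl3 => h; exact: csign_prev h inY.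
have hs k : (o + size (i :: J) < k <= M)%N -> k \notin i :: J ->
      (o < k <= M)%N /\ (size (npoly o (i :: J) k) <= size Y)%N.
  move=> /andP[hk kM'] kiJ.
  have ok : (o < k)%N by apply: leq_ltn_trans hk; rewrite leq_addr.
  have kM : (o < k <= M)%N by rewrite ok.
  have kM2 : (o <= k <= M)%N by rewrite ltnW.
  split => //.
  have kJ : k \notin J by move: kiJ; rewrite inE negb_or => /andP[].
  have koiJ : k \notin [:: o, i & J] by rewrite inE negb_or kiJ gtn_eqF.
  have [->|n0] := eqVneq (npoly o (i :: J) k) 0; first by rewrite size_poly0.
  have dv := chart_div oM iJ oiJ koiJ iM kM2 (ch o oo oJ).
  have No0 : npoly o J o != 0 := offsign_neq0 (off o oo oJ).
  have {dv} : (size (npoly o (i :: J) k * npoly o J o)%R <=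
    maxn (size (npoly o J k) + size (npoly o.+1 J i)).-1
         (size (npoly o J i) + size (npoly o.+1 J k)).-1)%N.
    rewrite dv (leq_trans (size_polyD _ _)) // size_polyN.
    by rewrite geq_max !leq_max !size_polyMleq orbT.
  (* For such [k] neither [npoly o J k] nor [npoly o.+1 J k] has the larger of the two sizes in
     [sizeall], which saves the one degree that [pure_offsign] requires. *)
  have := sz1 i iM1 iJ; rewrite size_mul // sY (sz0 o) // leq_addr.
  rewrite (sz0 k) // (sz0 i) // (sz1 k) //.
  have h1 : ((o + size J).+1 < k)%N by move: hk; rewrite /= addnS.
  have -> : (k <= o + size J)%N = false by rewrite leqNgt ltnW.
  have -> : (k <= o.+1 + size J)%N = false by rewrite leqNgt addSn h1.
  have : ((i <= o + size J) <= (i <= o.+1 + size J))%N.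
    by case: (leqP i (o + size J)) => // h; rewrite addSn leqW.
  move: (nat_of_bool (i <= o + _)%N) (nat_of_bool (i <= o.+1 + _)%N) => b1 b2.
  rewrite !addn0 addn1 !addnS /= leq_max.
  exact: deg_bound_cons.
split=> //.
- by rewrite sY.
- by rewrite sY ltnS lt0n size_eq0.
- exists Y, (fun y => om y), e; rewrite lvl2; split => //; split => //.
  move=> k y kM koiJ yY; rewrite npoly_head hornerN mulrN val //.
    by apply: in_next kM; move: koiJ; rewrite inE negb_or eq_sym => /andP[].
  by move: koiJ; rewrite inE negb_or => /andP[].
move=> k kh kiJ; have [kM sk] := hs k kh kiJ; rewrite lvl2 sY /=.
suff [] : size (npoly o (i :: J) k) = size Y /\
    offsign (lo (level o J).+1) (hi (level o J).+1) (npoly o (i :: J) k) by [].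
apply: pure_offsign => //.
apply: (@eq_csign _ (fun y => - e * (om y * (npoly o.+1 (i :: J) k).[y]) *
   ((rootp Y)^`().[y] * (rootp Y)^`().[y]))).
  by move=> y yY; rewrite val // oY derivZ hornerZ; ring.
apply: csignM; last first.
  by move=> y z yB zB; rewrite mulr_gt0 // -expr2 exprn_even_gt0 //=
    deriv_rootp_neq0.
apply: csignZ; first by rewrite oppr_eq0.
by apply: csignM => //; exact: cs2.
Qed.

(** The outer induction, on the number of eliminated members, supplies exact divisions; the inner
    one, downward on [o], supplies level [o.+1] with equally many eliminated members. *)
Lemma good_all r : goodle r.
Proof.
elim: r => [|r G]; first by move=> o [|//] oM _ _; exact: good_nil.
move=> o J oM v sJ; have [n] := ubnP (M.+1 - o); elim: n => // n IH in o J oM v sJ *.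
rewrite ltnS => on.
case: J => [|i J] in v sJ *; first exact: good_nil.
have iM : (o <= i <= M)%N by apply: (valid_le v); rewrite mem_head.
have {}oM : (o <= M)%N by case/andP: iM; exact: leq_trans.
have [oJ|oJ] := boolP (o \in i :: J).
  apply: good_in => //; apply: G => //; last first.
    by rewrite size_rem // -ltnS prednK.
  apply: valid_next (valid_rem _ v) _; rewrite mem_rem_uniqF //.
  by case/andP: v.
have pre a K : valid o (a :: K) -> (size (a :: K) <= r.+1)%N -> o \notin a :: K ->
    [/\ good o K, good o.+1 K, good o.+1 (a :: K) &
    [/\ (L <= (size (npoly o.+1 K a)).-1 + (size K).+1)%N,
    (1 < size (npoly o.+1 K a))%N, chart o (a :: K) o &
    forall k, (o + size (a :: K) < k <= M)%N -> k \notin a :: K ->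
      offsign (lo (level o (a :: K))) (hi (level o (a :: K)))
        (npoly o (a :: K) k) /\
      (size (npoly o (a :: K) k) = (size (npoly o.+1 K a)).-1)%N]].
  move=> {}v {}sJ {}oJ.
  have g1 : good o K by apply: G => //; [exact: leqW | exact: validS v].
  have oJ' : o \notin K by move: oJ; rewrite inE negb_or => /andP[].
  have g2 : good o.+1 K by apply: G => //; exact: valid_next (validS v) oJ'.
  have g3 : good o.+1 (a :: K).
    apply: IH => //; first exact: valid_next v oJ.
    by rewrite (leq_trans _ on) // ltn_sub2l // ltnS.
  by split => //; apply: good_cons_high => //; case: g3.
have [gJ g1J g2J [LJ s1 cho high]] := pre _ _ v sJ oJ.
have := oJ; rewrite inE negb_or => /andP[oi oJ'].
have oo : (o <= o <= M)%N by rewrite leqnn.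
(* A small [k] is exchanged for a large index. Since [k] and the members of [i :: J] are too many to
   fit in the range up to [o + size (i :: J)], some eliminated [j] exceeds it. Up to a scalar,
   eliminating [j] and keeping [k] is the same as eliminating [k] and keeping [j], and then
   [good_cons_high] covers [j]. *)
have low k : (k <= o + size (i :: J))%N -> (o < k <= M)%N -> k \notin i :: J ->
    offsign (lo (level o (i :: J))) (hi (level o (i :: J)))
      (npoly o (i :: J) k) /\
    size (npoly o (i :: J) k) = size (npoly o (i :: J) o).
  move=> kh kM kiJ.
  have [j jJ jh] : exists2 j, j \in i :: J & (o + size (i :: J) < j)%N.
    apply/hasP; apply: contraT => /hasPn h; exfalso.
    have /uniq_leq_size : uniq (k :: i :: J).
      by rewrite cons_uniq kiJ; case/andP: v.
    move=> /(_ (iota o.+1 (size (i :: J)))) sub.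
    suff /sub : {subset k :: i :: J <= iota o.+1 (size (i :: J))}.
      by rewrite size_iota /= ltnn.
    move=> l; rewrite mem_iota addSn ltnS inE => /orP[/eqP ->|lJ].
      by case/andP: kM => ->.
    have := h l lJ; rewrite -leqNgt => ->; rewrite andbT.
    have /andP[ol _] := valid_le v lJ; rewrite ltn_neqAle ol andbT.
    by apply: contraNneq oJ => ->.
  have [s s0 hs] := npoly_move G sJ (leqW oM) v jJ.
  have uJ : uniq (i :: J) by case/andP: v.
  have kr : k \notin rem j (i :: J) by apply: contra kiJ; exact: mem_rem.
  have jr : j \notin rem j (i :: J) by rewrite mem_rem_uniqF.
  have or : o \notin rem j (i :: J) by apply: contra oJ; exact: mem_rem.
  have kj : k != j by apply: contraNneq kiJ => ->.
  have kM' : (o <= k <= M)%N by case/andP: kM => /ltnW -> ->.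
  have vr := valid_rem j v.
  have sr : (size (rem j (i :: J)) = size J)%N by rewrite size_rem.
  move: (rem j (i :: J)) kr jr or vr sr hs => K kK jK oK vK sK hs.
  have vkK : valid o (k :: K) by move: vK; rewrite /valid /= kK kM'.
  have [||_ [_ [l [_ szl]] _] _ [_ _ _ hi']] := pre k K vkK.
  - by rewrite /= sK.
  - by rewrite inE negb_or oK; case/andP: kM => /ltn_eqF ->.
  have jM : (o < j <= M)%N.
    apply: in_next (valid_le v jJ).
    by apply: contraNneq oJ => ->.
  have jh' : (o + size (k :: K) < j <= M)%N.
    by rewrite /= sK; case/andP: jM => _ ->; rewrite andbT; move: jh.
  have jkK : j \notin k :: K by rewrite inE negb_or eq_sym kj jK.
  have [off sz] := hi' j jh' jkK.
  rewrite (hs k) // npolyC 1?eq_sym // scalerN -scaleNr.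
  split; first by apply: offsignZ; rewrite ?oppr_eq0 //; move: off; rewrite /level /= sK.
  rewrite size_scale ?oppr_eq0 // sz (hs o) // size_scale // npoly_base; last first.
    by rewrite inE negb_or oK; case/andP: jM => /ltn_eqF ->.
  rewrite (szl k) // (szl j) //.
  have -> : (k <= o.+1 + size K)%N by rewrite sK addSnnS.
  have -> : (j <= o.+1 + size K)%N = false.
    by apply/negbTE; rewrite sK addSnnS -ltnNge.
  by rewrite addn1 addn0.
have off : offall o (i :: J).
  move=> k kM kiJ; have [->|ko] := eqVneq k o.
    have [h _ _] := g1J; rewrite npoly_base //.
    have iJ : i \notin J by case/andP: v => /= /andP[].
    by have := h i (in_next oi iM) iJ; rewrite /level /= addSn addnS.
  have kM1 : (o < k <= M)%N by apply: in_next kM; rewrite eq_sym.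
  case: (leqP k (o + size (i :: J))) => kh; first by have [] := low k kh kM1 kiJ.
  have kh' : (o + size (i :: J) < k <= M)%N by rewrite kh; case/andP: kM.
  by have [] := high k kh' kiJ.
have so : size (npoly o (i :: J) o) = size (npoly o.+1 J i) by rewrite npoly_base.
have szall k : (o <= k <= M)%N -> k \notin i :: J -> size (npoly o (i :: J) k) =
    ((size (npoly o.+1 J i)).-1 + (k <= o + size (i :: J)))%N.
  move=> kM kiJ; have [->|ko] := eqVneq k o.
    by rewrite so leq_addr addn1 prednK // ltnW.
  have kM1 : (o < k <= M)%N by apply: in_next kM; rewrite eq_sym.
  case: (leqP k (o + size (i :: J))) => kh.
    have [_ ->] := low k kh kM1 kiJ.
    by rewrite so addn1 prednK // ltnW.
  have kh' : (o + size (i :: J) < k <= M)%N by rewrite kh; case/andP: kM.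
  by have [_ ->] := high k kh' kiJ; rewrite addn0.
split => //.
  by exists (size (npoly o.+1 J i)).-1; split => //.
apply: charts_from_base => //.
- by case: g2J.
- by rewrite so.
move=> k kM kiJ; rewrite !szall // leq_add2l leq_addr.
exact: leq_b1.
Qed.

Definition nform J (p : nat -> {poly R}) : {poly R} :=
  \sum_(k < M.+1 | (k : nat) \notin J) p k * npoly 0 J k.

(** Induction on the number of members left. The residues of [q * F], [F] being the form, over
    [rootp X * rootp Y] sum to zero, where [X] are the alternation points and [Y] the zeros of the
    eliminated member. At [X] the signs are known from alternation; at [Y] the form becomes the one
    with fewer members, whose sign changes the induction bounds and [q] absorbs. *)
Lemma nform_alternation T J (p : nat -> {poly R}) (n : nat -> nat) xs e :
  (T + M.+3 < L)%N -> valid 0 J ->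
  (\sum_(k < M.+1 | (k : nat) \notin J) n k <= T)%N ->
  (forall k, (k <= M)%N -> k \notin J -> (size (p k) <= n k)%N) ->
  (exists k, [/\ (k <= M)%N, k \notin J & p k != 0]) ->
  sorted <%R xs ->
  (forall x y, x \in xs -> y \in xs ->
     side (lo (level 0 J)) (hi (level 0 J)) x y) ->
  e != 0 -> alternates e (horner (nform J p)) xs ->
  (size xs <= \sum_(k < M.+1 | (k : nat) \notin J) n k)%N.
Proof.
move=> TL; have [d] := ubnP (M.+1 - size J).
elim: d => // d IH in J p n xs e *.
rewrite ltnS => sd v nT sp [k0 [k0M k0J pk0]] sxs sdx e0 al.
set N := (\sum_(k < _ | _) n k)%N in nT *.
rewrite leqNgt; apply/negP => Nxs.
pose X := take N.+1 xs.
have sX : size X = N.+1 by rewrite size_takel.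
have {}sdx x y : x \in X -> y \in X -> side (lo (level 0 J)) (hi (level 0 J)) x y.
  by move=> /mem_take xX /mem_take yX; exact: sdx.
have {}al : alternates e (horner (nform J p)) X by exact: alternates_take.
have {}sxs : sorted <%R X by exact: take_sorted.
move: X sX sdx al sxs => {Nxs} X sX sdx al sxs {xs}.
have uX : uniq X := lt_sorted_uniq sxs.
have x0X : head 0 X \in X by case: (X) sX => //= x X' _; rewrite mem_head.
have [off [l [Ll szl]] ch] : good 0 J by apply: (@good_all (size J)).
pose mu (k : 'I_M.+1) := (n k + size (npoly 0 J k))%N.
(* Eliminating a member with [mu] maximal gives [size F <= n i + size Y], which leaves exactly
   degree [N'] for the multiplier [q]. *)
have [i iJ imax] : exists2 i : 'I_M.+1, (i : nat) \notin J &
    forall k : 'I_M.+1, (k : nat) \notin J -> (mu k <= mu i)%N.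
  have k0P : (Ordinal (k0M : (k0 < M.+1)%N) : nat) \notin J by [].
  case: (@arg_maxnP _ (Ordinal (k0M : (k0 < M.+1)%N))
    (fun k : 'I_M.+1 => (k : nat) \notin J) mu k0P) => i iJ h.
  by exists i.
have iM : (0 <= i <= M)%N by rewrite leq0n -ltnS ltn_ord.
have [Y [th [e1 [uY inY e10 NE [cth H]]]]] := ch i iM iJ.
have Ns x : x \in X -> side (lo (level 0 J)) (hi (level 0 J)) x x.
  by move=> xX; exact: sdx.
have sgY x y : x \in X -> y \in X -> 0 < (rootp Y).[x] * (rootp Y).[y].
  by move=> xX yX; apply: (offsign_rootp (lohi _) inY); exact: sdx.
have Y0 x : x \in X -> (rootp Y).[x] != 0.
  by move=> xX; apply: contraTneq (sgY x x xX xX) => ->; rewrite mul0r ltxx.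
set F := nform J p in al *.
have alF x : x \in X -> 0 <= e * (-1) ^+ N * (F.[x] / (rootp X)^`().[x]).
  by move=> xX; have := alternates_deriv sxs al xX; rewrite sX.
pose a q x := q.[x] * F.[x] / ((rootp X)^`().[x] * (rootp Y).[x]) : R.
have aq (q : {poly R}) tau : (forall x, x \in X -> 0 <= tau * q.[x]) ->
    forall x, x \in X ->
    0 <= tau * (e * (-1) ^+ N * (rootp Y).[head 0 X]) * a q x.
  move=> hq x xX; have := alF x xX; have := sgY _ _ x0X xX; have := hq x xX.
  have := deriv_rootp_neq0 uX xX; have := Y0 x xX.
  rewrite /a; set D := _^`().[x]; set y0 := (rootp Y).[head 0 X]; set y1 := (rootp Y).[x].
  set u := (-1) ^+ N => y10 D0 tq yy ef.
  have -> : tau * (e * u * y0) * (q.[x] * F.[x] / (D * y1)) =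
     (tau * q.[x]) * (e * u * (F.[x] / D)) * (y0 * y1) / (y1 * y1).
    by field; rewrite y10 D0.
  rewrite divr_ge0 //; last by rewrite -expr2 sqr_ge0.
  by rewrite mulr_ge0 ?(ltW yy) // mulr_ge0.
have [hG|/existsPn oth] := boolP [exists k : 'I_M.+1,
   [&& (k : nat) \notin J, k != i & p k != 0]]; last first.
  have FE : F = p i * npoly 0 J i.
    rewrite /F /nform (bigD1 i) //= big1 ?addr0 // => k /andP[kJ ki].
    by have := oth k; rewrite kJ ki /= negbK => /eqP ->; rewrite mul0r.
  have ae x : x \in X -> a 1 x = e1 * ((p i).[x] / (rootp X)^`().[x]).
    move=> xX; have := Y0 x xX; have := deriv_rootp_neq0 uX xX.
    rewrite /a FE NE hornerM hornerZ hornerC => D0 y0; field; by rewrite y0 D0.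
  have spi : (size (p i) <= N)%N.
    rewrite (leq_trans (sp i _ iJ)) // ?leq_ord //.
    by rewrite /N (bigD1 i) //= leq_addr.
  (* When only [p i] is left, the residues at [X] sum to zero and have one weak sign, so all vanish:
     [p i] has more zeros than its degree allows. *)
  have pi0 : p i = 0.
    have s0 : \sum_(x <- X) a 1 x = 0.
      rewrite big_seq (eq_bigr _ (fun x xX => ae x xX)) -big_seq -mulr_sumr.
      by rewrite lagrange_coef ?sX ?(leq_trans spi) // nth_default ?mulr0.
    apply: (@roots_geq_poly_eq0 _ _ X) => //; last by rewrite sX leqW.
    apply/allP => x xX; apply/eqP.
    set w := 1 * (e * (-1) ^+ N * (rootp Y).[head 0 X]).
    have w0 : w != 0.
      by rewrite /w mul1r !mulf_neq0 ?sign_neq0 ?Y0.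
    have pos y : y \in X -> 0 <= w * a 1 y.
      by apply: aq => z _; rewrite hornerC mulr1.
    have /eqP : \sum_(y <- X) w * a 1 y = 0 by rewrite -mulr_sumr s0 mulr0.
    rewrite big_seq psumr_eq0 => [/allP/(_ x xX)/implyP/(_ xX)|]; last first.
      by move=> y /pos.
    rewrite mulf_eq0 (negPf w0) ae // mulf_eq0 (negPf e10) /= mulf_eq0 invr_eq0.
    by rewrite (negPf (deriv_rootp_neq0 uX xX)) orbF => /eqP.
  have [k0i|k0i] := eqVneq k0 i; first by move: pk0; rewrite k0i pi0 eqxx.
  have := oth (Ordinal (k0M : (k0 < M.+1)%N)); rewrite /= k0J pk0 andbT /=.
  by rewrite -val_eqE /= k0i.
have {}v' : valid 0 (val i :: J).
  by move: v; rewrite /valid /= iJ -ltnS ltn_ord.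
pose G y := (nform (val i :: J) p).[y].
pose N' := (\sum_(k < M.+1 | (k : nat) \notin val i :: J) n k)%N.
have NN : N = (n i + N')%N.
  rewrite /N (bigD1 i) //=; congr addn; apply: eq_bigl => k.
  by rewrite inE negb_or andbC val_eqE.
have lvl : level 0 (val i :: J) = (level 0 J).+1 by rewrite /level.
have sN : (size (npoly 0 J i) = (size Y).+1)%N by rewrite NE size_scale ?size_rootp.
have sJ' := valid_size v'.
have sYl : (N' < size Y)%N.
  apply: card_bound_zeros nT TL Ll sJ'; first by rewrite NN leq_addl.
  by rewrite -sN szl // leq_addr.
have sdY x y : x \in Y -> y \in Y ->
   side (lo (level 0 (val i :: J))) (hi (level 0 (val i :: J))) x y.
  by move=> /(allP inY) xi /(allP inY) yi; rewrite lvl; exact: side_prev.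
have sJM : ((size J).+1 <= M.+1)%N := sJ'.
have IHY zs e' : subseq zs (sort <=%R Y) -> e' != 0 -> alternates e' G zs ->
    (size zs <= N')%N.
  move=> zY e'0 alz.
  have zYm z : z \in zs -> z \in Y by move=> /(mem_subseq zY); rewrite mem_sort.
  apply: (IH (val i :: J) p n zs e') => //.
  - exact: sub_lt_step.
  - by apply: leq_trans nT; rewrite NN leq_addl.
  - by move=> k kM; rewrite inE negb_or => /andP[_ kJ]; exact: sp.
  - have /existsP[k /and3P[kJ ki pk]] := hG.
    by exists k; split; rewrite ?leq_ord // inE negb_or kJ andbT.
  - apply: (subseq_sorted lt_trans zY); rewrite sort_lt_sorted //.
  - by move=> x y /zYm xY /zYm yY; exact: sdY.
have [y0 yY0 Gy0] : exists2 y, y \in Y & G y != 0.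
  apply/hasP; apply: contraT => /hasPn h.
  have := IHY (sort <=%R Y) 1 (subseq_refl _) (oner_neq0 _).
  rewrite size_sort leqNgt sYl => H0; apply: H0; apply: alternates0 => y.
  by rewrite mem_sort => /h /negPn /eqP.
have dense (x y : R) : x < y -> exists2 r, x < r < y & True.
  by move=> xy; exists ((x + y) / 2) => //; apply/andP; split; lra.
have hasG : has (fun y => G y != 0) (sort <=%R Y).
  by apply/hasP; exists y0; rewrite ?mem_sort.
have sortY : sorted <%R (sort <=%R Y) by rewrite sort_lt_sorted.
have [s [z [e' [ss hs [zY sz ee' alz] sgn]]]] := sign_changes dense sortY hasG.
have e'0 : e' != 0.
  by apply: contraTneq (oner_neq0 R) => z0; rewrite -ee' z0 mulr0 eqxx.
have sN' : (size s < N')%N by rewrite -sz; exact: IHY alz.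
have ins : all (inside (lo (level 0 J)) (hi (level 0 J))) s.
  apply/allP => r /hs[_ _ [u + ur] [u' + ru']]; rewrite !mem_sort.
  move=> /(allP inY)/andP[u1 _] /(allP inY)/andP[_ u2].
  by rewrite /inside (le_trans u1 (ltW ur)) (le_trans (ltW ru') u2).
(* [X] lies on one side of the interval containing [Y]; [w] is its point nearest to that
   interval. *)
have [w [tau [wX wY]]] : exists w tau, (forall x, x \in X -> tau * (x - w) <= 0) /\
    (forall y, y \in Y -> 0 < tau * (y - w)).
  have Xn : X != [::] by case: (X) sX.
  have /orP[/andP[xlo _]|/andP[xhi _]] := Ns _ x0X.
    have [w wX hw] := seq_max Xn; exists w, 1; split => [x /hw|y /(allP inY)/andP[ylo _]].
      by rewrite mul1r subr_le0.
    have : w < lo (level 0 J).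
      by have := sdx _ _ x0X wX; move=> /orP[/andP[//]|/andP[h1 _]]; have := lohi (level 0 J); lra.
    by rewrite mul1r subr_gt0 => h; exact: lt_le_trans h ylo.
  have [w wX hw] := seq_min Xn; exists w, (-1); split => [x /hw|y /(allP inY)/andP[_ yhi]].
    by rewrite mulN1r opprB subr_le0.
  have : hi (level 0 J) < w.
    by have := sdx _ _ x0X wX; move=> /orP[/andP[h1 _]|/andP[//]]; have := lohi (level 0 J); lra.
  by rewrite mulN1r opprB subr_gt0 => h; exact: le_lt_trans yhi h.
(* How the sign of the residues at [X] compares with that at [Y] is unknown. Both multipliers make
   the residues at [Y] of one sign, the same for both, but the extra factor in [q1] reverses the
   sign at [X]; so one of the two contradicts [SXY]. *)
pose q0 := rootp s; pose q1 := tau *: (rootp s * ('X - w%:P)).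
have XY x : x \in X -> x \notin Y.
  by move=> xX; have := Y0 x xX; rewrite rootp_root.
have uZ : uniq (X ++ Y).
  rewrite cat_uniq uX uY andbT /=; apply/hasPn => y yY; apply/negP => yX.
  by have := XY y yX; rewrite yY.
pose b (q : {poly R}) y := q.[y] * F.[y] / ((rootp X).[y] * (rootp Y)^`().[y]) : R.
have sF : (size F <= n i + size Y)%N.
  apply: (leq_trans (size_sum _ _ _)); apply/bigmax_leqP => k kJ.
  apply: (leq_trans (size_polyMleq _ _)).
  have := imax k kJ; rewrite /mu sN; have := sp k (leq_ord k) kJ.
  exact: deg_bound_form.
have SXY (q : {poly R}) : (size q <= N'.+1)%N ->
    \sum_(x <- X) a q x = - \sum_(y <- Y) b q y.
  move=> sq; apply/eqP; rewrite -addr_eq0; apply/eqP.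
  have sqF : (size (q * F)%R <= (size (X ++ Y)).-1)%N.
    apply: (leq_trans (size_polyMleq _ _)); rewrite size_cat sX addSn /= NN.
    exact: deg_bound_mul.
  have := lagrange_coef uZ (leq_trans sqF (leq_pred _)).
  rewrite nth_default // big_cat /= => Z0; apply: etrans Z0; congr (_ + _).
    rewrite !big_seq; apply: eq_bigr => x xX; rewrite /a hornerM rootp_cat derivM.
    rewrite hornerD !hornerM; have := rootp_root X x; rewrite xX => /eqP ->.
    by rewrite mul0r addr0.
  rewrite !big_seq; apply: eq_bigr => y yY; rewrite /b hornerM rootp_cat derivM.
  rewrite hornerD !hornerM; have := rootp_root Y y; rewrite yY => /eqP ->.
  by rewrite mulr0 add0r.
have X0 y : y \in Y -> (rootp X).[y] != 0.
  by move=> yY; rewrite rootp_root; apply/negP => /XY; rewrite yY.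
have bE (q : {poly R}) y : y \in Y ->
    b q y = e1 * th y / (rootp X).[y] * (q.[y] * G y).
  move=> yY; have D0 := deriv_rootp_neq0 uY yY; have Xy := X0 y yY.
  rewrite /b; have -> : F.[y] = e1 * (rootp Y)^`().[y] * th y * G y.
    rewrite /F /nform (bigD1 i) //= hornerD hornerM NE hornerZ.
    have := rootp_root Y y; rewrite yY => /eqP ->; rewrite !mulr0 add0r.
    rewrite /G /nform !horner_sum mulr_sumr; apply: eq_big => k.
      by rewrite inE negb_or andbC val_eqE.
    move=> /andP[kJ ki]; have kM : (0 <= k <= M)%N := leq_ord k.
    have kiJ : (k : nat) \notin val i :: J by rewrite inE negb_or kJ andbT.
    by rewrite !hornerM (H k y) // NE derivZ hornerZ; ring.
  by field; rewrite Xy D0.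
have csb : csign (fun y => e1 * th y / (rootp X).[y]) Y.
  have cX : csign (horner (rootp X)) Y.
    move=> y y' yY yY'; rewrite /rootp !horner_prod -big_split /= big_seq.
    rewrite prodr_gt0 // => x xX; rewrite !hornerXsubC.
    have /orP[/andP[h1 _]|/andP[h1 _]] := Ns x xX;
      by have /andP[? ?] := allP inY _ yY; have /andP[? ?] := allP inY _ yY'; nra.
  by apply: csignM; [exact: csignZ|exact: csignV].
pose rho := e' * (-1) ^+ size s * (e1 * th y0 / (rootp X).[y0]).
have q0y y : y \in Y -> q0.[y] != 0.
  move=> yY; rewrite rootp_root; apply/negP => /hs[_]; rewrite mem_sort yY //.
have rb y : y \in Y -> 0 <= rho * b q0 y.
  move=> yY; have sgy := sgn y; rewrite mem_sort in sgy; have {}sgy := sgy yY.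
  have cb := csb _ _ yY0 yY; rewrite bE //.
  have -> : rho * (e1 * th y / (rootp X).[y] * (q0.[y] * G y)) =
     (e' * (-1) ^+ size s * (q0.[y] * G y)) *
     (e1 * th y0 / (rootp X).[y0] * (e1 * th y / (rootp X).[y])).
    by rewrite /rho; ring.
  exact: mulr_ge0 sgy (ltW cb).
have rho0 : rho != 0.
  exact: mulf_neq0 (mulf_neq0 e'0 (sign_neq0 _)) (csign_neq0 csb yY0).
have by0 : b q0 y0 != 0.
  rewrite bE //; apply: (mulf_neq0 (csign_neq0 csb yY0)).
  exact: mulf_neq0 (q0y _ yY0) Gy0.
have b1 y : b q1 y = tau * (y - w) * b q0 y.
  by rewrite /b /q1 hornerZ hornerM hornerXsubC; ring.
have SY0 : 0 < rho * \sum_(y <- Y) b q0 y.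
  rewrite mulr_sumr; apply: (ge0_sum_gt0 rb yY0); exact: mulf_neq0.
have SY1 : 0 < rho * \sum_(y <- Y) b q1 y.
  rewrite mulr_sumr; apply: (@ge0_sum_gt0 _ _ _ y0) => //.
    by move=> y yY; rewrite b1 mulrCA mulr_ge0 ?rb // ltW // wY.
  rewrite b1 mulrCA; apply: mulf_neq0; last exact: mulf_neq0.
  by rewrite gt_eqF // wY.
have q0X x : x \in X -> 0 <= q0.[head 0 X] * q0.[x].
  by move=> xX; apply/ltW/(offsign_rootp (lohi _) ins)/sdx.
pose kap := q0.[head 0 X] * (e * (-1) ^+ N * (rootp Y).[head 0 X]).
have kap0 : kap != 0.
  rewrite /kap !mulf_neq0 ?sign_neq0 ?Y0 //.
  have := offsign_rootp (lohi _) ins (sdx _ _ x0X x0X).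
  by apply: contraTneq => ->; rewrite mul0r ltxx.
have SX0 : 0 <= kap * \sum_(x <- X) a q0 x.
  by rewrite mulr_sumr big_seq sumr_ge0 // => x xX; exact: aq.
have SX1 : 0 <= - kap * \sum_(x <- X) a q1 x.
  rewrite mulr_sumr big_seq sumr_ge0 // => x xX; rewrite /kap -mulNr.
  apply: aq xX => y yX; rewrite /q1 hornerZ hornerM hornerXsubC.
  have -> : - q0.[head 0 X] * (tau * ((rootp s).[y] * (y - w))) =
    (q0.[head 0 X] * q0.[y]) * - (tau * (y - w)) by rewrite /q0; ring.
  by rewrite mulr_ge0 ?q0X // oppr_ge0 wX.
move: SX0 SX1; rewrite !SXY; last 2 first.
- rewrite (leq_trans (size_scale_leq _ _)) //.
  by rewrite size_Mmonic ?monicXsubC ?rootp_neq0 // size_XsubC size_rootp addn2.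
- by rewrite size_rootp ltnW.
move: SY0 SY1 rho0 kap0; set A0 := \sum_(y <- Y) _; set A1 := \sum_(y <- Y) _.
move=> h1 h2 r0 k0' h3 h4.
have k2 : 0 < kap * kap by rewrite -expr2 exprn_even_gt0.
have : 0 < (kap * kap) * ((rho * A0) * (rho * A1)).
  exact: mulr_gt0 k2 (mulr_gt0 h1 h2).
have -> : (kap * kap) * ((rho * A0) * (rho * A1)) =
  - ((rho * rho) * ((kap * - A0) * (- kap * - A1))) by ring.
have r2 : 0 <= rho * rho by rewrite -expr2 sqr_ge0.
by rewrite oppr_gt0 ltNge (mulr_ge0 r2 (mulr_ge0 h3 h4)).
Qed.

End NikishinPolynomials.

(** * Cauchy transforms of atomic generators *)

Section AtomicSystems.
Context {R : rcfType}.
Implicit Types (A : nat -> seq R) (c : nat -> R -> R) (xs : seq R).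

Lemma alternates_scale e kap (h f : R -> R) xs :
  (forall x, x \in xs -> 0 < kap * h x) -> alternates e f xs ->
  alternates (e * kap) (fun x => h x * f x) xs.
Proof.
elim: xs e => //= x xs IH e hk /andP[ef al].
have -> : e * kap * (h x * f x) = (kap * h x) * (e * f x) by ring.
rewrite mulr_ge0 ?(ltW (hk _ _)) ?mem_head //= -mulNr IH // => y yxs.
by rewrite hk // inE yxs orbT.
Qed.

Fixpoint atomcauchy A c d o x : R :=
  if d is d'.+1 then
    \sum_(a <- A o.+1) c o.+1 a * atomcauchy A c d' o.+1 a / (x - a)
  else 1.

Lemma basep_atomcauchy A c d o x : (forall i, uniq (A i)) ->
  (forall i a, a \in A i -> a \notin A i.+1) -> x \notin A o.+1 ->
  (basep A c d o).[x] = (rootp (A o.+1)).[x] * atomcauchy A c d o x.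
Proof.
move=> uA dA; elim: d o x => [|d IH] o x xA; first by rewrite /= mulr1.
rewrite /= horner_sum mulr_sumr !big_seq; apply: eq_bigr => a aA.
have aA' := dA _ _ aA; rewrite hornerZ IH //.
have P0 : (rootp (A o.+2)).[a] != 0 by rewrite rootp_root.
have xa : x - a != 0 by rewrite subr_eq0; apply: contraNneq xA => ->.
rewrite (rootpD1 (uA _) aA) hornerM hornerXsubC /atomp; field.
by rewrite xa P0.
Qed.

Lemma atomic_alternation m T A c (p : nat -> {poly R}) (n : nat -> nat) xs e :
  (forall i, (0 < i <= m)%N -> [/\ uniq (A i), (T + m.+3 < size (A i))%N &
     csign (c i) (A i)]) ->
  (forall i, (0 < i < m)%N ->
     (forall a b, a \in A i -> b \in A i.+1 -> a < b) \/
     (forall a b, a \in A i -> b \in A i.+1 -> b < a)) ->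
  ((0 < m)%N -> (forall x a, x \in xs -> a \in A 1%N -> x < a) \/
                (forall x a, x \in xs -> a \in A 1%N -> a < x)) ->
  (\sum_(k < m.+1) n k <= T)%N ->
  (forall k, (k <= m)%N -> (size (p k) <= n k)%N) ->
  (exists2 k, (k <= m)%N & p k != 0) ->
  sorted <%R xs -> e != 0 ->
  alternates e (fun x => \sum_(k < m.+1) (p k).[x] * atomcauchy A c k 0 x) xs ->
  (size xs <= \sum_(k < m.+1) n k)%N.
Proof.
move=> hA sA sxs nT sp [k0 k0m pk0] sorted_xs e0 al.
pose L := (T + m.+4)%N.
(* A bound larger than the absolute value of every given atom and point, beyond which artificial
   levels can be placed. *)
pose b := 1 + \sum_(i < m.+1) \sum_(a <- A i) `|a| + \sum_(x <- xs) `|x|.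
have sum0 (s : seq R) : 0 <= \sum_(a <- s) `|a| by rewrite sumr_ge0.
have sum1 (s : seq R) a : a \in s -> `|a| <= \sum_(a <- s) `|a|.
  by move=> as_; rewrite (big_rem a) //= lerDl.
have bxs x : x \in xs -> `|x| < b.
  move=> xxs; rewrite /b; have := sum1 _ _ xxs.
  have : 0 <= \sum_(i < m.+1) \sum_(a <- A i) `|a| by rewrite sumr_ge0.
  by lra.
have bA i a : (i <= m)%N -> a \in A i -> `|a| < b.
  move=> im aA; have := sum1 _ _ aA.
  have : \sum_(a <- A i) `|a| <= \sum_(i < m.+1) \sum_(a <- A i) `|a|.
    rewrite (bigD1 (Ordinal (im : (i < m.+1)%N))) //= lerDl.
    by rewrite sumr_ge0.
  by rewrite /b; have := sum0 xs; lra.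
pose Rt := [seq b + j%:R | j <- iota 0 L].
pose Lt := [seq - b - j%:R | j <- iota 0 L].
(* The elimination requires atoms at every level. Level 0 and the levels above [m] receive far
   points, alternately on the right and on the left so that neighbouring levels stay separated. They
   do not enter the transforms of the members up to [m] ([atomE]). *)
pose A' i := if (0 < i <= m)%N then A i else if odd (i - m) then Rt else Lt.
pose c' i := if (0 < i <= m)%N then c i else fun=> 1.
have A'E i : (0 < i <= m)%N -> A' i = A i by rewrite /A' => ->.
have uA' i : uniq (A' i).
  rewrite /A'; case: ifPn => [/hA[]//|_]; case: ifPn => _.
    by rewrite map_inj_uniq ?iota_uniq // => x y /addrI /eqP; rewrite eqr_nat => /eqP.
  rewrite map_inj_uniq ?iota_uniq // => x y /addrI /oppr_inj /eqP.
  by rewrite eqr_nat => /eqP.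
have sA' i : (L <= size (A' i))%N.
  rewrite /A'; case: ifPn => [/hA[_ sAi _]|_]; first by rewrite /L addnS.
  by case: ifPn => _; rewrite size_map size_iota.
have csA' i : csign (c' i) (A' i).
  rewrite /A' /c'; case: ifPn => [/hA[]//|_].
  by move=> y z _ _; rewrite mulr1.
have RtP a : a \in Rt -> b <= a by move=> /mapP[j _ ->]; rewrite lerDl.
have LtP a : a \in Lt -> a <= - b by move=> /mapP[j _ ->]; rewrite gerDl oppr_le0.
have b0 : 0 < b.
  rewrite /b; have := sum0 xs.
  have : 0 <= \sum_(i < m.+1) \sum_(a <- A i) `|a| by rewrite sumr_ge0.
  by lra.
have sepA' i : (forall a d, a \in A' i -> d \in A' i.+1 -> a < d) \/
     (forall a d, a \in A' i -> d \in A' i.+1 -> d < a).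
  rewrite /A'; have [im|mi] := ltnP i m.
    rewrite /=.
    have [i0|i0] := posnP i.
      rewrite i0 /=; left => a d /LtP ab /(bA 1%N); rewrite ltr_norml.
      by move=> h; have /andP[] := h (leq_ltn_trans (leq0n i) im); lra.
    rewrite (ltnW im) /=; apply: sA; by rewrite i0.
  rewrite /=.
  have [im|im] := eqVneq i m.
    rewrite im leqnn andbT subSnn /=; left => a d + /RtP db.
    case: ifPn => m0; first by move=> /(bA m a (leqnn _)); rewrite ltr_norml => /andP[_]; lra.
    by rewrite subnn /= => /LtP; lra.
  have {mi im} mi : (m < i)%N by rewrite ltn_neqAle eq_sym im.
  rewrite (leqNgt i m) mi andbF subSn ?(ltnW mi) //=.
  case: (odd _) => /=; [right|left] => a d; first by move=> /RtP + /LtP; lra.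
  by move=> /LtP + /RtP; lra.
have hull i : exists lh : R * R, [/\ lh.1 <= lh.2, all (inside lh.1 lh.2) (A' i),
     lh.1 \in A' i & lh.2 \in A' i].
  have An : A' i != [::].
    by rewrite -size_eq0 -lt0n (leq_trans _ (sA' i)) // /L addnS.
  have [lo loA hlo] := seq_min An; have [hi hiA hhi] := seq_max An.
  exists (lo, hi); split => //=; first exact: hlo.
  by apply/allP => a aA; rewrite /inside hlo ?hhi.
have /choice[lh lhP] := hull.
have sep i : ((lh i).2 < (lh i.+1).1) || ((lh i.+1).2 < (lh i).1).
  have [_ _ h1 h2] := lhP i; have [_ _ h3 h4] := lhP i.+1.
  by apply/orP; case: (sepA' i) => h; [left|right]; apply: h.
have mL : (m.+1 < L)%N := leq_trans (leqW (leqnSn _)) (leq_addl T _).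
have TL : (T + m.+3 < L)%N by rewrite /L ltn_add2l.
have sidexs x y : x \in xs -> y \in xs -> side (lh 1%N).1 (lh 1%N).2 x y.
  move=> xxs yxs; have [_ _ h3 h4] := lhP 1%N; rewrite /side.
  have [m0|m0] := posnP m.
    apply/orP; left; move: h3; rewrite /A' m0 /= => /RtP h3.
    have := bxs _ xxs; have := bxs _ yxs; rewrite !ltr_norml.
    by move=> /andP[_ h1] /andP[_ h2]; rewrite (lt_le_trans h1) ?(lt_le_trans h2).
  have A1E : A' 1%N = A 1%N by rewrite A'E // m0.
  rewrite A1E in h3 h4; apply/orP.
  by case: (sxs m0) => h; [left|right]; apply/andP; split; apply: h.
have nA' i a : a \in A' i -> a \notin A' i.+1.
  move=> aA; apply/negP => aA'.
  by case: (sepA' i) => h; have := h a a aA aA'; rewrite ltxx.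
have notin x : x \in xs -> x \notin A' 1%N.
  move=> xxs; have := sidexs _ _ xxs xxs; have [_ /allP h _ _] := lhP 1%N.
  by move=> sx; apply/negP => /h /andP[h1 h2]; case/orP: sx => /andP[]; lra.
have atomE d o x : (o + d <= m)%N -> atomcauchy A' c' d o x = atomcauchy A c d o x.
  elim: d o x => // d IH o x od /=.
  have om : (0 < o.+1 <= m)%N by rewrite (leq_trans _ od) // addnS ltnS leq_addr.
  rewrite A'E // /c' om; apply: eq_bigr => a _; rewrite IH //.
  by rewrite addSnnS.
have formE x : x \in xs -> (nform A' c' m [::] p).[x] =
    (rootp (A' 1%N)).[x] * \sum_(k < m.+1) (p k).[x] * atomcauchy A c k 0 x.
  move=> xxs; rewrite /nform horner_sum mulr_sumr; apply: eq_big => // k _.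
  rewrite hornerM npoly_nil subn0 basep_atomcauchy //; last exact: notin.
  rewrite atomE ?add0n ?leq_ord //; ring.
have [xs0|[x0 x0xs]] : xs = [::] \/ exists x, x \in xs.
- by case: (xs) => [|x s]; [left|right; exists x; rewrite mem_head].
- by rewrite xs0.
have posA x : x \in xs -> 0 < (rootp (A' 1%N)).[x0] * (rootp (A' 1%N)).[x].
  move=> xxs; have [h1 h2 _ _] := lhP 1%N.
  by apply: (offsign_rootp h1 h2); exact: sidexs.
have nE : (\sum_(k < m.+1 | (k : nat) \notin [::]) n k = \sum_(k < m.+1) n k)%N by [].
rewrite -nE.
apply: (@nform_alternation R A' c' (fun i => (lh i).1) (fun i => (lh i).2) m L
  uA' _ _ sep csA' sA' mL T [::] p n xs (e * (rootp (A' 1%N)).[x0])) => //.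
- by move=> i; have [] := lhP i.
- by move=> i; have [] := lhP i.
- by move=> k km _; exact: sp.
- by exists k0.
- rewrite mulf_neq0 // rootp_root; exact: notin.
rewrite (eq_alternates _ formE); exact: alternates_scale posA al.
Qed.

End AtomicSystems.

(** * Homogeneous systems with more unknowns than equations *)

Section LinearSystems.
Context {K : fieldType}.

Lemma linear_solution (T : finType) (P : pred T) d (phi : 'I_d -> T -> K) : (d < #|P|)%N ->
  exists u : T -> K, [/\ forall t, ~~ P t -> u t = 0, exists t, u t != 0 &
    forall l, \sum_t u t * phi l t = 0].
Proof.
move=> dP; pose M : 'M[K]_(#|P|, d) := \matrix_(i, l) phi l (enum_val i).
have : kermx M != 0.
  rewrite kermx_eq0 /row_free neq_ltn; apply/orP; left.
  by apply: leq_ltn_trans dP; exact: rank_leq_col.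
case/rowV0Pn => v /sub_kermxP vM vn0.
pose u t := \sum_i v 0 i * (enum_val i == t)%:R.
have uE i : u (enum_val i) = v 0 i.
  rewrite /u (bigD1 i) //= eqxx mulr1 big1 ?addr0 // => j ji.
  by rewrite (inj_eq enum_val_inj) (negbTE ji) mulr0.
exists u; split.
- move=> t nPt; rewrite /u big1 // => i _; case: eqP => [it|_]; rewrite ?mulr0 //.
  by have := enum_valP i; rewrite it => Pt; rewrite -topredE /= in Pt; rewrite Pt in nPt.
- have [i vi] : exists i, v 0 i != 0.
    apply/existsP; apply: contraR vn0; rewrite negb_exists => /forallP h.
    by apply/eqP/rowP => i; rewrite mxE; apply/eqP; have := h i; rewrite negbK.
  by exists (enum_val i); rewrite uE.
- move=> l; under eq_bigr => t _ do rewrite /u mulr_suml.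
  rewrite exchange_big /=; transitivity ((v *m M) 0 l); last by rewrite vM mxE.
  rewrite mxE; apply: eq_bigr => i _; rewrite mxE.
  rewrite (bigD1 (enum_val i)) //= eqxx mulr1 big1 ?addr0 // => t ti.
  by rewrite eq_sym (negbTE ti) mulr0 mul0r.
Qed.

Lemma sum_le_term m (n : nat -> nat) j : (j < m)%N -> (n j <= \sum_(i < m) n i)%N.
Proof. by move=> jm; rewrite (bigD1 (Ordinal jm)) //= leq_addr. Qed.

Lemma poly_solution m (n : nat -> nat) d (phi : 'I_d -> nat -> nat -> K) :
  (d < \sum_(j < m.+1) n j)%N ->
  exists b : nat -> {poly K}, [/\ forall j, (size (b j) <= n j)%N,
    exists2 j, (j <= m)%N & b j != 0 &
    forall l, \sum_(j < m.+1) \sum_(i < n j) phi l j i * (b j)`_i = 0].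
Proof.
pose D := (\sum_(j < m.+1) n j)%N => dD.
have nD (j : 'I_m.+1) : (n j <= D.+1)%N by rewrite ltnW // ltnS sum_le_term.
pose P := [pred t : 'I_m.+1 * 'I_D.+1 | (t.2 < n t.1)%N].
have dP : (d < #|P|)%N.
  rewrite -sum1_card big_mkcond /= -(pair_bigA _
    (fun (j : 'I_m.+1) (i : 'I_D.+1) => if (i < n j)%N then 1%N else 0%N)) /=.
  rewrite (leq_trans dD) //; apply: leq_sum => j _.
  rewrite -big_mkcond -(big_ord_widen _ (fun=> 1%N)) //.
  by rewrite sum1_card card_ord.
have [u [uP [[j0 i0] u0] uS]] := linear_solution (fun l (t : 'I_m.+1 * 'I_D.+1) => phi l t.1 t.2) dP.
have uN (j : 'I_m.+1) (i : 'I_D.+1) : ~~ (i < n j)%N -> u (j, i) = 0 by move=> h; exact: uP.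
pose b j : {poly K} := \poly_(i < n j) u (inord j, inord i).
have bE (j : 'I_m.+1) (i : 'I_D.+1) : (b j)`_i = u (j, i).
  by rewrite coef_poly !inord_val; case: ifPn => // /uN.
exists b; split; first by move=> j; exact: size_poly.
  exists j0; first by rewrite -ltnS.
  by apply: contraNneq u0 => b0; rewrite -bE b0 coef0.
move=> l; transitivity (\sum_(j < m.+1) \sum_(i < D.+1) u (j, i) * phi l j i); last first.
  by rewrite -[RHS](uS l) pair_bigA; apply: eq_bigr => -[j i].
apply: eq_bigr => j _.
rewrite (big_ord_widen _ (fun i => phi l j i * (b j)`_i) (nD j)) big_mkcond /=.
apply: eq_bigr => i _; rewrite bE mulrC; case: ifPn => // /uN ->.
by rewrite mul0r.
Qed.

End LinearSystems.

Lemma sub_multi m (n : nat -> nat) N : (N <= \sum_(j < m) n j)%N ->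
  exists n' : nat -> nat, (forall j, n' j <= n j)%N /\ (\sum_(j < m) n' j)%N = N.
Proof.
elim: m N => [|m IH] N.
  by rewrite big_ord0 leqn0 => /eqP ->; exists (fun=> 0%N); rewrite big_ord0.
rewrite big_ord_recr /= => h; have [|n' [n'n n'N]] := IH (N - n m)%N.
  by rewrite leq_subLR addnC.
exists (fun j => if j == m then minn N (n m) else n' j); split.
  by move=> j; case: eqP => [->|//]; exact: geq_minr.
rewrite big_ord_recr /= eqxx; under eq_bigr => i _ do rewrite ltn_eqF //.
by rewrite n'N minnE subnKC // leq_subr.
Qed.

(** * Two points inserted among the zeros of a function *)

Section TwoPoints.
Context {R : rcfType}.
Implicit Types (s t : seq R) (f : R -> R).

Lemma alternates_cat0 e f s t : {in s, forall x, f x = 0} ->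
  alternates e f (s ++ t) = alternates (e * (-1) ^+ size s) f t.
Proof.
elim: s e => [|x s IH] e h; first by rewrite /= expr0 mulr1.
rewrite /= h ?mem_head // mulr0 lexx /= IH.
  by congr (alternates _ f t); rewrite exprS; ring.
by move=> y ys; rewrite h // inE ys orbT.
Qed.

Lemma rootp_right x s : (forall r, r \in s -> r < x) -> 0 < (rootp s).[x].
Proof.
elim: s => [|r s IH] h; first by rewrite /rootp big_nil hornerC.
rewrite rootp_cons hornerM hornerXsubC mulr_gt0 ?subr_gt0 ?h ?mem_head //.
by apply: IH => y ys; rewrite h // inE ys orbT.
Qed.

Lemma sorted_cut s y : sorted <%R s -> y \notin s ->
  exists s1 s2, [/\ s = s1 ++ s2, forall x, x \in s1 -> x < y & forall x, x \in s2 -> y < x].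
Proof.
elim: s => [|x s IH] ss ys; first by exists [::], [::].
move: ys; rewrite inE negb_or => /andP[yx ys].
case: (ltrgtP x y) yx => // [xy|yx] _.
  have [s1 [s2 [-> h1 h2]]] := IH (path_sorted ss) ys.
  by exists (x :: s1), s2; split=> // z; rewrite inE => /predU1P[->|/h1].
exists [::], (x :: s); split=> // z; rewrite inE => /predU1P[->//|zs].
by apply: lt_trans yx _; have /allP := order_path_min lt_trans ss; apply.
Qed.

(* Inserting [y] and [y'] into the zeros [s] of [f] gives a weakly alternating
   sequence, unless [f] has at [y] and [y'] the signs of [rootp s] up to a common factor. *)
Lemma alternates_two f s y y' : sorted <%R s -> y < y' -> y \notin s -> y' \notin s ->
  {in s, forall x, f x = 0} ->
  (rootp s).[y] * f y * ((rootp s).[y'] * f y') <= 0 ->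
  exists xs e, [/\ sorted <%R xs, perm_eq xs [:: y, y' & s], e != 0 & alternates e f xs].
Proof.
move=> ss yy' ys ys' f0.
have [s1 [s' [sE h1 h']]] := sorted_cut ss ys.
have ss' : sorted <%R s' by move: ss; rewrite sE => /cat_sorted2[].
have ys2 : y' \notin s' by move: ys'; rewrite sE mem_cat negb_or => /andP[].
have [s2 [s3 [s'E h2 h3]]] := sorted_cut ss' ys2.
have h2' x : x \in s2 -> y < x by move=> xs; apply: h'; rewrite s'E mem_cat xs.
have sE' : s = s1 ++ s2 ++ s3 by rewrite sE s'E.
move=> le0; pose xs := s1 ++ y :: s2 ++ y' :: s3.
have a1 : 0 < (rootp s1).[y] by exact: rootp_right.
have a2 := rootp_left h2'.
have a3 : 0 < (-1) ^+ size s3 * (rootp s3).[y].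
  by apply: rootp_left => x xs3; apply: lt_trans yy' _; exact: h3.
have b1 : 0 < (rootp s1).[y'] by apply: rootp_right => x xs1; apply: lt_trans yy'; exact: h1.
have b2 : 0 < (rootp s2).[y'] by exact: rootp_right.
have b3 := rootp_left h3.
(* Between [y] and [y'] stand the zeros [s2], which fit any sign, so alternation only asks for this
   inequality; the sign of [rootp s] at the two points differs by exactly the factor
   [(-1) ^+ size s2]. *)
have sgn : (-1) ^+ size s2 * (f y * f y') <= 0.
  move: le0; rewrite sE' !rootp_cat !hornerM => le0.
  have e3 : (-1) ^+ size s3 * (-1) ^+ size s3 = 1 :> R by rewrite -expr2 sqrr_sign.
  have e2 : (-1) ^+ size s2 * (-1) ^+ size s2 = 1 :> R by rewrite -expr2 sqrr_sign.
  have := mulr_gt0 (mulr_gt0 (mulr_gt0 a1 a2) a3) (mulr_gt0 (mulr_gt0 b1 b2) b3).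
  set Q := (X in 0 < X) => Q0; rewrite -(pmulr_rle0 _ Q0).
  move: le0; congr (_ <= _).
  rewrite /Q; set q2 := (-1) ^+ size s2 in e2 *; set q3 := (-1) ^+ size s3 in e3 *.
  transitivity ((q2 * q2) * (q3 * q3) * ((rootp s1).[y] * ((rootp s2).[y] * (rootp s3).[y]) * f y *
    ((rootp s1).[y'] * ((rootp s2).[y'] * (rootp s3).[y']) * f y'))); last by ring.
  by rewrite e2 e3 !mul1r.
have z1 : {in s1, forall x, f x = 0} by move=> x xs1; rewrite f0 // sE' mem_cat xs1.
have z2 : {in s2, forall x, f x = 0} by move=> x xs1; rewrite f0 // sE' !mem_cat xs1 orbT.
have z3 : {in s3, forall x, f x = 0} by move=> x xs1; rewrite f0 // sE' !mem_cat xs1 !orbT.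
have sxs : sorted <%R xs.
  rewrite sorted_pairwise; last exact: lt_trans.
  move: ss; rewrite sE' sorted_pairwise; last exact: lt_trans.
  rewrite /xs !pairwise_cat /= !pairwise_cat /= !allrel_catr !allrel_consr.
  move=> /and3P[/andP[p1 p2] p3 /and3P[p4 p5 p6]].
  rewrite allrel_catr allrel_consr all_cat /= p1 p2 p3 p4 p5 p6 yy' !andbT /=.
  rewrite -!andbA; do ?[apply/andP; split]; apply/allP => x.
  - exact: h1.
  - by move=> /h1 xy; exact: lt_trans xy yy'.
  - exact: h2'.
  - by move=> /h3; exact: lt_trans.
  - exact: h2.
  - exact: h3.
have [e0 [e00 e01 e02]] : exists e0 : R,
    [/\ e0 != 0, 0 <= e0 * f y & 0 <= - e0 * ((-1) ^+ size s2 * f y')].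
  set v := (-1) ^+ size s2 * f y'; have uv : f y * v <= 0.
    by move: sgn; rewrite mulrCA.
  case: (ltP 0 (f y)) => fy; first by exists 1; rewrite oner_neq0; split => //; nra.
  case: (ltP (f y) 0) => fy'.
    by exists (-1); rewrite oppr_eq0 oner_neq0; split => //; nra.
  have -> : f y = 0 by apply/eqP; rewrite eq_le fy fy'.
  case: (leP 0 v) => v0; [exists (-1)|exists 1]; rewrite ?oppr_eq0 oner_neq0 ?mulr0; split => //; nra.
exists xs, (e0 * (-1) ^+ size s1); split=> //.
- rewrite /xs sE' -[y :: s2 ++ _]cat1s perm_catCA /= perm_cons.
  by rewrite -[y' :: s3]cat1s catA perm_catCA /= perm_cons catA.
- by rewrite mulf_neq0 // expf_neq0 // oppr_eq0 oner_neq0.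
have e1 : (-1) ^+ size s1 * (-1) ^+ size s1 = 1 :> R by rewrite -expr2 sqrr_sign.
rewrite /xs alternates_cat0 // -mulrA e1 mulr1 /= e01 /= alternates_cat0 //=.
by rewrite -mulrA e02 /=; exact: alternates0.
Qed.

End TwoPoints.

Import numFieldNormedType.Exports.
Local Open Scope charge_scope.

(** * Charges of constant sign *)

Section ConstantSign.
Context {R : realType}.
Local Open Scope classical_set_scope.
Local Open Scope ereal_scope.
Local Open Scope charge_scope.
Implicit Types (s : bcharge R) (A D : set (measurableTypeR R)).

Notation fmeas := {finite_measure set (measurableTypeR R) -> \bar R}.

(** [s = e * mu] with [e = 1] or [e = -1]; the clauses translate the notions defined through the
    Jordan decomposition into statements on one finite measure. *)
Definition sign_measure s (mu : fmeas) (e : R) := [/\ (e * e = 1)%R,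
  forall f, L1 s f <-> mu.-integrable setT (EFin \o f),
  forall f, cint s f = (e * Rintegral mu setT f)%R,
  forall A, measurable A -> Defs.variation s A = mu A &
  forall A, measurable A -> s A = e%:E * mu A].

Lemma measure_null (mu : fmeas) A : mu setT = 0 -> measurable A -> mu A = 0.
Proof.
move=> mu0 mA; apply/eqP; rewrite eq_le measure_ge0 andbT -mu0.
by apply: le_measure; rewrite ?inE.
Qed.

Lemma null_integral (mu : fmeas) (f : R -> R) : mu setT = 0 ->
  Rintegral mu setT f = 0%R.
Proof.
move=> mu0; rewrite /Rintegral (@eq_measure_integral _ _ _ _ mzero).
  by rewrite integral_measure_zero.
by move=> A mA _; exact: measure_null.
Qed.

Lemma null_integrable (mu : fmeas) (f : R -> R) (nu : fmeas) : mu setT = 0 ->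
  nu.-integrable setT (EFin \o f) -> mu.-integrable setT (EFin \o f).
Proof.
move=> mu0 /integrableP[mf _]; apply/integrableP; split => //.
rewrite (@eq_measure_integral _ _ _ _ mzero); first by rewrite integral_measure_zero.
by move=> A mA _; exact: measure_null.
Qed.

Lemma const_sign_measure s : s.-positive_set setT \/ s.-negative_set setT ->
  exists mu e, sign_measure s mu e.
Proof.
have hpn := hahn_pn s; have [[mP hP] [mN hN] _ _] := hpn.
have dec A : measurable A -> s A = posp s A - negp s A.
  by move=> mA; rewrite (jordan_decomp hpn mA) /cadd /= cscaleN1.
have posE A : measurable A -> posp s A = s (A `&` hahn_p s).
  by move=> mA; rewrite /posp jordan_posE /= /crestr0 mem_set.
have negE A : measurable A -> negp s A = - s (A `&` hahn_n s).
  by move=> mA; rewrite /negp jordan_negE cjordan_negE /crestr0 mem_set.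
move=> [[_ pos]|[_ neg]].
  have n0 : negp s setT = 0.
    apply/eqP; rewrite negE // setTI eq_le; apply/andP; split.
      by rewrite oppe_le0; exact: pos.
    by rewrite oppe_ge0; exact: hN.
  exists (posp s), 1%R; split => //; first by rewrite mulr1.
  - by move=> f; split => [[]//|fi]; split => //; exact: null_integrable fi.
  - by move=> f; rewrite /cint (@null_integral (negp s)) // subr0 mul1r.
  - by move=> A mA; rewrite /Defs.variation /charge_variation /= [X in _ + X]measure_null ?adde0.
  - by move=> A mA; rewrite dec // [X in _ - X]measure_null // sube0 mul1e.
have p0 : posp s setT = 0.
  apply/eqP; rewrite posE // setTI eq_le; apply/andP; split.
    exact: neg.
  exact: hP.
exists (negp s), (-1)%R; split => //; first by rewrite mulrNN mulr1.
- by move=> f; split => [[]//|fi]; split => //; exact: null_integrable fi.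
- by move=> f; rewrite /cint (@null_integral (posp s)) // sub0r mulN1r.
- by move=> A mA; rewrite /Defs.variation /charge_variation /= [X in X + _]measure_null ?add0e.
- by move=> A mA; rewrite dec // [X in X - _]measure_null // sub0e EFinN mulN1e.
Qed.

(** Each point off the support lies in an interval with rational end points and measure zero, and
    there are countably many of these. *)
Lemma null_outside_supp s (mu : fmeas) (D : set R) :
  (forall A, measurable A -> Defs.variation s A = mu A) ->
  closed D -> supp s `<=` D -> mu (~` D) = 0.
Proof.
move=> vE cD sD.
have mD : measurable (~` D : set (measurableTypeR R)).
  by apply: open_measurable; exact: closed_openC.
pose B (p q : rat) : set (measurableTypeR R) :=
  if `[< mu `]ratr p, ratr q[ = 0 >] then `]ratr p, ratr q[ else set0.
pose F n := if @unpickle (rat * rat)%type n is Some pq then B pq.1 pq.2 else set0.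
have mF n : measurable (F n).
  rewrite /F; case: (unpickle n) => // pq; rewrite /B.
  by case: asboolP => _; [exact: measurable_itv|exact: measurable0].
have F0 n : mu.-negligible (F n).
  apply/negligibleP => //; rewrite /F; case: (unpickle n) => [pq|]; last exact: measure0.
  by rewrite /B; case: asboolP => // _; rewrite measure0.
have nF : mu (\bigcup_n F n) = 0.
  by apply/negligibleP; [exact: bigcupT_measurable|exact: negligible_bigcup].
apply/eqP; rewrite eq_le measure_ge0 andbT -nF; apply: le_measure; rewrite ?inE //.
  exact: bigcupT_measurable.
move=> x nDx; have nsx : ~ supp s x by move=> /sD.
have [U [[oU Ux] vU]] : exists U, open_nbhs x U /\ Defs.variation s U = 0.
  move/existsNP : nsx => [U /not_implyP[oU] /negP]; rewrite -leNgt => h.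
  exists U; split => //; have [oU' _] := oU.
  have mU : measurable (U : set (measurableTypeR R)) by exact: open_measurable.
  by apply/eqP; rewrite eq_le h /= vE // measure_ge0.
have mU : measurable (U : set (measurableTypeR R)) by exact: open_measurable.
have [e e0 xeU] : exists2 e : R, (0 < e)%R & ball x e `<=` U.
  by have /nbhs_ballP[e /= e0 h] := open_nbhs_nbhs (conj oU Ux); exists e.
have [p] := @rat_in_itvoo R (x - e)%R x ltac:(by rewrite ltrBlDr ltrDl).
rewrite in_itv /= => /andP[p1 p2].
have [q] := @rat_in_itvoo R x (x + e)%R ltac:(by rewrite ltrDl).
rewrite in_itv /= => /andP[q1 q2].
have sub : `]ratr p, ratr q[ `<=` U.
  move=> y /=; rewrite in_itv /= => /andP[py yq]; apply: xeU.
  by rewrite /ball /= ltr_norml; apply/andP; split; lra.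
have [n FE] : exists n, F n = B p q.
  by exists (pickle (p, q)); rewrite /F pickleK.
exists n => //; rewrite FE /B asboolT; first by rewrite /= in_itv /= p2 q1.
apply/eqP; rewrite eq_le measure_ge0 andbT -vU vE //.
by apply: le_measure; rewrite ?inE //; exact: measurable_itv.
Qed.

End ConstantSign.

(** * Replacing a measure by point masses *)

Section Separation.
Context {R : realType}.
Local Open Scope classical_set_scope.

(* The hypothesis says that [C] misses the origin in its first [r] coordinates. *)
Lemma convex_separation r (C : set (nat -> R)) : C !=set0 ->
  (forall u v (t : R), C u -> C v -> 0 < t < 1 -> C (fun i => t * u i + (1 - t) * v i)) ->
  (forall v, C v -> exists2 i, (i < r)%N & v i != 0) ->
  exists l : nat -> R, (exists2 i, (i < r)%N & l i != 0) /\
    forall v, C v -> 0 <= \sum_(i < r) l i * v i.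
Proof.
elim: r C => [|r IH] C C0 conv nz; first by have [v /nz[]] := C0.
have base (e : R) : e != 0 -> (forall v, C v -> 0 <= e * v r) ->
    exists l : nat -> R, (exists2 i, (i < r.+1)%N & l i != 0) /\
    forall v, C v -> 0 <= \sum_(i < r.+1) l i * v i.
  move=> e0 h; exists (fun i => if i == r then e else 0); split.
    by exists r => //; rewrite eqxx.
  move=> v /h; rewrite big_ord_recr /= eqxx big1 ?add0r // => i _.
  by rewrite ltn_eqF // mul0r.
have [allge|/existsNP[v2 /not_implyP[Cv2 /negP]]] := pselect (forall v, C v -> 0 <= v r).
  by apply: (base 1); rewrite ?oner_neq0 // => v /allge; rewrite mul1r.
rewrite -ltNge => b2.
have [allle|/existsNP[v1 /not_implyP[Cv1 /negP]]] := pselect (forall v, C v -> v r <= 0).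
  apply: (base (-1)); first by rewrite oppr_eq0 oner_neq0.
  by move=> v /allle; rewrite mulN1r oppr_ge0.
rewrite -ltNge => b1.
pose comb (u v : nat -> R) (i : nat) : R := (- v r / (u r - v r)) * u i + (1 - (- v r / (u r - v r))) * v i.
have combP u v : C u -> C v -> 0 < u r -> v r < 0 -> C (comb u v) /\ comb u v r = 0.
  move=> Cu Cv u0 v0; have d0 : 0 < u r - v r by lra.
  split; last by rewrite /comb; field; rewrite gt_eqF.
  apply: conv => //; rewrite divr_gt0 ?oppr_gt0 //= ltr_pdivrMr // mul1r; lra.
(* The slice of [C] by the last coordinate hyperplane is separated by induction. The last
   coefficient is then chosen between the slopes imposed by the points on the two sides; [ineq] says
   that these do not cross, because the segment joining such points meets the slice. *)
pose C1 := [set v | C v /\ v r = 0].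
have [||| l' [[i0 i0r li0] hl']] := IH C1.
- by have [] := combP v1 v2 Cv1 Cv2 b1 b2; exists (comb v1 v2).
- move=> u v t [Cu u0] [Cv v0] t01; split; first exact: conv.
  by rewrite u0 v0 !mulr0 addr0.
- move=> v [/nz[i ir vi] vr]; exists i => //; move: ir; rewrite ltnS leq_eqVlt.
  by case/orP => // /eqP ir; move: vi; rewrite ir vr eqxx.
pose a (v : nat -> R) := \sum_(i < r) l' i * v i.
have ineq u v : C u -> C v -> 0 < u r -> v r < 0 ->
    - a u / u r <= a v / - v r.
  move=> Cu Cv u0 v0; have [Cc c0] := combP u v Cu Cv u0 v0.
  have := hl' _ (conj Cc c0); have d0 : 0 < u r - v r by lra.
  have -> : \sum_(i < r) l' i * comb u v i =
      (- v r * a u + u r * a v) / (u r - v r).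
    rewrite /a !mulr_sumr -big_split /= mulr_suml; apply: eq_bigr => i _.
    by rewrite /comb; field; rewrite gt_eqF.
  rewrite pmulr_lge0 ?invr_gt0 // => h.
  by rewrite ler_pdivrMr // mulrAC ler_pdivlMr ?oppr_gt0 //; nra.
pose S := [set x | exists2 u, C u /\ 0 < u r & x = - a u / u r].
have S1 : S (- a v1 / v1 r) by exists v1.
have ubS v : C v -> v r < 0 -> ubound S (a v / - v r).
  by move=> Cv v0 _ [u [Cu u0] ->]; exact: ineq.
have hS : has_sup S by split; [exists (- a v1 / v1 r)|exists (a v2 / - v2 r); exact: ubS].
pose be := sup S.
exists (fun i => if i == r then be else l' i); split.
  by exists i0; [exact: ltnW|rewrite ltn_eqF].
move=> v Cv; rewrite big_ord_recr /= eqxx.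
under eq_bigr => i _ do rewrite ltn_eqF //.
rewrite -/(a v); have [v0|v0|v0] := ltgtP (v r) 0.
- have : be <= a v / - v r by apply: ge_sup; [exists (- a v1 / v1 r)|exact: ubS].
  by rewrite ler_pdivlMr ?oppr_gt0 //; nra.
- have : - a v / v r <= be by apply: ub_le_sup; [case: hS|exists v].
  by rewrite ler_pdivrMr //; nra.
- by rewrite v0 mulr0 addr0; apply: hl'; split.
Qed.

End Separation.

Section Tchakaloff.
Context {R : realType}.
Local Open Scope classical_set_scope.
Notation fmeas := {finite_measure set (measurableTypeR R) -> \bar R}.
Notation int mu f := (Rintegral mu setT f).
Notation itg mu f := (mu.-integrable setT (EFin \o f)).

Lemma int_sum (mu : fmeas) (l : nat -> R) (f : nat -> R -> R) r :
  (forall i, (i < r)%N -> itg mu (f i)) ->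
  itg mu (fun t => \sum_(i < r) l i * f i t) /\
  int mu (fun t => \sum_(i < r) l i * f i t) = \sum_(i < r) l i * int mu (f i).
Proof.
elim: r => [|r IH] fi.
  split.
    by under eq_fun do rewrite big_ord0; exact: integrable0.
  rewrite big_ord0 (_ : (fun t : R => _) = cst 0) ?Rintegral_cst ?mul0r //.
  by apply/funext => t; rewrite big_ord0.
have [|h1 h2] := IH; first by move=> i ir; apply: fi; exact: ltnW.
have h3 : itg mu (fun t => l r * f r t).
  have := @integrableZl _ _ _ mu setT measurableT (l r) (EFin \o f r) (fi r (ltnSn _)).
  by apply: eq_integrable => // t _.
have -> : (fun t => \sum_(i < r.+1) l i * f i t) =
   (fun t => (\sum_(i < r) l i * f i t) + l r * f r t).
  by apply/funext => t; rewrite big_ord_recr.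
split.
  by have := integrableD measurableT h1 h3; apply: eq_integrable.
rewrite RintegralD // big_ord_recr /= h2; congr (_ + _).
by rewrite RintegralZl //; exact: fi.
Qed.

Definition atoms_in (E : set R) (s : seq (R * R)) :=
  forall p, p \in s -> 0 < p.1 /\ E p.2.

Lemma full_nonempty (mu : fmeas) (E : set (measurableTypeR R)) :
  (0 < mu setT)%E -> mu (~` E) = 0%E -> E !=set0.
Proof.
move=> mu0 muE; apply/set0P; apply: contraTneq mu0 => E0.
by move: muE; rewrite E0 setC0 => ->; rewrite ltxx.
Qed.

(* If the origin is not a positive combination of values of [Psi] on [E], then
   some [phi = \sum_i l i * Psi i] is non-negative on [E] with zero mean, so that
   one coordinate is redundant on the set of full measure where [phi = 0]. *)
Lemma zero_mean_atoms (mu : fmeas) r (Psi : nat -> R -> R) (E : set (measurableTypeR R)) :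
  (0 < mu setT)%E -> measurable E -> mu (~` E) = 0%E ->
  (forall i, (i < r)%N -> itg mu (Psi i)) ->
  (forall i, (i < r)%N -> int mu (Psi i) = 0) ->
  exists s, [/\ s != [::], atoms_in E s &
    forall i, (i < r)%N -> \sum_(p <- s) p.1 * Psi i p.2 = 0].
Proof.
move=> mu0; elim: r Psi E => [|r IH] Psi E mE muE iPsi zPsi.
  have [t Et] := full_nonempty mu0 muE.
  exists [:: (1, t)]; split => // p; rewrite inE => /eqP -> /=; by split.
apply: contrapT => no.
pose C := [set v | exists s, [/\ s != [::], atoms_in E s &
   v = (fun i => \sum_(p <- s) p.1 * Psi i p.2)]].
have Cconv u v (t : R) : C u -> C v -> 0 < t < 1 -> C (fun i => t * u i + (1 - t) * v i).
  move=> [s [s0 sE ->]] [s' [s'0 s'E ->]] /andP[t0 t1].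
  exists ([seq (t * p.1, p.2) | p <- s] ++ [seq ((1 - t) * p.1, p.2) | p <- s']).
  split.
  - by case: (s) s0.
  - move=> p; rewrite mem_cat => /orP[] /mapP[q qs ->] /=.
      by have [? ?] := sE q qs; split => //; rewrite mulr_gt0.
    by have [? ?] := s'E q qs; split => //; rewrite mulr_gt0 // subr_gt0.
  - apply/funext => i; rewrite big_cat !big_map /= !mulr_sumr.
    by congr (_ + _); apply: eq_bigr => p _; rewrite mulrA.
have Cnz v : C v -> exists2 i, (i < r.+1)%N & v i != 0.
  move=> [s [s0 sE vE]]; apply: contrapT => h; apply: no; exists s; split => // i ir.
  apply/eqP; apply: contrapT => /negP h'; apply: h; exists i => //.
  by rewrite vE.
have [t0 Et0] := full_nonempty mu0 muE.
have C1 t : E t -> C (fun i => Psi i t).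
  move=> Et; exists [:: (1, t)]; split => //.
    by move=> p; rewrite inE => /eqP -> /=.
  by apply/funext => i; rewrite big_seq1 mul1r.
have C0 : C !=set0 by exists (fun i => Psi i t0); exact: C1.
have [l [[j jr lj] hl]] := convex_separation C0 Cconv Cnz.
pose phi t := \sum_(i < r.+1) l i * Psi i t.
have [iphi phiE] := int_sum l iPsi.
have phi0 : int mu phi = 0.
  by rewrite phiE big1 // => i _; rewrite zPsi ?mulr0.
have phi_ge0 t : E t -> 0 <= phi t by move=> Et; exact: hl (C1 t Et).
have mphi : measurable_fun setT phi.
  by have /integrableP[/measurable_EFinP] := iphi.
have nphi : mu.-negligible (~` [set t | phi t = 0]).
  have /(ae_eq_integral_abs mu measurableT) : measurable_fun setT (EFin \o phi).
    exact/measurable_EFinP.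
  case=> [h _]; have {}h : ae_eq mu setT (EFin \o phi) (cst 0%E).
    apply: h; transitivity (\int[mu]_x (phi x)%:E)%E; last first.
      rewrite -[LHS]fineK; last exact: integrable_fin_num.
      by move: phi0; rewrite /Rintegral => ->.
    apply: ae_eq_integral => //.
    - exact/measurableT_comp/measurable_EFinP.
    - exact/measurable_EFinP.
    exists (~` E); split => //; first exact: measurableC.
    move=> t /= ht Et; apply: ht => _; rewrite /= ger0_norm //.
    exact: phi_ge0.
  move: h; apply: negligibleS => t /= ht ht'; apply: ht.
  by have := ht' I; rewrite /= => -[].
pose E' : set (measurableTypeR R) := E `&` [set t | phi t = 0].
have mE' : measurable E'.
  apply: measurableI => //; rewrite -[X in measurable X]setTI.
  exact: (mphi measurableT [set 0] (measurable_set1 0)).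
have muE' : mu (~` E') = 0%E.
  apply/negligibleP; first exact: measurableC.
  rewrite setCI; apply: negligibleU => //.
  by apply/negligibleP => //; exact: measurableC.
have bumpr i : (i < r)%N -> (bump j i < r.+1)%N.
  by move=> ir; rewrite /bump; case: (j <= i)%N => //; exact: leqW.
have [||s [s0 sE sz]] := IH (fun i => Psi (bump j i)) E' mE' muE'.
- by move=> i ir; apply: iPsi; exact: bumpr.
- by move=> i ir; apply: zPsi; exact: bumpr.
have sE1 : atoms_in E s by move=> p /sE[? []].
have oth i : (i < r.+1)%N -> i != j -> \sum_(p <- s) p.1 * Psi i p.2 = 0.
  move=> ir ij; have -> : i = bump j (unbump j i) by rewrite unbumpK.
  apply: sz; rewrite /unbump; case: (ltngtP i j) ij => // ji _.
    by rewrite (subn0 i) (leq_trans ji).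
  by rewrite (subn1 i) -ltnS prednK // (leq_trans _ ji).
(* The atoms lie where [phi = 0] and annihilate all coordinates but [j]; as [l j != 0], they
   annihilate coordinate [j] too. *)
apply: no; exists s; split => // i ir; have [->|] := eqVneq i j; last exact: oth.
apply: (mulfI lj); rewrite mulr0.
have : \sum_(p <- s) p.1 * phi p.2 = 0.
  by rewrite big_seq big1 // => p /sE[_ [_ ->]]; rewrite mulr0.
under eq_bigr => p _ do rewrite /phi mulr_sumr.
rewrite exchange_big /= (bigD1 (Ordinal jr)) //= [X in _ + X]big1 => [|k kj].
  rewrite addr0 => h; rewrite -[RHS]h mulr_sumr; apply: eq_bigr => p _.
  by rewrite mulrCA.
under eq_bigr => p _ do rewrite mulrCA.
by rewrite -mulr_sumr oth ?mulr0.
Qed.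

Lemma integral_atoms (mu : fmeas) r (f : nat -> R -> R) (E : set (measurableTypeR R)) :
  (0 < mu setT)%E -> measurable E -> mu (~` E) = 0%E ->
  (forall i, (i < r)%N -> itg mu (f i)) ->
  exists s, atoms_in E s /\
    forall i, (i < r)%N -> \sum_(p <- s) p.1 * f i p.2 = int mu (f i).
Proof.
move=> mu0 mE muE fi; pose M := fine (mu setT).
have M0 : 0 < M by rewrite fine_gt0 // mu0 /= -ge0_fin_numE // fin_num_measure.
(* Subtracting the mean reduces to zero integrals; scaling the total weight [W] of the atoms to [M]
   restores the constants. *)
pose Psi i t := f i t - int mu (f i) / M.
have ic (k : R) : itg mu (fun=> k) by exact: finite_measure_integrable_cst.
have [||s [s0 sE sz]] := @zero_mean_atoms mu r Psi E mu0 mE muE.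
- move=> i ir; have := integrableB measurableT (fi i ir) (ic (int mu (f i) / M)).
  by apply: eq_integrable.
- move=> i ir; rewrite /Psi (RintegralB measurableT (fi i ir) (ic _)).
  by rewrite Rintegral_cst // -/M mulfVK ?subrr // gt_eqF.
pose W := \sum_(p <- s) p.1.
have W0 : 0 < W.
  case: s s0 sE @W {sz} => // p s _ sE W; rewrite /W big_cons ltr_pwDl //.
    by have [] := sE p (mem_head _ _).
  rewrite big_seq sumr_ge0 // => q qs; apply: ltW.
  by have [] := sE q (mem_behead (s := p :: s) qs).
exists [seq (M / W * p.1, p.2) | p <- s]; split.
  move=> p /mapP[q /sE[q0 Eq] ->] /=; split => //.
  by rewrite !mulr_gt0 ?invr_gt0.
move=> i ir; rewrite big_map /=.
have /eqP : \sum_(p <- s) p.1 * f i p.2 - W * (int mu (f i) / M) = 0.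
  rewrite -[RHS](sz i ir) /W mulr_suml -sumrB; apply: eq_bigr => p _.
  by rewrite /Psi; ring.
rewrite subr_eq0 => /eqP h.
transitivity (M / W * \sum_(p <- s) p.1 * f i p.2).
  by rewrite mulr_sumr; apply: eq_bigr => p _; rewrite mulrA.
by rewrite h; field; rewrite !gt_eqF.
Qed.

End Tchakaloff.

(** * Integrals against a density *)

Section Densities.
Context {R : realType}.
Local Open Scope classical_set_scope.
Notation fmeas := {finite_measure set (measurableTypeR R) -> \bar R}.
Notation int mu f := (Rintegral mu setT f).
Notation itg mu f := (mu.-integrable setT (EFin \o f)).

Lemma measurable_cauchy_kernel (x : R) :
  measurable_fun [set: measurableTypeR R] (fun t : R => (x - t)^-1).
Proof.
rewrite -(setvU [set x]).
apply/measurable_funU; [exact: measurableC|exact: measurable_set1|split].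
  apply: open_continuous_measurable_fun.
    rewrite (_ : ~` _ = [set y | y != x]); first exact: open_neq.
    by apply/seteqP; split => y /= /eqP.
  move=> t; rewrite inE /= => tx.
  apply: cvgV.
    by rewrite subr_eq0; apply/eqP => xt; apply: tx.
  by apply: cvgB; [exact: cvg_cst|exact: cvg_id].
exact: measurable_fun_set1.
Qed.

Lemma kernel_bounded (D : set R) (x : R) : closed D -> ~ D x ->
  exists2 C : R, 0 < C & forall t, D t -> `|(x - t)^-1| <= C.
Proof.
move=> cD nDx; have /open_nbhs_nbhs/nbhs_ballP[e /= e0 h] : open_nbhs x (~` D).
  by split => //; exact: closed_openC.
exists e^-1; first by rewrite invr_gt0.
move=> t Dt; rewrite normfV lef_pV2 ?posrE //.
  by rewrite leNgt; apply/negP => xt; exact: (h t).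
rewrite normr_gt0 subr_eq0; apply/eqP => xt; apply: nDx; by rewrite xt.
Qed.

Lemma itg_bounded (mu : fmeas) (D : set (measurableTypeR R)) (f h : R -> R) C :
  measurable D -> mu (~` D) = 0%E -> measurable_fun setT f ->
  (forall t, D t -> `|f t| <= C) -> itg mu h -> itg mu (fun t => h t * f t).
Proof.
move=> mD muD mf bf ih; have mCD := measurableC mD.
have /integrableP[/measurable_EFinP mh _] := ih.
have mhf : measurable_fun setT (EFin \o (fun t => h t * f t)).
  by apply/measurable_EFinP; exact: measurable_funM.
apply/(negligible_integrable mCD measurableT mhf muD); rewrite setTD setCK.
have ihD : mu.-integrable D (EFin \o h) by apply: integrableS ih.
have mfD : measurable_fun D f by apply: measurable_funS mf.
have bD : [bounded f t | t in D].
  exists C; split; first exact: num_real.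
  by move=> y Cy t Dt; rewrite /= (le_trans (bf t Dt)) // ltW.
have := integrableMl mD ihD mfD bD.
by apply: eq_integrable => // t _.
Qed.

(** [h] agrees almost everywhere with the Radon-Nikodym derivative of [nu], so this is the change of
    variables for that derivative. *)
Lemma density_int (mu nu : fmeas) (h f : R -> R) :
  itg mu h -> (forall A, measurable A -> nu A = \int[mu]_(x in A) (h x)%:E)%E ->
  itg nu f -> itg mu (fun t => f t * h t) ->
  int nu f = int mu (fun t => f t * h t).
Proof.
move=> ih nuE jf ifh.
have dom : nu `<< mu.
  apply/null_content_dominatesP => A mA muA; rewrite nuE //.
  apply: null_set_integral => //.
  by case/integrableP: ih => mh _; apply: measurable_funS mh.
have mRN : mu.-integrable setT ('d (charge_of_finite_measure nu) '/d mu).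
  exact: Radon_Nikodym_integrable.
have RNE : ae_eq mu setT (EFin \o h) ('d (charge_of_finite_measure nu) '/d mu).
  apply: integral_ae_eq => //.
  move=> A _ mA; rewrite -Radon_Nikodym_integral //.
  exact: esym (nuE A mA).
rewrite /Rintegral -(Radon_Nikodym_change_of_variables dom measurableT jf).
congr fine; apply: ae_eq_integral => //.
- apply: emeasurable_funM; first exact: (measurable_int nu jf).
  exact: (measurable_int mu mRN).
- exact: (measurable_int mu ifh).
move: RNE => [N [mN muN sN]]; exists N; split => // t nt.
apply: sN => /= h1; apply: nt => _ /=; rewrite -h1 //.
Qed.

End Densities.

Section DensityCharges.
Context {R : realType}.
Local Open Scope classical_set_scope.
Notation fmeas := {finite_measure set (measurableTypeR R) -> \bar R}.
Notation int mu f := (Rintegral mu setT f).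
Notation itg mu f := (mu.-integrable setT (EFin \o f)).
Implicit Types (s : bcharge R) (mu : fmeas).

Lemma itg_indic mu (g : R -> R) (A : set (measurableTypeR R)) :
  measurable A -> itg mu g -> itg mu (fun x => g x * \1_A x).
Proof.
move=> mA ig; apply: (@itg_bounded _ mu setT _ _ 1) => //.
- by rewrite setCT measure0.
- by move=> t _; rewrite ger0_norm // indicE; case: (t \in A).
Qed.

Lemma integral_indic_mul mu (g : R -> R) (A : set (measurableTypeR R)) :
  measurable A -> itg mu g ->
  (\int[mu]_(x in A) (g x)%:E)%E = (int mu (fun x => g x * \1_A x))%:E.
Proof.
move=> mA ig; rewrite /Rintegral fineK; last first.
  by apply: integrable_fin_num => //; exact: itg_indic.
rewrite [LHS]integral_mkcond; congr (integral _ _ _); apply/funext => x.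
by rewrite /patch indicE /=; case: ifP => _; rewrite ?mulr1 ?mulr0.
Qed.

Lemma density_measure s (g : R -> R) mu e mu' e' :
  sign_measure s mu e -> L1 s g -> sign_measure (density s g) mu' e' ->
  forall A, measurable A ->
  mu' A = (\int[mu]_(x in A) (e' * e * g x)%:E)%E.
Proof.
move=> [ee sL1 scint _ _] sg [ee' _ _ _ sA'] A mA.
have ig : itg mu g by apply/sL1.
have -> : mu' A = (e'%:E * density s g A)%E.
  by rewrite sA' // muleA -EFinM ee' mul1e.
have -> : density s g A = (cint s (fun x => g x * \1_A x))%:E.
  rewrite /density; case: pselect => // h.
  rewrite /= /cadd /= cscaleN1 /=.
  have := integral_indic_mul mA h.1; have := integral_indic_mul mA h.2.
  by rewrite /cint EFinB => <- <-.
rewrite scint -EFinM mulrA EFinM -integral_indic_mul //.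
by rewrite -integralZl //; exact: integrableS ig.
Qed.

Lemma density_cint s (g : R -> R) mu e mu' e' (D : set (measurableTypeR R)) (f : R -> R) C :
  sign_measure s mu e -> L1 s g -> sign_measure (density s g) mu' e' ->
  measurable D -> mu (~` D) = 0%E -> measurable_fun setT f ->
  (forall t, D t -> `|f t| <= C) ->
  itg mu (fun t => g t * f t) /\
  cint (density s g) f = e * int mu (fun t => g t * f t).
Proof.
move=> sm sg sm' mD muD mf bf; have dm := density_measure sm sg sm'.
have [ee sL1 _ _ _] := sm; have [ee' _ cint' _ _] := sm'.
have ig : itg mu g by apply/sL1.
have igf := itg_bounded mD muD mf bf ig.
have ih : itg mu (fun x => e' * e * g x).
  by apply: eq_integrable (integrableZl measurableT (e' * e) ig).
split=> //; rewrite cint' (density_int ih dm).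
- rewrite (_ : (fun t => _) = (fun t => (e' * e) * (g t * f t))); last first.
    by apply/funext => t; ring.
  by rewrite RintegralZl // !mulrA ee' mul1r.
- have muD' : mu' (~` D) = 0%E.
    rewrite dm; last exact: measurableC.
    apply: null_set_integral => //; first exact: measurableC.
    have /integrableP[mh _] := ih; exact: measurable_funS mh.
  have i1 : itg mu' (fun=> 1) by exact: finite_measure_integrable_cst.
  apply: eq_integrable (itg_bounded mD muD' mf bf i1) => // t _ /=.
  by rewrite mul1r.
- apply: eq_integrable (integrableZl measurableT (e' * e) igf) => // t _ /=.
  by congr EFin; ring.
Qed.

End DensityCharges.

Section ManyAtoms.
Context {R : realType}.
Local Open Scope classical_set_scope.
Notation fmeas := {finite_measure set (measurableTypeR R) -> \bar R}.
Notation int mu f := (Rintegral mu setT f).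
Notation itg mu f := (mu.-integrable setT (EFin \o f)).
Implicit Types (s : bcharge R) (mu : fmeas).

(** To force many distinct nodes, the indicators of disjoint neighbourhoods of points of the support
    are added to the functions: their integrals are positive, so each neighbourhood receives a
    node. *)
Lemma many_atoms s mu (L r : nat) (f : nat -> R -> R) (E : set (measurableTypeR R)) :
  (forall A, measurable A -> Defs.variation s A = mu A) ->
  infinite_set (supp s) -> measurable E -> mu (~` E) = 0%E ->
  (forall i, (i < r)%N -> itg mu (f i)) ->
  exists (A : seq R) (c : R -> R), [/\ uniq A, (L <= size A)%N,
    forall a, a \in A -> E a /\ 0 < c a &
    forall i, (i < r)%N -> \sum_(a <- A) c a * f i a = int mu (f i)].
Proof.
move=> vE infS mE muE fi.
(* One point more than requested, so that even for [L = 0] some neighbourhood shows that [mu] is not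
   zero. *)
have [S [uS szS sS]] : exists S : seq R, [/\ uniq S, size S = L.+1 & forall x, x \in S -> supp s x].
  elim: L.+1 => [|n [S [uS <- sS]]]; first by exists [::].
  have : ~ (supp s `<=` [set` S]).
    by move=> h; apply: infS; exact: sub_finite_set h (finite_seq S).
  move/existsNP => [x /not_implyP[sx /negP xS]]; exists (x :: S) => /=.
  split=> //; first by rewrite uS andbT.
  by move=> y; rewrite inE => /predU1P[->|/sS].
have [d d0 dS] : exists2 d : R, 0 < d & forall x y, x \in S -> y \in S -> x != y -> d + d <= `|x - y|.
  pose P := [seq xy <- [seq (x, y) | x <- S, y <- S] | xy.1 != xy.2].
  have [d d0 dP] : exists2 d : R, 0 < d & forall xy, xy \in P -> d <= `|xy.1 - xy.2|.
    have : forall xy, xy \in P -> 0 < `|xy.1 - xy.2|.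
      by move=> [x y]; rewrite mem_filter /= => /andP[xy _]; rewrite normr_gt0 subr_eq0.
    elim: P => [_|q P IH h]; first by exists 1.
    have [|d d0 hd] := IH; first by move=> xy xyP; apply: h; exact: mem_behead.
    exists (Num.min d `|q.1 - q.2|).
      by rewrite lt_min d0 h ?mem_head.
    move=> xy; rewrite inE => /predU1P[->|/hd h1]; rewrite ge_min ?lexx ?orbT //.
    by rewrite h1.
  exists (d / 2); first by rewrite divr_gt0.
  move=> x y xS yS xy; rewrite -splitr; apply: (dP (x, y)).
  by rewrite mem_filter /= xy /=; apply/allpairsP; exists (x, y).
pose U (x : R) : set (measurableTypeR R) := `]x - d, x + d[.
have mU x : measurable (U x) by exact: measurable_itv.
have U0 x : x \in S -> (0 < mu (U x))%E.
  move=> xS; rewrite -vE //; apply: (sS x xS); split.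
    exact: interval_open.
  by rewrite /U /= in_itv /=; lra.
have muT : (0 < mu setT)%E.
  case: S uS szS sS U0 {dS} => // x S _ _ _ /(_ x (mem_head _ _)) h.
  by apply: lt_le_trans h _; apply: le_measure; rewrite ?inE.
pose g i := if (i < r)%N then f i else \1_(U (nth 0 S (i - r))).
have [|p [pE pint]] := @integral_atoms _ mu (r + L.+1) g E muT mE muE.
  move=> i _; rewrite /g; case: ifP => [/fi//|_].
  have i1 : itg mu (fun=> 1) by exact: finite_measure_integrable_cst.
  have := itg_indic (mU (nth 0 S (i - r)%N)) i1.
  by apply: eq_integrable => // t _ /=; rewrite mul1r.
pose A := undup [seq q.2 | q <- p].
(* Masses at coinciding nodes are merged. *)
pose c a := \sum_(q <- p | q.2 == a) q.1.
have sumE (h : R -> R) : \sum_(a <- A) c a * h a = \sum_(q <- p) q.1 * h q.2.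
  under eq_bigr => a _ do rewrite /c mulr_suml big_mkcond.
  rewrite exchange_big /= big_seq [RHS]big_seq; apply: eq_bigr => q qp.
  rewrite (bigD1_seq q.2) ?undup_uniq ?mem_undup ?map_f //=.
  rewrite eqxx big1_seq ?addr0 // => a /andP[aq _].
  by rewrite eq_sym (negbTE aq).
have intp i : (i < r)%N -> \sum_(a <- A) c a * f i a = int mu (f i).
  by move=> ir; rewrite sumE; have := pint i (ltn_addr _ ir); rewrite /g ir.
exists A, c; split=> //; first exact: undup_uniq.
- have hit x : x \in S -> has (fun a => `[< U x a >]) A.
    move=> xS; apply: contraT => /hasPn h.
    have ix : (index x S < L.+1)%N by rewrite -szS index_mem.
    have := pint (r + index x S)%N; rewrite ltn_add2l => /(_ ix).
    rewrite /g ltnNge leq_addr /= addKn nth_index // => h1.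
    have : int mu (\1_(U x)) = 0.
      rewrite -h1 big_seq big1 // => q qp; rewrite indicE.
      have /asboolPn nU : ~~ `[< U x q.2 >] by apply: h; rewrite mem_undup map_f.
      by rewrite memNset // mulr0.
    rewrite /Rintegral integral_indic // setIT => h2.
    have := fine_gt0 (x := mu (U x)); rewrite h2 ltxx => h3.
    suff : false by []. apply: h3; rewrite U0 //=.
    by rewrite -ge0_fin_numE // fin_num_measure.
  pose pk x := nth 0 A (find (fun a => `[< U x a >]) A).
  have pkP x : x \in S -> pk x \in A /\ U x (pk x).
    move=> /hit hx; split; first by rewrite mem_nth // -has_find.
    by have := nth_find 0 hx => /asboolP.
  rewrite ltnW // -szS -(size_map pk); apply: uniq_leq_size.
    rewrite map_inj_in_uniq // => x y xS yS pxy; apply/eqP; apply: contraT => xy.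
    have := dS x y xS yS xy; have [_] := pkP x xS; have [_] := pkP y yS.
    rewrite -pxy /U /= !in_itv /= => /andP[a1 a2] /andP[b1 b2].
    by rewrite leNgt ltr_norml => /negP[]; apply/andP; split; lra.
  by move=> _ /mapP[x /pkP[? _] ->].
- move=> a; rewrite mem_undup => /mapP[q qp ->]; have [q0 Eq] := pE q qp.
  split=> //; rewrite /c; case/splitPr: qp pE => p1 p2 pE.
  rewrite big_cat big_cons eqxx /= ltr_wpDl ?ltr_pwDl //.
  all: rewrite big_seq_cond sumr_ge0 // => x /andP[xp _]; apply: ltW.
  all: by have [] := pE x; rewrite // mem_cat inE xp ?orbT.
Qed.

End ManyAtoms.

(** * Nikishin systems *)

Section NikishinData.
Context {R : realType}.
Local Open Scope classical_set_scope.
Notation fmeas := {finite_measure set (measurableTypeR R) -> \bar R}.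
Notation int mu f := (Rintegral mu setT f).
Notation itg mu f := (mu.-integrable setT (EFin \o f)).
Implicit Types (sigma : nat -> bcharge R) (mu : nat -> fmeas) (e : nat -> R).

Definition separated (E F : set R) :=
  (forall a b, E a -> F b -> a < b) \/ (forall a b, E a -> F b -> b < a).

(** Member [k] of the system of level [i], indexed by its last generator; for [i = 0] these are the
    entries of [hatrow]. *)
Definition nikw sigma i k x : R :=
  if k == i then 1 else Defs.cauchy (nik sigma i.+1 k) x.

(** The sets [E i] have full measure and avoid the neighbouring intervals, so on [E i] the kernel of
    the next level is bounded and the members satisfy a true recursion. That [E 0] is an interval
    will keep change points between atoms inside it. *)
Definition nik_data m sigma (E : nat -> set (measurableTypeR R)) mu e := [/\
  forall i, (i <= m)%N -> [/\ sign_measure (sigma i) (mu i) (e i),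
    infinite_set (supp (sigma i)), measurable (E i) & mu i (~` E i) = 0%E],
  forall i, (i < m)%N -> separated (E i) (E i.+1),
  forall i k, (i <= k <= m)%N -> itg (mu i) (nikw sigma i k),
  forall i k x, (i < k <= m)%N -> E i x ->
    itg (mu i.+1) (fun t => nikw sigma i.+1 k t * (x - t)^-1) /\
    nikw sigma i k x = e i.+1 * int (mu i.+1) (fun t => nikw sigma i.+1 k t * (x - t)^-1) &
  is_interval (E 0%N)].

Lemma interval_separated (I J : set R) : is_interval I -> is_interval J ->
  separated (I `\` J) (J `\` I).
Proof.
move=> iI iJ; have [h|h] := pselect (exists a b, [/\ (I `\` J) a, (J `\` I) b & a < b]).
  have [a0 [b0 [[Ia0 Ja0] [Jb0 Ib0] ab0]]] := h; left=> a b [Ia Ja] [Jb Ib].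
  case: (ltgtP a b) => // [ba|ab]; last by case: Ib; rewrite -ab.
  case: (leP a0 b) => ab1.
    by case: Ib; apply: (iI a0 a) => //; rewrite ab1 ltW.
  by case: Ja0; apply: (iJ b b0) => //; rewrite !ltW.
right=> a b EA EB; case: (ltgtP a b) => // [ab|ab].
  by case: h; exists a, b.
by case: EA EB; rewrite ab => _ nJ [].
Qed.

Lemma supp_sub (Delta : set R) s : classM Delta s -> supp s `<=` Delta.
Proof. by move=> [_ _ <-]; exact: sub_smallest. Qed.

Lemma nikishin_data m sigma : nikishin m sigma ->
  exists E mu e, nik_data m sigma E mu e.
Proof.
move=> [Delta [hD hsep hnik]].
have sgn j : exists p : fmeas * R, (j <= m)%N -> sign_measure (sigma j) p.1 p.2.
  case: (leqP j m) => jm.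
    have [_ _ [/const_sign_measure[mu [e h]] _ _]] := hD j jm.
    by exists (mu, e).
  have [_ _ [/const_sign_measure[mu [e _]] _ _]] := hD 0%N isT.
  by exists (mu, e).
have {sgn}/choice[p hp] := sgn.
pose mu j := (p j).1; pose e j := (p j).2.
have mD j : (j <= m)%N -> measurable (Delta j : set (measurableTypeR R)).
  by move=> /hD[_ cD _]; exact: closed_measurable.
have nullD j : (j <= m)%N -> mu j (~` Delta j) = 0%E.
  move=> jm; have [_ cD cM] := hD j jm; have [_ _ _ vE _] := hp j jm.
  by apply: null_outside_supp vE cD _; exact: supp_sub.
pose E j : set (measurableTypeR R) := Delta j `\`
  ([set x | (0 < j)%N /\ Delta j.-1 x] `|` [set x | (j < m)%N /\ Delta j.+1 x]).
have mB (b : bool) (B : set (measurableTypeR R)) : (b -> measurable B) ->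
    measurable [set x | b /\ B x].
  case: b => h.
    by rewrite (_ : mkset _ = B); [exact: h|apply/seteqP; split=> [x []|x]].
  by rewrite (_ : mkset _ = set0)//; apply/seteqP; split=> [x []|x].
have mE j : (j <= m)%N -> measurable (E j).
  move=> jm; apply: measurableD; first exact: mD.
  apply: measurableU; apply: mB => h; apply: mD => //.
  by rewrite (leq_trans _ jm) ?leq_pred.
have nullI i j : (i <= m)%N -> (j <= m)%N -> (Delta i `&` Delta j = set0 \/
    exists x, Delta i `&` Delta j = [set x] /\ sigma j [set x] = 0%E) ->
    mu j (Delta i `&` Delta j) = 0%E.
  move=> im jm [->|[x [-> sx]]]; first exact: measure0.
  have [ee _ _ _ sE] := hp j jm; move: sx; rewrite sE; last exact: measurable_set1.
  move=> /eqP; rewrite mule_eq0 => /orP[/eqP[e0]|/eqP//].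
  by move: ee; rewrite e0 mulr0 => /eqP; rewrite eq_sym oner_eq0.
have nullE j : (j <= m)%N -> mu j (~` E j) = 0%E.
  move=> jm.
  pose N1 : set (measurableTypeR R) := [set x | (0 < j)%N /\ (Delta j.-1 `&` Delta j) x].
  pose N2 : set (measurableTypeR R) := [set x | (j < m)%N /\ (Delta j.+1 `&` Delta j) x].
  have jm' : (j.-1 <= m)%N by rewrite (leq_trans _ jm) ?leq_pred.
  have mN1 : measurable N1 by apply: mB => _; apply: measurableI; exact: mD.
  have mN2 : measurable N2 by apply: mB => h; apply: measurableI; exact: mD.
  apply/negligibleP; first by apply: measurableC; exact: mE.
  have : (mu j).-negligible (~` Delta j `|` (N1 `|` N2)).
    apply: negligibleU; first by apply/negligibleP; [by apply: measurableC; exact: mD|exact: nullD].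
    apply: negligibleU; apply/negligibleP => //.
      rewrite /N1; clear mN1 N1 mN2 N2; case: j jm jm' => [|j] jm jm' /=.
        by rewrite (_ : mkset _ = set0) ?measure0 //; apply/seteqP; split=> [x []|x].
      rewrite (_ : mkset _ = Delta j `&` Delta j.+1); last by apply/seteqP; split=> [x []|x].
      apply: nullI => //; case: (hsep j jm) => [->|[x [-> _ sx]]]; first by left.
      by right; exists x.
    rewrite /N2; case: (boolP (j < m)%N) => h; last first.
      by rewrite (_ : mkset _ = set0) ?measure0 //; apply/seteqP; split=> [x []|x].
    rewrite (_ : mkset _ = Delta j.+1 `&` Delta j); last by apply/seteqP; split=> [x []|x].
    apply: nullI => //; rewrite setIC; case: (hsep j h) => [->|[x [-> sx _]]]; first by left.
    by right; exists x.
  apply: negligibleS => x nE; apply: contrapT => /not_orP[/contrapT Dx /not_orP[n1 n2]].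
  apply: nE; split=> // -[[h1 h2]|[h1 h2]]; [apply: n1|apply: n2]; by split.
have EE j x : (j < m)%N -> E j x -> ~ Delta j.+1 x.
  by move=> jm [_ /not_orP[_ h]] Dx; apply: h.
have nikS i k : (i < k)%N -> nik sigma i k = density (sigma i) (Defs.cauchy (nik sigma i.+1 k)).
  by move=> ik; rewrite {1}/nik -subSS subSn //.
have iw i k : (i <= k <= m)%N -> itg (mu i) (nikw sigma i k).
  move=> /andP[ik km]; rewrite /nikw; case: eqVneq => [_|ki].
    exact: finite_measure_integrable_cst.
  have ik' : (i < k <= m)%N by rewrite ltn_neqAle eq_sym ki ik.
  have [L _] := hnik i k ik'; have [_ h _ _ _] := hp i (leq_trans ik km).
  exact/h.
have key i k x : (i < k <= m)%N -> E i x ->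
    itg (mu i.+1) (fun t => nikw sigma i.+1 k t * (x - t)^-1) /\
    nikw sigma i k x = e i.+1 * int (mu i.+1) (fun t => nikw sigma i.+1 k t * (x - t)^-1).
  move=> /andP[ik km] Ex; have im : (i < m)%N by exact: leq_trans km.
  have [_ cD _] := hD i.+1 im.
  have [C C0 bC] := kernel_bounded cD (EE i x im Ex).
  have sm := hp i.+1 im; have mk := measurable_cauchy_kernel x.
  have i2 : itg (mu i.+1) (nikw sigma i.+1 k) by apply: iw; rewrite ik.
  have := itg_bounded (mD _ im) (nullD _ im) mk bC i2; split=> //.
  rewrite {1}/nikw gtn_eqF // /Defs.cauchy /nikw.
  case: (eqVneq k i.+1) => [->|ki].
    rewrite /nik subnn /=; have [_ _ -> _ _] := sm.
    by congr (_ * int _ _); apply/funext => t; rewrite mul1r.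
  have ik' : (i.+1 < k <= m)%N by rewrite ltn_neqAle eq_sym ki ik.
  have [L [cs _ _]] := hnik i.+1 k ik'.
  have [mu' [e' sm']] := const_sign_measure cs.
  have /andP[ik1 _] := ik'; rewrite (nikS _ _ ik1) in sm' *.
  by have [_ ->] := density_cint sm L sm' (mD _ im) (nullD _ im) mk bC.
exists E, mu, e; split.
- move=> i im; have [_ _ [_ infS _]] := hD i im; split=> //; [exact: hp|exact: mE|exact: nullE].
- move=> i im; have [iI _ _] := hD i (ltnW im); have [iJ _ _] := hD i.+1 im.
  have sub1 : E i `<=` Delta i `\` Delta i.+1.
    by move=> x Ex; split; [case: Ex|exact: EE Ex].
  have sub2 : E i.+1 `<=` Delta i.+1 `\` Delta i.
    move=> x [Dx /not_orP[h _]]; split=> // Dx'; apply: h; by split.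
  case: (interval_separated iI iJ) => h; [left|right] => a b /sub1 ? /sub2 ?; exact: h.
- exact: iw.
- exact: key.
move=> a b Ea Eb r /andP[ar rb].
have [i0 _ _] := hD 0%N isT; have Dr : Delta 0%N r.
  by apply: (i0 a b); [case: Ea|case: Eb|rewrite ar rb].
(* The removed point [r] cannot separate [a] from [b]. [Delta 1] contains another point [t]: if [t]
   lies beyond [a] or [b], that point belongs to [Delta 1]; otherwise [t] is a second common point
   of the two intervals. *)
split=> // -[[]//|[m0 D1r]]; have [i1 _ [_ infS _]] := hD 1%N m0.
have nar : a != r by apply: contraPneq (EE 0%N a m0 Ea) => ->; exact.
have nbr : b != r by apply: contraPneq (EE 0%N b m0 Eb) => ->; exact.
have {nar} ar' : a < r by rewrite lt_neqAle nar.
have {nbr} rb' : r < b by rewrite lt_neqAle eq_sym nbr.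
have [t D1t tr] : exists2 t, Delta 1%N t & t != r.
  apply: contrapT => no; apply: infS; apply: (@sub_finite_set _ _ [set r]) => [t st|].
    apply: contrapT => /eqP tr; apply: no; exists t => //.
    by have [_ _ cM] := hD 1%N m0; exact: supp_sub cM _ st.
  exact: finite_set1.
have D01 x : Delta 0%N x -> Delta 1%N x -> x = r.
  move=> D0x D1x; case: (hsep 0%N m0) => [D0|[y [D0 _ _]]].
    by have : set0 r by rewrite -D0; split.
  have /= -> : [set y] x by rewrite -D0; split.
  by have /= -> : [set y] r by rewrite -D0; split.
case: (ltgtP t r) tr => // [tr|rt] _.
  case: (leP t a) => ta.
    by apply: (EE 0%N a m0 Ea); apply: (i1 t r) => //; rewrite ta ltW.
  have D0t : Delta 0%N t by apply: (i0 a r); [case: Ea| |rewrite !ltW].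
  by move: tr; rewrite (D01 t D0t D1t) ltxx.
case: (leP b t) => tb.
  by apply: (EE 0%N b m0 Eb); apply: (i1 r t) => //; rewrite tb ltW.
have D0t : Delta 0%N t by apply: (i0 r b); [|case: Eb|rewrite !ltW].
by move: rt; rewrite (D01 t D0t D1t) ltxx.
Qed.

End NikishinData.

Section RealSystems.
Context {R : realType}.
Local Open Scope classical_set_scope.
Notation fmeas := {finite_measure set (measurableTypeR R) -> \bar R}.
Notation int mu f := (Rintegral mu setT f).
Notation itg mu f := (mu.-integrable setT (EFin \o f)).
Implicit Types (sigma : nat -> bcharge R) (mu : nat -> fmeas) (e : nat -> R).

Definition represents m sigma (E : nat -> set (measurableTypeR R)) e L i (B A : seq R) (c : R -> R) := [/\
  uniq A, (L <= size A)%N, forall a, a \in A -> E i.+1 a /\ 0 < c a &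
  forall k x, (i < k <= m)%N -> x \in B ->
    nikw sigma i k x = \sum_(a <- A) e i.+1 * c a * nikw sigma i.+1 k a / (x - a)].

Lemma represent_level m sigma E mu e L i (B : seq R) : nik_data m sigma E mu e ->
  (i < m)%N -> (forall x, x \in B -> E i x) ->
  exists A c, represents m sigma E e L i B A c.
Proof.
move=> [h1 _ _ h4 _] im BE; have [[_ _ _ vE _] infS mE muE] := h1 i.+1 im.
(* [l] encodes the pair formed by the position of [x] in [B] and the index [k], so one choice of
   atoms serves all points and all members. *)
pose f l : R -> R := let x := nth 0 B (l %/ m.+1)%N in let k := (l %% m.+1)%N in
  if (i < k)%N then fun t => nikw sigma i.+1 k t * (x - t)^-1 else fun=> 0.
have [|A [c [uA szA AE sumA]]] :=
    @many_atoms _ (sigma i.+1) (mu i.+1) L (size B * m.+1)%N f (E i.+1) vE infS mE muE.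
  move=> l lB; rewrite /f; case: ifP => [ik|_]; last first.
    exact: finite_measure_integrable_cst.
  have xB : nth 0 B (l %/ m.+1)%N \in B by apply: mem_nth; rewrite ltn_divLR.
  have ikm : (i < l %% m.+1 <= m)%N by rewrite ik -ltnS ltn_pmod.
  by have [] := h4 _ _ _ ikm (BE _ xB).
exists A, c; split=> // k x ikm xB; have [_ ->] := h4 _ _ _ ikm (BE _ xB).
have /andP[ik km] := ikm; have km' : (k < m.+1)%N by [].
pose l := (index x B * m.+1 + k)%N.
have lE : f l = fun t => nikw sigma i.+1 k t * (x - t)^-1.
  by rewrite /f divnMDl // modnMDl divn_small // modn_small // addn0 nth_index // ik.
have lB : (l < size B * m.+1)%N.
  have : (index x B < size B)%N by rewrite index_mem.
  move=> h; apply: (@leq_trans ((index x B).+1 * m.+1)).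
    by rewrite /l mulSn [X in (_ < X)%N]addnC ltn_add2l.
  by rewrite leq_mul2r h orbT.
rewrite -lE -(sumA l lB) lE mulr_sumr; apply: eq_bigr => a _.
by rewrite !mulrA.
Qed.

Lemma nikishin_alternation m sigma E mu e n (p : nat -> {poly R}) (xs : seq R) eps :
  nik_data m sigma E mu e ->
  (forall x, x \in xs -> E 0%N x) -> sorted <%R xs ->
  (forall k, (k <= m)%N -> (size (p k) <= n k)%N) ->
  (exists2 k, (k <= m)%N & p k != 0) -> eps != 0 ->
  alternates eps (fun x => \sum_(k < m.+1) (p k).[x] * nikw sigma 0 k x) xs ->
  (size xs <= \sum_(k < m.+1) n k)%N.
Proof.
move=> hd xsE sxs szp pn0 e0 alt; have [h1 h2 _ _ _] := hd.
pose T := (\sum_(k < m.+1) n k)%N; pose L := (T + m.+3).+1.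
have /choice[st hst] : forall iB : nat * seq R, exists Ac : seq R * (R -> R),
    (iB.1 < m)%N -> (forall x, x \in iB.2 -> E iB.1 x) ->
    represents m sigma E e L iB.1 iB.2 Ac.1 Ac.2.
  move=> [i B] /=; have [[im BE]|no] := pselect ((i < m)%N /\ forall x, x \in B -> E i x).
    by have [A [c h]] := represent_level L hd im BE; exists (A, c).
  by exists ([::], fun=> 0) => im BE; case: no.
(* The atoms of each level reproduce the integrals at the atoms of the previous level, starting from
   [xs]. Consequently the atomic transforms agree exactly with the original functions at all these
   points. *)
pose A := fix A i := if i is i'.+1 then (st (i', A i')).1 else xs.
pose c i := if i is i'.+1 then fun a => e i'.+1 * (st (i', A i')).2 a else fun=> 0.
have AE i : (i <= m)%N -> forall x, x \in A i -> E i x.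
  elim: i => [|i IH] im x; first exact: xsE.
  by have [_ _ h _] := hst (i, A i) im (IH (ltnW im)) => xA; have [] := h x xA.
have rep i : (i < m)%N -> represents m sigma E e L i (A i) (A i.+1) (st (i, A i)).2.
  by move=> im; apply: (hst (i, A i)) => //; apply: AE; exact: ltnW.
have cauE d o x : (o + d <= m)%N -> x \in A o ->
    atomcauchy A c d o x = nikw sigma o (o + d)%N x.
  elim: d o x => [|d IH] o x odm xA; first by rewrite addn0 /nikw eqxx.
  have om : (o < m)%N by rewrite (leq_trans _ odm) // addnS ltnS leq_addr.
  have [_ _ _ ->] := rep o om; rewrite ?odm ?addnS ?ltnS ?leq_addr //=.
  by rewrite big_seq [RHS]big_seq; apply: eq_bigr => a aA; rewrite IH // addSnnS.
have key : alternates eps (fun x => \sum_(k < m.+1) (p k).[x] * atomcauchy A c k 0 x) xs.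
  have E1 : {in xs, (fun x => \sum_(k < m.+1) (p k).[x] * nikw sigma 0 k x) =1
      (fun x => \sum_(k < m.+1) (p k).[x] * atomcauchy A c k 0 x)}.
    by move=> x xxs; apply: eq_bigr => k _; have km : (0 + k <= m)%N := ltn_ord k; rewrite cauE.
  by rewrite -(eq_alternates _ E1).
apply: (atomic_alternation (T := T) _ _ _ _ szp pn0 sxs e0 key) => //.
- move=> [|i] // /andP[_ im]; have [uA szA hA _] := rep i im; split=> //.
  move=> a b aA bA /=; have [_ ca] := hA a aA; have [_ cb] := hA b bA.
  have [[ee _ _ _ _] _ _ _] := h1 _ im.
  have -> : e i.+1 * (st (i, A i)).2 a * (e i.+1 * (st (i, A i)).2 b) =
    (e i.+1 * e i.+1) * ((st (i, A i)).2 a * (st (i, A i)).2 b) by ring.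
  by rewrite ee mul1r mulr_gt0.
- move=> i /andP[_ im]; case: (h2 i im) => h; [left|right] => a b aA bA;
    apply: h; [exact: AE (ltnW im) _ aA|exact: AE im _ bA|exact: AE (ltnW im) _ aA|exact: AE im _ bA].
- move=> m0; case: (h2 0%N m0) => h; [left|right] => a b aA bA;
    by apply: h; [exact: xsE|exact: (AE 1%N)].
Qed.

End RealSystems.

(** * Mixed orthogonality *)

Section MixedOrthogonality.
Context {R : realType}.
Local Open Scope classical_set_scope.
Notation fmeas := {finite_measure set (measurableTypeR R) -> \bar R}.
Notation int mu f := (Rintegral mu setT f).
Notation itg mu f := (mu.-integrable setT (EFin \o f)).

Lemma itg_dominated (mu : fmeas) (D : set (measurableTypeR R)) (f g : R -> R) :
  measurable D -> mu (~` D) = 0%E -> measurable_fun setT f ->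
  (forall t, D t -> `|f t| <= g t) -> itg mu g -> itg mu f.
Proof.
move=> mD muD mf fg ig; have mCD := measurableC mD.
have mf' : measurable_fun setT (EFin \o f) by apply/measurable_EFinP.
apply/(negligible_integrable mCD measurableT mf' muD); rewrite setTD setCK.
have igD := integrableS measurableT mD (@subsetT _ D) ig.
have mfD : measurable_fun D (EFin \o f) by apply: measurable_funS mf'.
apply: (le_integrable mD mfD _ igD) => t Dt.
by rewrite /= lee_fin (le_trans (fg t Dt)) // ler_norm.
Qed.

Lemma itg_norm (mu : fmeas) (f : R -> R) : itg mu f -> itg mu (fun t => `|f t|).
Proof. by move=> /integrable_abse; exact: eq_integrable. Qed.

Lemma nik_data_pos m (sigma : nat -> bcharge R) E mu e i : nik_data m sigma E mu e -> (i <= m)%N ->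
  (0 < (mu i : fmeas) setT)%E.
Proof.
move=> [h1 _ _ _ _] im; have [[_ _ _ vE _] infS _ _] := h1 i im.
have [x sx] : supp (sigma i) !=set0.
  by apply/set0P/eqP => s0; apply: infS; rewrite s0; exact: finite_set0.
by have := sx setT; rewrite vE //; apply; split => //; exact: openT.
Qed.

(** Far out on [E 0] the point [x] is on the side away from [E 1], hence at distance at least 1 from
    it, and the kernel is at most 1. *)
Lemma weight_bounded m (sigma : nat -> bcharge R) E mu e k : nik_data m sigma E mu e ->
  (k <= m)%N -> exists K C, forall x, E 0%N x -> K < `|x| -> `|nikw sigma 0 k x| <= C.
Proof.
move=> hd km; have [h1 h2 h3 h4 _] := hd.
case: k km => [|k] km; first by exists 0, 1 => x _ _; rewrite /nikw /= normr1.
have m0 : (0 < m)%N by exact: leq_ltn_trans km.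
have [x0 Ex0] : E 0%N !=set0.
  have [_ _ _ muE] := h1 0%N isT; exact: full_nonempty (nik_data_pos hd _) muE.
have [[ee _ _ vE _] infS mE muE] := h1 1%N m0.
have [b0 Eb0] : E 1%N !=set0 by exact: full_nonempty (nik_data_pos hd m0) muE.
have iw : itg (mu 1%N) (nikw sigma 1 k.+1) by exact: h3.
exists (`|x0| + `|b0| + 1), (int (mu 1%N) (fun t => `|nikw sigma 1 k.+1 t|)) => x Ex Kx.
have km' : (0 < k.+1 <= m)%N by [].
have [ik ->] := h4 0%N k.+1 x km' Ex.
(* Reproducing the integral and its majorant with the same atoms turns the estimate into a finite
   sum over points of [E 1]. *)
pose f l : R -> R := if l == 0%N then fun t => nikw sigma 1 k.+1 t * (x - t)^-1
  else fun t => `|nikw sigma 1 k.+1 t|.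
have [|A [c [_ _ AE sumA]]] := @many_atoms _ _ _ 0 2 f _ vE infS mE muE.
  by move=> [|i] _; [exact: ik|exact: itg_norm].
have := sumA 0%N isT; have := sumA 1%N isT; rewrite /f /= => <- <-.
have -> : `|e 1%N * \sum_(a <- A) c a * (nikw sigma 1 k.+1 a / (x - a))| =
    `|\sum_(a <- A) c a * (nikw sigma 1 k.+1 a / (x - a))|.
  have /eqP : `|e 1%N| ^+ 2 = 1 by rewrite -normrX expr2 ee normr1.
  by rewrite sqrp_eq1 ?normr_ge0 // normrM => /eqP ->; rewrite mul1r.
apply: le_trans (ler_norm_sum _ _ _) _; rewrite big_seq [leRHS]big_seq; apply: ler_sum => a aA.
have [Ea ca] := AE a aA; rewrite !normrM (gtr0_norm ca) ler_pM2l // ler_piMr //.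
have d1 : 1 <= `|x - a|.
  have y1 := ler_norm x0; have y2 := ler_norm (- x0).
  have y3 := ler_norm b0; have y4 := ler_norm (- b0); rewrite !normrN in y2 y4.
  have Kx' : (`|x0| + `|b0| + 1 < x) \/ (`|x0| + `|b0| + 1 < - x).
    by apply/orP; rewrite -lter_normr.
  rewrite ler_normr; case: (h2 0%N m0) => sep; have xb := sep _ _ Ex Eb0; have x0a := sep _ _ Ex0 Ea.
    by case: Kx' => Kx'; apply/orP; right; lra.
  by case: Kx' => Kx'; apply/orP; left; lra.
by rewrite normfV invf_le1 // (lt_le_trans _ d1).
Qed.

Section Real.
Variables (m1 m2 : nat) (sigma1 sigma2 : nat -> bcharge R).
Variables (E1 E2 : nat -> set (measurableTypeR R)) (mu1 mu2 : nat -> fmeas) (e1 e2 : nat -> R).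
Hypothesis hd1 : nik_data m1 sigma1 E1 mu1 e1.
Hypothesis hd2 : nik_data m2 sigma2 E2 mu2 e2.
Hypothesis same : forall A : set (measurableTypeR R), measurable A ->
  sigma1 0%N A = sigma2 0%N A.
Notation w1 := (nikw sigma1 0).
Notation w2 := (nikw sigma2 0).
Notation mu := (mu2 0%N).
Hypothesis mom : forall n, itg mu (fun x => x ^+ n).
Hypothesis iW : forall j k, (j <= m2)%N -> (k <= m1)%N -> itg mu (fun x => w2 j x * w1 k x).

Let E := E1 0%N `&` E2 0%N.

Lemma common_support : measurable E /\ mu (~` E) = 0%E.
Proof.
have [h1 _ _ _ _] := hd1; have [h2 _ _ _ _] := hd2.
have [[_ _ _ _ s1] _ mE1 muE1] := h1 0%N isT; have [[ee _ _ _ s2] _ mE2 muE2] := h2 0%N isT.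
split; first exact: measurableI.
apply/negligibleP; first by apply: measurableC; exact: measurableI.
rewrite /E setCI; apply: negligibleU; apply/negligibleP => //; try exact: measurableC.
have := same (measurableC mE1); rewrite s1 ?s2 //; try exact: measurableC.
rewrite muE1 mule0 => /esym/eqP; rewrite mule_eq0 => /orP[/eqP[e0]|/eqP//].
by move: ee; rewrite e0 mulr0 => /eqP; rewrite eq_sym oner_eq0.
Qed.

(** On a bounded part the power is bounded and [iW] applies; outside it both weights are bounded and
    [mom] applies. *)
Lemma moment_itg n j k : (j <= m2)%N -> (k <= m1)%N ->
  itg mu (fun x => x ^+ n * (w2 j x * w1 k x)).
Proof.
move=> jm km; have [mE muE] := common_support.
have [K1 [C1 b1]] := weight_bounded hd1 km; have [K2 [C2 b2]] := weight_bounded hd2 jm.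
pose K := `|K1| + `|K2|; have iw := iW jm km.
have ig : itg mu (fun x => K ^+ n * `|w2 j x * w1 k x| + `|C2| * `|C1| * `|x ^+ n|).
  have i1 := integrableZl measurableT (K ^+ n) (itg_norm iw).
  have i2 := integrableZl measurableT (`|C2| * `|C1|) (itg_norm (mom n)).
  by have := integrableD measurableT i1 i2; apply: eq_integrable.
apply: (itg_dominated mE muE) ig.
  apply: measurable_funM.
    by apply/measurable_EFinP; exact: measurable_int (mom n).
  by apply/measurable_EFinP; exact: measurable_int iw.
move=> x [E1x E2x]; rewrite normrM normrX.
case: (leP `|x| K) => xK.
  apply: (@le_trans _ _ (K ^+ n * `|w2 j x * w1 k x|)).
    by rewrite ler_wpM2r // lerXn2r ?nnegrE // addr_ge0.
  by rewrite lerDl !mulr_ge0 ?exprn_ge0.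
have K1x : K1 < `|x| by apply: le_lt_trans xK; rewrite (le_trans (ler_norm K1)) // lerDl.
have K2x : K2 < `|x| by apply: le_lt_trans xK; rewrite (le_trans (ler_norm K2)) // lerDr.
apply: (@le_trans _ _ (`|C2| * `|C1| * `|x| ^+ n)); last first.
  by rewrite lerDr mulr_ge0 // exprn_ge0 // addr_ge0.
rewrite mulrC ler_wpM2r ?exprn_ge0 // normrM ler_pM //.
  by rewrite (le_trans (b2 x E2x K2x)) // ler_norm.
by rewrite (le_trans (b1 x E1x K1x)) // ler_norm.
Qed.

Definition row_form (a : nat -> {poly R}) x := \sum_(k < m1.+1) (a k).[x] * w1 k x.

Lemma row_integral (a : nat -> {poly R}) j nu : (j <= m2)%N ->
  itg mu (fun x => x ^+ nu * (w2 j x * row_form a x)) /\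
  int mu (fun x => x ^+ nu * (w2 j x * row_form a x)) =
    \sum_(k < m1.+1) \sum_(i < size (a k)) (a k)`_i * int mu (fun x => x ^+ (nu + i) * (w2 j x * w1 k x)).
Proof.
move=> jm.
pose g k x := \sum_(i < size (a k)) (a k)`_i * (x ^+ (nu + i) * (w2 j x * w1 k x)).
have inner k : (k < m1.+1)%N -> itg mu (g k) /\
   int mu (g k) =
   \sum_(i < size (a k)) (a k)`_i * int mu (fun x => x ^+ (nu + i) * (w2 j x * w1 k x)).
  move=> km; apply: (int_sum (fun i => (a k)`_i) (f := fun i x => x ^+ (nu + i) * (w2 j x * w1 k x))).
  by move=> i _; exact: moment_itg.
have -> : (fun x => x ^+ nu * (w2 j x * row_form a x)) = (fun x => \sum_(k < m1.+1) 1 *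
    \sum_(i < size (a k)) (a k)`_i * (x ^+ (nu + i) * (w2 j x * w1 k x))).
  apply/funext => x; rewrite /row_form !mulr_sumr; apply: eq_bigr => k _.
  rewrite mul1r horner_coef mulr_suml !mulr_sumr; apply: eq_bigr => i _.
  by rewrite exprD; ring.
have [|h1 h2] := int_sum (mu := mu) (fun=> 1) (r := m1.+1) (f := g).
  by move=> k km; have [] := inner k km.
split; first exact: h1.
by rewrite h2; apply: eq_bigr => k _; rewrite mul1r; have [] := inner k (ltn_ord k).
Qed.

Lemma mixed_core (n1 n2 : nat -> nat) (a : nat -> {poly R}) :
  (\sum_(k < m1.+1) n1 k = (\sum_(j < m2.+1) n2 j).+1)%N ->
  (forall k, (k <= m1)%N -> (size (a k) <= n1 k)%N) ->
  (exists2 k, (k <= m1)%N & (size (a k) < n1 k)%N) ->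
  (forall j nu, (j <= m2)%N -> (nu < n2 j)%N ->
     int mu (fun x => x ^+ nu * (w2 j x * row_form a x)) = 0) ->
  forall k, (k <= m1)%N -> a k = 0.
Proof.
move=> nN sza [k0 k0m k0lt] orth k km; apply/eqP; apply: contraT => ak0.
pose N := (\sum_(j < m2.+1) n2 j)%N; pose D := N.+1; pose F := row_form a.
have [mE muE] := common_support.
(* The deficient size at [k0] uses up the unit by which [n1] exceeds [n2] in total. *)
have sumsz : (\sum_(k < m1.+1) size (a k) <= N)%N.
  rewrite -ltnS -nN; have k0m' : (k0 < m1.+1)%N by [].
  rewrite (bigD1 (Ordinal k0m')) //= [X in (_ < X)%N](bigD1 (Ordinal k0m')) //=.
  by rewrite -addSn leq_add // leq_sum // => i _; rewrite sza // -ltnS.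
have [h2 _ _ _ iE2] := hd2; have [[_ _ _ vE _] infS _ _] := h2 0%N isT.
pose f l x := x ^+ (l %% D) * (w2 (l %/ D)%N x * F x).
(* With [N.+2] atoms [F] cannot vanish at all of them, and a second atom is at hand for [be0]. The
   index [l] encodes a row and a power. *)
have [|A [c [uA szA AE sumA]]] := @many_atoms _ _ _ N.+2 (m2.+1 * D)%N f _ vE infS mE muE.
  move=> l lm; have jm : (l %/ D <= m2)%N by rewrite -ltnS ltn_divLR.
  by have [] := row_integral a (l %% D) jm.
pose Y := sort <=%R A.
have sY : sorted <%R Y by rewrite sort_lt_sorted.
have YA y : (y \in Y) = (y \in A) by rewrite mem_sort.
have szY : (N.+2 <= size Y)%N by rewrite size_sort.
have sumY j nu : (j <= m2)%N -> (nu < n2 j)%N ->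
    \sum_(y <- Y) c y * (y ^+ nu * (w2 j y * F y)) = 0.
  move=> jm nun; have nuD : (nu < D)%N.
    by rewrite ltnS (leq_trans (ltnW nun)) //; exact: sum_le_term.
  rewrite (perm_big A) /=; last by rewrite perm_sort.
  have lE : f (j * D + nu)%N = fun x => x ^+ nu * (w2 j x * F x).
    by rewrite /f modnMDl modn_small // divnMDl // divn_small // addn0.
  have lD : (j * D + nu < m2.+1 * D)%N.
    apply: (@leq_trans (j.+1 * D)); first by rewrite mulSn [X in (_ < X)%N]addnC ltn_add2l.
    by rewrite leq_mul2r ltnS jm orbT.
  by have := sumA _ lD; rewrite lE orth.
have YE1 y : y \in Y -> E1 0%N y by rewrite YA => /AE[[]].
have YE2 y : y \in Y -> E2 0%N y by rewrite YA => /AE[[]].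
have c0 y : y \in Y -> 0 < c y by rewrite YA => /AE[].
have hF : has (fun y => F y != 0) Y.
  apply: contraT => /hasPn h; have F0 : {in Y, forall y, F y = 0}.
    by move=> y /h; rewrite negbK => /eqP.
  have := nikishin_alternation hd1 YE1 sY (fun k _ => leqnn (size (a k)))
    (ex_intro2 _ _ k km ak0) (oner_neq0 _) (alternates0 1 F0).
  by move=> /leq_trans/(_ sumsz); rewrite leqNgt ltnW.
have dense : forall x y : R, x < y -> exists2 r, x < r < y & True.
  by move=> x y xy; exists ((x + y) / 2) => //; apply/andP; split; lra.
have [s [z [e [ss hs [subz szz ee altz] sgn]]]] := sign_changes dense sY hF.
have zE1 y : y \in z -> E1 0%N y by move=> /(mem_subseq subz); exact: YE1.
have e0 : e != 0 by apply: contraTneq (oner_neq0 R) => e0; rewrite -ee e0 mulr0 eqxx.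
have dN : ((size s).+1 <= N)%N.
  rewrite -szz; apply: leq_trans sumsz.
  exact: (nikishin_alternation hd1 zE1 (subseq_sorted lt_trans subz sY) (fun k _ => leqnn (size (a k)))
    (ex_intro2 _ _ k km ak0) e0 altz).
(* The degrees are shrunk to total [size s + 1]: enough for a nontrivial [B] vanishing on [s], and
   by the alternation bound too little for [B] to alternate at two further points. *)
have [n' [n'n n'S]] := sub_multi dN.
have [|b [szb bn0 bs]] := @poly_solution R m2 n' (size s) (fun l j i => (nth 0 s l) ^+ i * w2 j (nth 0 s l)).
  by rewrite n'S.
pose B x := \sum_(j < m2.+1) (b j).[x] * w2 j x.
have BE x : B x = \sum_(j < m2.+1) \sum_(i < n' j) (b j)`_i * (x ^+ i * w2 j x).
  apply: eq_bigr => j _; rewrite (horner_coef_wide _ (szb j)) mulr_suml.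
  by apply: eq_bigr => i _; rewrite mulrA.
have Bs : {in s, forall r, B r = 0}.
  move=> r rs; have ix : (index r s < size s)%N by rewrite index_mem.
  rewrite BE -[RHS](bs (Ordinal ix)) /= nth_index //.
  by apply: eq_bigr => j _; apply: eq_bigr => i _; rewrite mulrC.
have Ys y : y \in Y -> y \notin s.
  by move=> yY; apply/negP => /hs[_ nY _ _]; rewrite yY in nY.
(* Otherwise [alternates_two] would make [B] alternate at [size s + 2] points. This also shows that
   [B] has no zero among the atoms. *)
have pairs y y' : y \in Y -> y' \in Y -> y < y' ->
    0 < ((rootp s).[y] * B y) * ((rootp s).[y'] * B y').
  move=> yY y'Y yy'; rewrite ltNge; apply/negP => le0.
  have [xs [e' [sxs pxs e'0 altx]]] := alternates_two ss yy' (Ys _ yY) (Ys _ y'Y) Bs le0.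
  have xE2 x : x \in xs -> E2 0%N x.
    rewrite (perm_mem pxs) !inE => /or3P[/eqP->|/eqP->|/hs[_ _ [u uY ux] [v vY xv]]].
    - exact: YE2.
    - exact: YE2.
    - by apply: (iE2 u v (YE2 _ uY) (YE2 _ vY)); rewrite !ltW.
  have := nikishin_alternation hd2 xE2 sxs (fun k _ => szb k) bn0 e'0 altx.
  by rewrite n'S (perm_size pxs) /= ltnn.
have /hasP[y0 y0Y /= Fy0] := hF.
pose be := (rootp s).[y0] * B y0.
have pairs0 y : y \in Y -> y != y0 -> 0 < be * ((rootp s).[y] * B y).
  by move=> yY; case: (ltgtP y y0) => // h _; [rewrite mulrC|]; exact: pairs.
have be0 : be != 0.
  have [y1 y1Y y10] : exists2 y1, y1 \in Y & y1 != y0.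
    apply/hasP; apply: contraT => /hasPn h.
    have : (size Y <= size [:: y0])%N.
      apply: uniq_leq_size; first by rewrite sort_uniq.
      by move=> y yY; rewrite inE; have := h y yY; rewrite negbK.
    by move=> /(leq_trans szY).
  by apply: contraTneq (pairs0 _ y1Y y10) => ->; rewrite mul0r ltxx.
have pos y : y \in Y -> 0 < be * ((rootp s).[y] * B y).
  move=> yY; have [->|] := eqVneq y y0; last exact: pairs0.
  by rewrite -expr2 exprn_even_gt0.
pose ka := e * (-1) ^+ size s.
have ka0 : ka != 0 by rewrite mulf_neq0 // expf_neq0 // oppr_eq0 oner_neq0.
pose g y := c y * (ka * be * (B y * F y)).
have g0 y : y \in Y -> 0 <= g y.
  move=> yY; rewrite mulr_ge0 ?(ltW (c0 _ yY)) //.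
  have s0 : 0 < (rootp s).[y] ^+ 2 by rewrite exprn_even_gt0 //= rootp_root Ys.
  rewrite -(pmulr_lge0 _ s0).
  have -> : ka * be * (B y * F y) * (rootp s).[y] ^+ 2 =
    (ka * ((rootp s).[y] * F y)) * (be * ((rootp s).[y] * B y)) by ring.
  by apply: mulr_ge0; [exact: sgn|apply: ltW; exact: pos].
have gy0 : g y0 != 0.
  have B0 : B y0 != 0 by apply: contraNneq be0 => h; rewrite /be h mulr0.
  have cy0 : c y0 != 0 by rewrite gt_eqF // c0.
  by apply: mulf_neq0 => //; apply: mulf_neq0; exact: mulf_neq0.
have : 0 < \sum_(y <- Y) g y by exact: ge0_sum_gt0 g0 y0Y gy0.
have -> : \sum_(y <- Y) g y = ka * be * \sum_(j < m2.+1) \sum_(i < n' j)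
    (b j)`_i * \sum_(y <- Y) c y * (y ^+ i * (w2 j y * F y)).
  under [in RHS]eq_bigr => j _ do under eq_bigr => i _ do rewrite mulr_sumr.
  under [in RHS]eq_bigr => j _ do rewrite exchange_big /=.
  rewrite exchange_big /= mulr_sumr; apply: eq_bigr => y _.
  rewrite /g BE mulrCA; congr (_ * _); rewrite mulr_suml mulr_sumr.
  apply: eq_bigr => j _; rewrite mulr_suml mulr_sumr; apply: eq_bigr => i _.
  by ring.
rewrite big1 ?mulr0 ?ltxx // => j _; rewrite big1 // => i _.
have jm : (j <= m2)%N := ltn_ord j.
have i2 : (i < n2 j)%N := leq_trans (ltn_ord i) (n'n j).
by rewrite sumY ?mulr0.
Qed.

End Real.
End MixedOrthogonality.

(** * Formal expansions and complex coefficients *)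

Section MixedVectors.
Context {K : fieldType}.
Implicit Types (A : nat -> {poly K}).

Lemma sum_coef_widen (p : {poly K}) (g : nat -> K) n : (size p <= n)%N ->
  \sum_(i < size p) g i * p`_i = \sum_(i < n) g i * p`_i.
Proof.
move=> pn; rewrite (big_ord_widen _ (fun i => g i * p`_i) pn) big_mkcond /=.
apply: eq_bigr => i _; case: ltnP => // h; by rewrite nth_default ?mulr0.
Qed.

Lemma fmul_expansion_neg (c : nat -> K) (p : {poly K}) nu :
  fmul (expansion c) p (Negz nu) = \sum_(i < size p) c (nu + i)%N * p`_i.
Proof.
apply: eq_bigr => i _; congr (_ * _).
by have -> : Negz nu - i%:Z = Negz (nu + i) by rewrite !NegzE; lia.
Qed.

Lemma fmul_expansion_large (c : nat -> K) (p : {poly K}) q : (size p <= q)%N ->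
  fmul (expansion c) p q%:Z = 0.
Proof.
move=> pq; rewrite /fmul big1 // => i _; have iq : (i <= q)%N.
  by rewrite ltnW // (leq_trans (ltn_ord i)).
by rewrite subzn // mul0r.
Qed.

(** The polynomial part [B] can absorb precisely the nonnegative powers of [z]; the conditions left
    are those on the coefficients of [z^(-nu-1)] with [nu < n2 j]. *)
Lemma mixed_vectorP p q (c : 'I_q -> 'I_p -> nat -> K) (F : 'M[fseries K]_(q, p)) n1 n2
    (A : 'rV[{poly K}]_p) : (forall j k, F j k = expansion (c j k)) ->
  mixed_vector F n1 n2 A <-> [/\ A != 0, forall k, (size (A ord0 k) <= n1 k)%N &
    forall j nu, (nu < n2 j)%N ->
      \sum_k \sum_(i < n1 k) c j k (nu + i)%N * (A ord0 k)`_i = 0].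
Proof.
move=> FE.
have eqn j nu : (forall k, (size (A ord0 k) <= n1 k)%N) ->
    \sum_k fmul (F j k) (A ord0 k) (Negz nu) =
    \sum_k \sum_(i < n1 k) c j k (nu + i)%N * (A ord0 k)`_i.
  move=> szA; apply: eq_bigr => k _; rewrite FE fmul_expansion_neg.
  exact: (sum_coef_widen (fun i => c j k (nu + i)%N)).
split=> [[A0 szA [B hB]]|[A0 szA orth]]; split=> //.
  move=> j nu nun; rewrite -eqn //; have := hB j (Negz nu).
  by rewrite subr0; apply; rewrite NegzE ltrN2.
pose D := (\sum_k size (A ord0 k))%N.
exists (\row_j \poly_(e < D) \sum_k fmul (F j k) (A ord0 k) e%:Z) => j [e|nu] he.
  rewrite mxE /= coef_poly; case: ltnP => [_|De]; first by rewrite subrr.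
  rewrite subr0 big1 // => k _; rewrite FE fmul_expansion_large // (leq_trans _ De) //.
  by rewrite /D (bigD1 k) //= leq_addr.
by rewrite /= subr0 eqn // orth //; move: he; rewrite NegzE ltrN2.
Qed.

End MixedVectors.

(** * Uniqueness and existence with complex coefficients *)

Section ComplexSystem.
Context {R : realType}.
Local Open Scope classical_set_scope.
Notation fmeas := {finite_measure set (measurableTypeR R) -> \bar R}.
Notation int mu f := (Rintegral mu setT f).
Notation itg mu f := (mu.-integrable setT (EFin \o f)).
Variables (m1 m2 : nat) (sigma1 sigma2 : nat -> bcharge R).
Hypothesis nik1 : nikishin m1 sigma1.
Hypothesis nik2 : nikishin m2 sigma2.
Hypothesis compat : compatible m1 m2 sigma1 sigma2.
Hypothesis mom0 : forall N, finite_moments N (sigma2 0%N).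
Notation w1 := (nikw sigma1 0).
Notation w2 := (nikw sigma2 0).

Definition wmoment (j k n : nat) : R :=
  cint (sigma2 0%N) (fun x => x ^+ n * (w2 j x * w1 k x)).

Lemma WmxE x (j : 'I_m2.+1) (k : 'I_m1.+1) : Wmx m1 m2 sigma1 sigma2 x j k = w2 j x * w1 k x.
Proof. by rewrite mxE big_ord1 !mxE. Qed.

Lemma ShatE j k : Shat m1 m2 sigma1 sigma2 j k = expansion (fun n => (wmoment j k n)%:C%C).
Proof.
rewrite mxE; congr expansion; apply/funext => n; congr (_%:C)%C.
by congr cint; apply/funext => x; rewrite WmxE.
Qed.

Lemma real_unique (n1 n2 : nat -> nat) (a : nat -> {poly R}) :
  (\sum_(k < m1.+1) n1 k = (\sum_(j < m2.+1) n2 j).+1)%N ->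
  (forall k, (k <= m1)%N -> (size (a k) <= n1 k)%N) ->
  (exists2 k, (k <= m1)%N & (size (a k) < n1 k)%N) ->
  (forall j nu, (j <= m2)%N -> (nu < n2 j)%N ->
     \sum_(k < m1.+1) \sum_(i < n1 k) wmoment j k (nu + i) * (a k)`_i = 0) ->
  forall k, (k <= m1)%N -> a k = 0.
Proof.
have [E1 [mu1 [e1 hd1]]] := nikishin_data nik1.
have [E2 [mu2 [e2 hd2]]] := nikishin_data nik2.
have [h2 _ _ _ _] := hd2; have [[_ L1E cE _ _] _ _ _] := h2 0%N isT.
have [same iW] := compat.
have mom n : itg (mu2 0%N) (fun x => x ^+ n).
  by apply/L1E; exact: (mom0 (ltnSn n)).
have {}iW j k : (j <= m2)%N -> (k <= m1)%N -> itg (mu2 0%N) (fun x => w2 j x * w1 k x).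
  move=> jm km; apply/L1E; have jm' : (j < m2.+1)%N by []. have km' : (k < m1.+1)%N by [].
  have := iW (Ordinal jm') (Ordinal km'); congr L1.
  by apply/funext => x; rewrite WmxE.
move=> nN sza strict orth; apply: (mixed_core hd1 hd2 same mom iW nN sza strict).
move=> j nu jm nun; have [_ ->] := row_integral hd1 hd2 same mom iW a nu jm.
have := orth j nu jm nun; have [[ee _ _ _ _] _ _ _] := h2 0%N isT.
have e0 : e2 0%N != 0.
  by apply: contraTneq (oner_neq0 R) => e0; rewrite -ee e0 mulr0 eqxx.
move=> h; apply: (mulfI e0); rewrite mulr0 -[RHS]h mulr_sumr; apply: eq_bigr => k _.
have kn : (size (a k) <= n1 k)%N by apply: sza; rewrite -ltnS.
rewrite -(sum_coef_widen (fun i => wmoment j k (nu + i)) kn) mulr_sumr.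
by apply: eq_bigr => i _; rewrite /wmoment cE; ring.
Qed.

Lemma complex_unique (n1 n2 : nat -> nat) (A : nat -> {poly R[i]%C}) :
  (\sum_(k < m1.+1) n1 k = (\sum_(j < m2.+1) n2 j).+1)%N ->
  (forall k, (k <= m1)%N -> (size (A k) <= n1 k)%N) ->
  (exists2 k, (k <= m1)%N & (size (A k) < n1 k)%N) ->
  (forall j nu, (j <= m2)%N -> (nu < n2 j)%N ->
     \sum_(k < m1.+1) \sum_(i < n1 k) (wmoment j k (nu + i))%:C%C * (A k)`_i = 0) ->
  forall k, (k <= m1)%N -> A k = 0.
Proof.
move=> nN szA [k0 k0m k0lt] orth k km.
(* The moments are real, so any additive, real-homogeneous map such as the real or imaginary part
   carries a solution to a real solution. *)
have part (pr : R[i]%C -> R) : {morph pr : x y / x + y} -> pr 0 = 0 ->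
    (forall (r : R) x, pr (r%:C%C * x) = r * pr x) -> forall i, pr (A k)`_i = 0.
  move=> prD pr0 prZ i; pose a k : {poly R} := \poly_(i < size (A k)) pr (A k)`_i.
  have aE k' i' : (a k')`_i' = pr (A k')`_i'.
    by rewrite coef_poly; case: ltnP => // h; rewrite nth_default.
  have a_le k' : (size (a k') <= size (A k'))%N by exact: size_poly.
  rewrite -aE (@real_unique n1 n2 a nN) ?coef0 //.
  - by move=> k' k'm; rewrite (leq_trans (a_le k')) // szA.
  - by exists k0 => //; exact: leq_ltn_trans k0lt.
  move=> j nu jm nun; rewrite -[RHS]pr0 -(orth j nu jm nun) (big_morph pr prD pr0).
  apply: eq_bigr => k' _; rewrite (big_morph pr prD pr0); apply: eq_bigr => i' _.
  by rewrite prZ aE.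
apply/polyP => i; rewrite coef0.
have re0 : complex.Re (A k)`_i = 0.
  apply: (part (@complex.Re R)) => //; first by move=> [? ?] [? ?].
  by move=> r [u v] /=; ring.
have im0 : complex.Im (A k)`_i = 0.
  apply: (part (@complex.Im R)) => //; first by move=> [? ?] [? ?].
  by move=> r [u v] /=; ring.
by move: re0 im0; case: ((A k)`_i) => u v /= -> ->.
Qed.

(** One homogeneous equation for each pair of a row [j] and a power [nu < n2 j], and one unknown
    more than equations. *)
Lemma complex_exists (n1 n2 : nat -> nat) :
  (\sum_(k < m1.+1) n1 k = (\sum_(j < m2.+1) n2 j).+1)%N ->
  exists A : nat -> {poly R[i]%C}, [/\ forall k, (size (A k) <= n1 k)%N,
    exists2 k, (k <= m1)%N & A k != 0 &
    forall j nu, (j <= m2)%N -> (nu < n2 j)%N ->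
     \sum_(k < m1.+1) \sum_(i < n1 k) (wmoment j k (nu + i))%:C%C * (A k)`_i = 0].
Proof.
move=> nN; pose s := [seq (j, nu) | j <- iota 0 m2.+1, nu <- iota 0 (n2 j)].
have sz : size s = (\sum_(j < m2.+1) n2 j)%N.
  rewrite size_allpairs_dep sumnE big_map -(big_mkord xpredT n2) /index_iota subn0.
  by apply: eq_bigr => j _; rewrite size_iota.
have [|A [szA An0 hA]] := @poly_solution R[i]%C m1 n1 (size s)
    (fun l k i => (wmoment (nth (0, 0)%N s l).1 k ((nth (0, 0)%N s l).2 + i))%:C%C).
  by rewrite sz nN.
exists A; split=> // j nu jm nun.
have js : (j, nu) \in s.
  by apply/allpairsPdep; exists j, nu; split=> //; rewrite mem_iota.
have ix : (index (j, nu) s < size s)%N by rewrite index_mem.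
by have := hA (Ordinal ix); rewrite /= nth_index.
Qed.

End ComplexSystem.

Theorem theorem1p3 (R : realType) (m1 m2 : nat)
    (sigma1 sigma2 : nat -> bcharge R)
    (nik1 : nikishin m1 sigma1) (nik2 : nikishin m2 sigma2)
    (compat : compatible m1 m2 sigma1 sigma2)
    (mom1 : forall k, (1 <= k <= m1)%N -> finite_moments (2 ^ k + 1) (sigma1 k))
    (mom2 : forall k, (1 <= k <= m2)%N -> finite_moments (2 ^ k + 1) (sigma2 k))
    (mom0 : forall N, finite_moments N (sigma2 0%N)) :
  mixed_perfect (Shat m1 m2 sigma1 sigma2) /\
  (forall (n1 : 'I_m1.+1 -> nat) (n2 : 'I_m2.+1 -> nat),
     (\sum_k n1 k = (\sum_j n2 j).+1)%N ->
     exists A : 'rV[{poly R[i]}]_m1.+1,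
       mixed_vector (Shat m1 m2 sigma1 sigma2) n1 n2 A /\
       forall A' : 'rV[{poly R[i]}]_m1.+1,
         mixed_vector (Shat m1 m2 sigma1 sigma2) n1 n2 A' ->
         exists2 c : R[i], c != 0 & A' = c%:P *: A).
Proof.
pose ext m (n : 'I_m.+1 -> nat) k := n (inord k).
have extE m (n : 'I_m.+1 -> nat) (k : 'I_m.+1) : ext m n k = n k by rewrite /ext inord_val.
have extS m (n : 'I_m.+1 -> nat) : (\sum_(k < m.+1) ext m n k = \sum_k n k)%N.
  by apply: eq_bigr => k _; rewrite extE.
have mvP n1 n2 A := mixed_vectorP n1 n2 A (@ShatE R m1 m2 sigma1 sigma2).
have zero (n1 : 'I_m1.+1 -> nat) (n2 : 'I_m2.+1 -> nat) (A : 'rV[{poly R[i]}]_m1.+1) k0 :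
    (\sum_k n1 k = (\sum_j n2 j).+1)%N ->
    (forall k, (size (A ord0 k) <= n1 k)%N) -> (size (A ord0 k0) < n1 k0)%N ->
    (forall (j : 'I_m2.+1) nu, (nu < n2 j)%N -> \sum_k \sum_(i < n1 k)
       (wmoment sigma1 sigma2 j k (nu + i))%:C%C * (A ord0 k)`_i = 0) -> A = 0.
  move=> nN szA ltk0 orth; apply/rowP => k; rewrite mxE.
  have := complex_unique nik1 nik2 compat mom0 (n1 := ext m1 n1) (n2 := ext m2 n2)
    (A := fun k => A ord0 (inord k)); rewrite !extS => /(_ nN) h.
  rewrite -[in LHS](inord_val k); apply: h; last exact: (ltn_ord k).
  - by move=> k' _; exact: szA.
  - by exists (nat_of_ord k0); [exact: (ltn_ord k0)|rewrite inord_val extE].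
  move=> j nu jm nun; rewrite -[RHS](orth (inord j) nu nun); apply: eq_bigr => k' _.
  by rewrite extE inord_val inordK.
have perfect : mixed_perfect (Shat m1 m2 sigma1 sigma2).
  move=> n1 n2 nN A /mvP[A0 szA orth] k; apply/eqP; rewrite eqn_leq szA /= leqNgt.
  by apply: contra A0 => ltk; apply/eqP; exact: (zero n1 n2 A k).
split=> // n1 n2 nN.
have nN' : (\sum_(k < m1.+1) ext m1 n1 k = (\sum_(j < m2.+1) ext m2 n2 j).+1)%N by rewrite !extS.
have [B [szB [k1 k1m Bk1] orthB]] := complex_exists sigma1 sigma2 nN'.
pose A : 'rV[{poly R[i]}]_m1.+1 := \row_k B k.
have mvA : mixed_vector (Shat m1 m2 sigma1 sigma2) n1 n2 A.
  apply/mvP; split.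
  - have k1m' : (k1 < m1.+1)%N by [].
    by apply: contraNneq Bk1 => /rowP/(_ (Ordinal k1m')); rewrite !mxE => /= ->.
  - by move=> k; rewrite mxE -(extE m1 n1 k).
  move=> j nu nun; have nun' : (nu < ext m2 n2 j)%N by rewrite extE.
  rewrite -[RHS](orthB j nu (ltn_ord j) nun').
  by apply: eq_bigr => k _; rewrite mxE extE.
exists A; split=> // A' mvA'.
(* The total of [n1] is at least 1; by normality both solutions have full degree in such a
   component. *)
have [k0 k0n] : exists k0, (0 < n1 k0)%N.
  apply/existsP; apply: contraT; rewrite negb_exists => /forallP h.
  by move: nN; rewrite big1 // => k _; apply/eqP; have := h k; rewrite lt0n negbK.
have szA0 := perfect n1 n2 nN A mvA k0; have szA'0 := perfect n1 n2 nN A' mvA' k0.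
pose l := lead_coef (A ord0 k0); pose l' := lead_coef (A' ord0 k0).
have l0 : l != 0 by rewrite lead_coef_eq0 -size_poly_gt0 szA0.
have l'0 : l' != 0 by rewrite lead_coef_eq0 -size_poly_gt0 szA'0.
(* This factor cancels the leading terms in component [k0], so the difference is deficient there and
   vanishes by [zero]. *)
exists (l' / l); first by rewrite mulf_neq0 ?invr_eq0.
have [_ szA orthA] := (mvP n1 n2 A).1 mvA; have [_ szA' orthA'] := (mvP n1 n2 A').1 mvA'.
pose c := l' / l; apply/eqP; rewrite -subr_eq0; apply/eqP.
have coefE k i : ((A' - c%:P *: A) ord0 k)`_i = (A' ord0 k)`_i - c * (A ord0 k)`_i.
  by rewrite 3!mxE coefB coefCM.
have szD k : (size ((A' - c%:P *: A)%R ord0 k) <= n1 k)%N.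
  apply/leq_sizeP => i ni; rewrite coefE !nth_default ?mulr0 ?subr0 //.
    exact: leq_trans (szA k) ni.
  exact: leq_trans (szA' k) ni.
apply: (zero n1 n2 _ k0 nN szD).
  rewrite -(prednK k0n) ltnS; apply/leq_sizeP => i; rewrite leq_eqVlt => /predU1P[<-|ni].
    rewrite coefE -{1}szA'0 -szA0 -!/(lead_coef _) -/l -/l' /c.
    by rewrite divfK // subrr.
  apply: nth_default; apply: leq_trans (szD k0) _; by rewrite -(prednK k0n).
move=> j nu nun; have e1 := orthA j nu nun; have e2 := orthA' j nu nun.
transitivity ((\sum_k \sum_(i < n1 k) (wmoment sigma1 sigma2 j k (nu + i))%:C%C * (A' ord0 k)`_i) -
   c * (\sum_k \sum_(i < n1 k) (wmoment sigma1 sigma2 j k (nu + i))%:C%C * (A ord0 k)`_i)).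
  rewrite mulr_sumr -sumrB; apply: eq_bigr => k _; rewrite mulr_sumr -sumrB.
  by apply: eq_bigr => i _; rewrite coefE; ring.
by rewrite e1 e2 mulr0 subr0.
Qed.
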